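(* A group is isomorphic to a finite generalized $J$-group if and only if it is isomorphic to a complex reflection group of rank two.
   Context: For $p\geqslant 1$ and a tuple $K=(k_1,\dots,k_p)$ with entries in $\mathbb{N}_{\geqslant 2}\cup\{\infty\}$, let $J(K)=\langle s_1,\dots,s_p\mid s_1s_2\cdots s_p=s_2\cdots s_ps_1=\cdots=s_ps_1\cdots s_{p-1},\ s_i^{k_i}=1 \text{ for all } i \text{ with } k_i<\infty\rangle$. If $K'=(k'_1,\dots,k'_p)$ is a tuple of positive integers with $k'_i$ dividing $k_i$ for all $i$ (every positive integer divides $\infty$), the generalized $J$-group $J\binom{K}{K'}$ is the normal closure of $\{s_1^{k'_1},\dots,s_p^{k'_p}\}$ in $J(K)$. A generalized $J$-group is any group of this form. A complex reflection group of rank two is a finite subgroup of $GL_2(\mathbb{C})$ generated by complex reflections, i.e. by elements of finite order whose fixed space in $\mathbb{C}^2$ is a line; reducible groups (products of at most two cyclic groups, including the degenerate ones) are allowed. *)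

(* Defs.v *)
From HB Require Import structures.
From mathcomp Require Import all_boot all_order all_algebra.
From mathcomp Require Import generic_quotient.
From mathcomp Require Import complex.
From mathcomp Require Import boolp classical_sets functions cardinality reals.

Set Implicit Arguments.
Unset Strict Implicit.
Unset Printing Implicit Defensive.

Local Open Scope classical_set_scope.
Local Open Scope group_scope.
Local Open Scope quotient_scope.

Section Subgroups.
Variable G : groupType.
Implicit Types H S : set G.

Definition is_subgroup H := H 1 /\ forall x y, H x -> H y -> H (x / y).

Definition is_normal_subgroup H :=
  is_subgroup H /\ forall x y, H x -> H (x ^ y).

Definition generated S : set G := smallest is_subgroup S.

Definition normal_closure S : set G := smallest is_normal_subgroup S.

End Subgroups.

Definition isomorphic_to (G H : groupType) (A : set H) :=
  exists f : {multiplicative G -> H}, set_bij [set: G] A f.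

(* The letter (x, false) stands for the generator x, (x, true) for x^-1. *)
Definition word (X : Type) := seq (X * bool).

Section Presentation.
Variables (X : choiceType) (rel : word X -> word X -> Prop).
Implicit Types u v w : word X.

Inductive word_cong : word X -> word X -> Prop :=
| WordRel u v of rel u v : word_cong u v
| WordCancel x b : word_cong [:: (x, b); (x, ~~ b)] [::]
| WordCat u u' v v' of word_cong u u' & word_cong v v' :
    word_cong (u ++ v) (u' ++ v')
| WordRefl u : word_cong u u
| WordSym u v of word_cong u v : word_cong v u
| WordTrans u v w of word_cong u v & word_cong v w : word_cong u w.

Definition word_eqv u v := `[< word_cong u v >].

Lemma word_eqv_refl : reflexive word_eqv.
Proof. by move=> u; apply/asboolP; exact: WordRefl. Qed.

Lemma word_eqv_sym : symmetric word_eqv.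
Proof. by move=> u v; apply/asboolP/asboolP => /WordSym. Qed.

Lemma word_eqv_trans : transitive word_eqv.
Proof.
by move=> v u w /asboolP uv /asboolP vw; apply/asboolP; exact: WordTrans vw.
Qed.

Canonical word_eqv_equiv :=
  EquivRel word_eqv word_eqv_refl word_eqv_sym word_eqv_trans.

(* The group with generators x : X and relations u = v for all u, v such that *)
(* rel u v.                                                                   *)
Definition presented := {eq_quot word_eqv}.

HB.instance Definition _ := Choice.on presented.
HB.instance Definition _ := EqQuotient.on presented.

Definition word_inv w : word X := rev [seq (a.1, ~~ a.2) | a <- w].

Definition presented_of_word w : presented := \pi w.

Lemma presented_of_wordP u v :
  presented_of_word u = presented_of_word v <-> word_cong u v.
Proof.
split=> [/eqmodP/asboolP //|uv].
by apply/eqmodP/asboolP.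
Qed.

Definition presented_one : presented := presented_of_word [::].
Definition presented_mul (a b : presented) : presented :=
  presented_of_word (repr a ++ repr b).
Definition presented_inv (a : presented) : presented :=
  presented_of_word (word_inv (repr a)).

Lemma presented_of_wordK a : presented_of_word (repr a) = a.
Proof. exact: reprK. Qed.

Lemma repr_cong w : word_cong (repr (presented_of_word w)) w.
Proof. by apply/presented_of_wordP; rewrite presented_of_wordK. Qed.

Lemma presented_mulE u v :
  presented_mul (presented_of_word u) (presented_of_word v)
  = presented_of_word (u ++ v).
Proof. by apply/presented_of_wordP/WordCat; exact: repr_cong. Qed.

Lemma word_inv_cons x b w : word_inv ((x, b) :: w) = word_inv w ++ [:: (x, ~~ b)].
Proof. by rewrite /word_inv /= rev_cons -cats1. Qed.

Lemma word_invV w : word_cong (word_inv w ++ w) [::].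
Proof.
elim: w => [|[x b] w IHw]; first exact: WordRefl.
rewrite word_inv_cons -catA /=; apply: WordTrans IHw.
apply: WordCat; first exact: WordRefl.
rewrite -[X in word_cong _ X]cat0s -cat1s -[_ :: w]cat1s catA.
apply: WordCat; last exact: WordRefl.
by have := WordCancel x (~~ b); rewrite negbK.
Qed.

Lemma word_Vinv w : word_cong (w ++ word_inv w) [::].
Proof.
elim: w => [|[x b] w IHw]; first exact: WordRefl.
rewrite word_inv_cons -cat1s -catA (catA w).
apply: WordTrans (WordCancel x b).
rewrite -[X in word_cong _ X]/([:: (x, b)] ++ [::] ++ [:: (x, ~~ b)]).
apply: WordCat; first exact: WordRefl.
by apply: WordCat => //; exact: WordRefl.
Qed.

Lemma presented_mulA : associative presented_mul.
Proof.
move=> a b c.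
rewrite -[a]presented_of_wordK -[b]presented_of_wordK -[c]presented_of_wordK.
by rewrite !presented_mulE catA.
Qed.

Lemma presented_mul1 : left_id presented_one presented_mul.
Proof. by move=> a; rewrite -[a]presented_of_wordK presented_mulE. Qed.

Lemma presented_1mul : right_id presented_one presented_mul.
Proof. by move=> a; rewrite -[a]presented_of_wordK presented_mulE cats0. Qed.

Lemma presented_mulV : left_inverse presented_one presented_inv presented_mul.
Proof.
move=> a; rewrite -{2}[a]presented_of_wordK presented_mulE.
by apply/presented_of_wordP; exact: word_invV.
Qed.

Lemma presented_Vmul : right_inverse presented_one presented_inv presented_mul.
Proof.
move=> a; rewrite -{1}[a]presented_of_wordK presented_mulE.
by apply/presented_of_wordP; exact: word_Vinv.
Qed.

HB.instance Definition _ := isGroup.Build presented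
  presented_mulA presented_mul1 presented_1mul presented_mulV presented_Vmul.

Definition presented_gen (x : X) : presented := presented_of_word [:: (x, false)].

End Presentation.

(* In a tuple K : 'I_p -> option nat, None encodes the entry infinity. *)
Section JGroup.
Variables (p : nat) (K : 'I_p -> option nat).

Inductive J_rel : word 'I_p -> word 'I_p -> Prop :=
| JRelRot r of r < p :
    J_rel [seq (i, false) | i <- enum 'I_p]
          [seq (i, false) | i <- rot r (enum 'I_p)]
| JRelExp i k of K i = Some k : J_rel (nseq k (i, false)) [::].

Definition Jgroup : groupType := presented J_rel.

Definition Jgen (i : 'I_p) : Jgroup := presented_gen J_rel i.

Definition generalized_J (K' : 'I_p -> nat) : set Jgroup :=
  normal_closure [set Jgen i ^+ K' i | i in [set: 'I_p]].

End JGroup.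

Arguments generalized_J {p} K K'.

Definition J_parameters p (K : 'I_p -> option nat) (K' : 'I_p -> nat) :=
  0 < p /\
  forall i, 0 < K' i /\ (forall k, K i = Some k -> 2 <= k /\ K' i %| k).

Definition isomorphic_to_finite_generalized_J (G : groupType) :=
  exists p (K : 'I_p -> option nat) (K' : 'I_p -> nat),
    [/\ J_parameters K K', finite_set (generalized_J K K')
      & isomorphic_to G (generalized_J K K')].

Section GL.
Variables (n : nat) (F : fieldType).
Local Open Scope ring_scope.

Record GL := MkGL { GLmx :> 'M[F]_n; GLmx_unit : GLmx \in unitmx }.

HB.instance Definition _ := [isSub for GLmx].
HB.instance Definition _ := [Choice of GL by <:].

Definition GL_one : GL := MkGL (unitmx1 F n).

Lemma GL_mul_proof (A B : GL) : A *m B \in unitmx.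
Proof. by rewrite unitmx_mul !GLmx_unit. Qed.
Definition GL_mul (A B : GL) : GL := MkGL (GL_mul_proof A B).

Lemma GL_inv_proof (A : GL) : invmx A \in unitmx.
Proof. by rewrite unitmx_inv GLmx_unit. Qed.
Definition GL_inv (A : GL) : GL := MkGL (GL_inv_proof A).

Lemma GL_mulA : associative GL_mul.
Proof. by move=> A B C; apply: val_inj; exact: mulmxA. Qed.
Lemma GL_mul1 : left_id GL_one GL_mul.
Proof. by move=> A; apply: val_inj; exact: mul1mx. Qed.
Lemma GL_1mul : right_id GL_one GL_mul.
Proof. by move=> A; apply: val_inj; exact: mulmx1. Qed.
Lemma GL_mulV : left_inverse GL_one GL_inv GL_mul.
Proof. by move=> A; apply: val_inj; exact: mulVmx (GLmx_unit A). Qed.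
Lemma GL_Vmul : right_inverse GL_one GL_inv GL_mul.
Proof. by move=> A; apply: val_inj; exact: mulmxV (GLmx_unit A). Qed.

HB.instance Definition _ :=
  isGroup.Build GL GL_mulA GL_mul1 GL_1mul GL_mulV GL_Vmul.

End GL.

(* As everywhere in MathComp, the eigenspaces of a matrix are spaces of row   *)
(* vectors, so that a matrix acts on F^2 by v |-> v *m A.                     *)
Definition complex_reflection (F : fieldType) (A : GL 2 F) :=
  (exists2 m : nat, 0 < m & A ^+ m = 1) /\ \rank (eigenspace A 1%R) = 1%N.

Definition rank2_reflection_group (R : realType) (W : set (GL 2 R[i])) :=
  [/\ is_subgroup W, finite_set W
    & exists2 S, S `<=` @complex_reflection R[i] & W = generated S].

(* Main.v *)
(** For the direct implication, assume some k'_i < k_i and map the generators of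
J(K) to complex reflections.  A finite J(K, K') contains a non-central
s_i ^ k'_i, which is centralised by some power of any h in J(K); if all powers
of the image of h are non-scalar, then h commutes with s_i, because
centralisers of non-scalar matrices in GL_2 are abelian.  Suitable words h
exclude p >= 4 and the triples (a, b, c) with 1/a + 1/b + 1/c <= 1, and an
infinite k_i is excluded by a character of J(K).  In the remaining cases the
reflection representation is faithful: for p = 3 a coset enumeration bounds the
index of <s t u> by the order N of the polyhedral rotation group, and a transfer
argument shows that s t u has order N, the order of the scalar it acts by.

Conversely let W be a finite reflection group and Z its scalars.  Centralisers
of non-scalar elements (tori) partition W minus Z, and counting them gives the
classical list: W/Z is cyclic, dihedral, or of order 12, 24, 60.  In the last
cases the traces of products of two m-fold rotations take so few values that
some pair of them generates a (2, 3, m) triple.  In each case one obtains a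
faithful J(K) in GL_2 normalising W such that every reflection of W is
conjugate to a power of a generator, and then W = J(K, K') where k'_i is the
least k with s_i ^ k in W. *)

Require Import Defs.
From HB Require Import structures.
From mathcomp Require generic_quotient.
From mathcomp Require Import all_boot all_order all_fingroup all_algebra cyclic frobenius complex.
From mathcomp Require Import boolp classical_sets functions cardinality reals trigo.
From mathcomp Require Import zify ring lra.

Set Implicit Arguments.
Unset Strict Implicit.
Unset Printing Implicit Defensive.

Import Order.TTheory GRing.Theory Num.Theory.

Local Open Scope group_scope.

(** The delicate point is the faithfulness of the reflection representation of J(a, b, c). Coset
    enumeration only bounds the index of the central subgroup generated by z = stu from above, and
    says nothing about the order of z. The transfer is therefore used twice. In the image, where z
    acts by a scalar of order N, the transfer into the scalars kills s, t and u; hence there are at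
    least N classes modulo scalars and the enumeration is sharp. In J(K) itself, the transfer into
    the powers of z then gives z^N = 1. The eigenvalues of the generators are powers of one
    primitive N-th root of unity l, with exponents N/a, N/b, N/c. The Euler relation N/a + N/b + N/c
    = N + 2 makes their product l^2, as it must be since stu acts by the scalar l. In the converse,
    J(K) is in general larger than W, but it lies in C^* W, and this is enough for it to normalise
    W. The tetrahedral group needs separate care throughout: none of its rotations reverses a
    three-fold axis, so the two ends of such an axis must be reached by different generators. *)

Section PresentedGroups.
Variables (X : choiceType) (rel : word X -> word X -> Prop).

Lemma presented_of_word_cat (u v : word X) :
  presented_of_word rel (u ++ v) = presented_of_word rel u * presented_of_word rel v.
Proof. by rewrite -presented_mulE. Qed.

Lemma presented_gen_true (x : X) :
  presented_of_word rel [:: (x, true)] = (presented_gen rel x)^-1.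
Proof.
apply: (mulgI (presented_gen rel x)); rewrite mulgV -presented_of_word_cat.
by apply/presented_of_wordP; exact: (WordCancel rel x false).
Qed.

Lemma presented_ind (P : presented rel -> Prop) :
  P 1 -> (forall x a, P a -> P (a * presented_gen rel x)) ->
  (forall x a, P a -> P (a * (presented_gen rel x)^-1)) -> forall a, P a.
Proof.
move=> P1 PM PV a; rewrite -[a]presented_of_wordK.
elim/last_ind: (generic_quotient.repr a) => [//|w [x b] IHw].
rewrite -cats1 presented_of_word_cat.
by case: b; [rewrite presented_gen_true; exact: PV | exact: PM].
Qed.

Lemma presented_gen_prod (s : seq X) :
  presented_of_word rel [seq (x, false) | x <- s] = \prod_(x <- s) presented_gen rel x.
Proof.
elim: s => [|x s IHs]; first by rewrite big_nil.
by rewrite big_cons -IHs -presented_of_word_cat.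
Qed.

Lemma presented_gen_exp (x : X) n :
  presented_of_word rel (nseq n (x, false)) = presented_gen rel x ^+ n.
Proof.
elim: n => [//|n IHn].
by rewrite expgS -IHn -presented_of_word_cat.
Qed.

Variables (H : groupType) (f : X -> H).

Definition word_eval (w : word X) : H :=
  \prod_(a <- w) (if a.2 then (f a.1)^-1 else f a.1).

Lemma word_eval_cat u v : word_eval (u ++ v) = word_eval u * word_eval v.
Proof. by rewrite /word_eval big_cat. Qed.

Hypothesis f_rel : forall u v, rel u v -> word_eval u = word_eval v.

Lemma word_eval_cong u v : word_cong rel u v -> word_eval u = word_eval v.
Proof.
elim=> {u v} [u v /f_rel // | x b | u u' v v' _ IHu _ IHv | // | u v _ -> //
  | u v w _ -> _ -> //].
- by rewrite /word_eval !big_cons !big_nil mulg1; case: b; rewrite /= ?mulgV ?mulVg.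
- by rewrite !word_eval_cat IHu IHv.
Qed.

Lemma presented_lift :
  exists phi : {multiplicative presented rel -> H},
    forall x, phi (presented_gen rel x) = f x.
Proof.
pose phi (a : presented rel) := word_eval (generic_quotient.repr a).
have phiE w : phi (presented_of_word rel w) = word_eval w.
  exact/word_eval_cong/repr_cong.
have phiM : {morph phi : a b / a * b}.
  move=> a b; rewrite -[a]presented_of_wordK -[b]presented_of_wordK.
  by rewrite -presented_of_word_cat !phiE word_eval_cat.
pose HBphi := isMultiplicative.Build _ _ phi phiM.
pose Phi : {multiplicative presented rel -> H} := HB.pack phi HBphi.
exists Phi => x; rewrite /Phi /= phiE /word_eval big_cons big_nil mulg1 //.
Qed.

End PresentedGroups.

(** * The groups J(K) and their universal property *)

Section JGroups.
Variables (p : nat) (K : 'I_p -> option nat).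

Lemma Jgen_exp i k : K i = Some k -> Jgen K i ^+ k = 1.
Proof.
move=> Ki; rewrite -presented_gen_exp; apply/presented_of_wordP.
exact/WordRel/JRelExp.
Qed.

Lemma Jgroup_ind (P : Jgroup K -> Prop) :
  P 1 -> (forall i a, P a -> P (a * Jgen K i)) ->
  (forall i a, P a -> P (a * (Jgen K i)^-1)) -> forall a, P a.
Proof. exact: presented_ind. Qed.

Lemma Jgen_prod_rot r : r < p ->
  \prod_(i <- enum 'I_p) Jgen K i = \prod_(i <- rot r (enum 'I_p)) Jgen K i.
Proof.
move=> lt_rp; rewrite -!(presented_gen_prod (@J_rel p K)).
exact/presented_of_wordP/WordRel/JRelRot.
Qed.

(** The rotation relations follow from centrality alone: split the full product as [a * b] after [r]
    factors. It commutes with the prefix [a], and cancelling [a] in [a * b * a = a * a * b] gives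
    [b * a = a * b]. *)
Lemma Jgroup_lift (H : groupType) (f : 'I_p -> H) :
  (forall x, commute (\prod_(i <- enum 'I_p) f i) (f x)) ->
  (forall i k, K i = Some k -> f i ^+ k = 1) ->
  exists phi : {multiplicative Jgroup K -> H}, forall i, phi (Jgen K i) = f i.
Proof.
move=> f_central f_exp; apply: presented_lift => _ _ [r lt_rp | i k /f_exp fik].
  have evalE s : word_eval f [seq (i, false) | i <- s] = \prod_(i <- s) f i.
    by rewrite /word_eval big_map.
  rewrite !evalE /rot big_cat /=.
  set b := \prod_(i <- drop _ _) _; set a := \prod_(i <- take _ _) _.
  have abE : \prod_(i <- enum 'I_p) f i = a * b by rewrite -big_cat cat_take_drop.
  have : commute (a * b) a.
    by rewrite -abE; apply: commute_prod => i _; exact: f_central.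
  by rewrite /commute -mulgA abE => /mulgI.
rewrite /word_eval big_nil; transitivity (f i ^+ k) => //.
by elim: (k) => [|n IHn]; rewrite ?big_nil // big_cons IHn expgS.
Qed.

End JGroups.

(** * The transfer to a central subgroup *)

Definition central_subgroup (X : groupType) (A : {pred X}) :=
  group_closed A /\ {in A, forall a x, commute a x}.

(* An abelian group in additive notation: the target of the transfer. *)
Definition central_type (X : groupType) (A : {pred X}) of central_subgroup A :=
  {x : X | x \in A}.

Ltac gsimp := rewrite ?(invgM, invgK, invg1, mulg1, mul1g, mulgA, mulVg, mulgV, mulgK, mulgVK).

Section CentralType.
Variables (X : groupType) (A : {pred X}) (cA : central_subgroup A).
Local Notation B := (central_type cA).

HB.instance Definition _ := Choice.on B.

Let A1 : 1 \in A. Proof. by case: cA => -[]. Qed.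
Let AM : {in A &, forall x y, x * y \in A}.
Proof. by case: cA => /group_closedM. Qed.
Let AV : {in A, forall x, x^-1 \in A}.
Proof. by case: cA => /group_closedV. Qed.

Definition central_zero : B := exist (fun x => x \in A) 1 A1.
Definition central_add (x y : B) : B := exist (fun x => x \in A) _ (AM (valP x) (valP y)).
Definition central_opp (x : B) : B := exist (fun x => x \in A) _ (AV (valP x)).

Fact central_addA : associative central_add.
Proof. by move=> x y z; apply: val_inj; exact: mulgA. Qed.
Fact central_addC : commutative central_add.
Proof. by move=> x y; apply: val_inj => /=; apply: cA.2; exact: valP. Qed.
Fact central_add0 : left_id central_zero central_add.
Proof. by move=> x; apply: val_inj; exact: mul1g. Qed.
Fact central_addN : left_inverse central_zero central_opp central_add.
Proof. by move=> x; apply: val_inj; exact: mulVg. Qed.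

HB.instance Definition _ := GRing.isZmodule.Build B
  central_addA central_addC central_add0 central_addN.

Definition central_val (x : B) : X := val x.

Lemma central_valD x y : central_val (x + y)%R = central_val x * central_val y.
Proof. by []. Qed.

Lemma central_valMn x n : central_val (x *+ n)%R = central_val x ^+ n.
Proof.
elim: n => [//|n IHn].
by rewrite mulrS central_valD IHn expgS.
Qed.

End CentralType.

Section Transfer.
Variables (X : groupType) (A : {pred X}) (cA : central_subgroup A).
Variables (M : nat) (r : 'I_M -> X).
Hypothesis r_cover : forall x, exists d, (r d)^-1 * x \in A.
Hypothesis r_uniq : forall d d', (r d)^-1 * r d' \in A -> d = d'.
Local Notation B := (central_type cA).

Let A1 : 1 \in A. Proof. by case: cA => -[]. Qed.
Let AM : {in A &, forall x y, x * y \in A}.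
Proof. by case: cA => /group_closedM. Qed.
Let AV : {in A, forall x, x^-1 \in A}.
Proof. by case: cA => /group_closedV. Qed.
Let AC a x : a \in A -> a * x = x * a. Proof. by move=> /(cA.2)/(_ x). Qed.

Definition coset_index x : 'I_M := xchoose (r_cover x).
Definition coset_act g d : 'I_M := coset_index (g * r d).
(** The defect in [A] of the transversal: [g * r d] is the representative of its coset times
    [cocycle g d]. The sum over [d] is the transfer. *)
Definition cocycle g d : B :=
  exist (fun x => x \in A) ((r (coset_act g d))^-1 * (g * r d)) (xchooseP (r_cover (g * r d))).

Lemma cocycleE g d : r (coset_act g d) * central_val (cocycle g d) = g * r d.
Proof. by rewrite /= mulVKg. Qed.

Lemma coset_index_eq x d : (r d)^-1 * x \in A -> coset_index x = d.
Proof.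
move=> rxA; apply/esym/r_uniq.
have := AM rxA (AV (xchooseP (r_cover x))).
by rewrite invgM invgK mulgA mulgK.
Qed.

Lemma cocycle_unique g d d' (c : B) :
  r d' * central_val c = g * r d -> coset_act g d = d' /\ cocycle g d = c.
Proof.
move=> E; have d'E : coset_act g d = d'.
  by apply: coset_index_eq; rewrite -E mulKg; exact: valP.
split=> //; apply: val_inj; apply: (mulgI (r d')).
by rewrite E -(cocycleE g d) d'E.
Qed.

Lemma cocycleM g h d :
  coset_act (g * h) d = coset_act g (coset_act h d) /\
  cocycle (g * h) d = (cocycle g (coset_act h d) + cocycle h d)%R.
Proof.
apply: cocycle_unique.
by rewrite central_valD mulgA cocycleE -mulgA cocycleE mulgA.
Qed.

Lemma coset_act_inj g : injective (coset_act g).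
Proof.
move=> d d' E; apply: r_uniq.
have := AM (AV (valP (cocycle g d))) (valP (cocycle g d')).
by rewrite /= E !invgM invgK -!mulgA mulVKg mulKg.
Qed.

Definition transfer g : B := (\sum_d cocycle g d)%R.

Lemma transferM g h : transfer (g * h) = (transfer g + transfer h)%R.
Proof.
rewrite /transfer [in RHS](reindex_inj (@coset_act_inj h)) -big_split /=.
by apply: eq_bigr => d _; rewrite (cocycleM g h d).2.
Qed.

Lemma transfer_central (a : B) : transfer (central_val a) = (a *+ M)%R.
Proof.
rewrite /transfer (eq_bigr (fun=> a)) ?sumr_const ?card_ord // => d _.
have [] // := @cocycle_unique (central_val a) d d a.
exact/esym/AC/valP.
Qed.

(* Modulo [A], all cycles of [s] have length exactly [k]; as [s ^+ k = 1], *)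
(* the cocycle of [s] is a coboundary.                                     *)
Lemma transfer_eq0 s k : (0 < k)%N -> s ^+ k = 1 ->
  (forall j, s ^+ j \in A -> (k %| j)%N) -> transfer s = 0%R.
Proof.
move=> k0 sk1 skA.
have sV : s ^+ k.-1 = s^-1 by apply/esym/mulg1_eq; rewrite -expgS prednK.
(* [E d] depends only on the cycle of the coset [d] under [s], so [xget] chooses one base point per
   cycle and [rep] is constant on cycles. *)
pose E d : set X := [set y | exists i, (s ^+ i * y)^-1 * r d \in A]%classic.
have Ene d : exists y, E d y by exists (r d), 0%N; rewrite mul1g mulVg.
have Eact d : E (coset_act s d) = E d.
  apply/predeqP => y; have cP := valP (cocycle s d).
  have rE : r (coset_act s d) = s * r d * (val (cocycle s d))^-1.
    by rewrite -(cocycleE s d) mulgK.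
  split=> -[i iP].
    exists (k.-1 + i)%N; move: (AM iP cP); rewrite rE expgnDr sV.
    by gsimp.
  exists i.+1; rewrite rE expgS; have := AM iP (AV cP).
  by gsimp.
pose rep d := xget 1 (E d).
have repP d : exists i, (s ^+ i * rep d)^-1 * r d \in A by exact: (xgetPex 1 (Ene d)).
pose ex d : nat := xchoose (repP d).
(* [m d] measures [r d] against a translate of the base point by a power of [s]; the cocycle of [s]
   will be the coboundary of [m]. *)
have [m mE] : exists m : 'I_M -> B,
    forall d, s ^+ ex d * rep d * central_val (m d) = r d.
  exists (fun d => exist (fun x => x \in A) _ (xchooseP (repP d))) => d.
  by rewrite /= mulVKg.
suff cE d : cocycle s d = (m d - m (coset_act s d))%R.
  rewrite /transfer (eq_bigr _ (fun d _ => cE d)) sumrB.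
  by rewrite [X in (X - _)%R](reindex_inj (@coset_act_inj s)) subrr.
apply/esym/eqP; rewrite subr_eq; apply/eqP/val_inj/esym.
change (central_val (cocycle s d) * central_val (m (coset_act s d)) = central_val (m d)).
have repE : rep (coset_act s d) = rep d by rewrite /rep Eact.
have := cocycleE s d; rewrite -(mE d) -(mE (coset_act s d)) repE /central_val.
move: (valP (m d)) (valP (m (coset_act s d))) (valP (cocycle s d)).
set d' := coset_act s d; move: (val (m d)) => m0; move: (val (m d')) => m1.
move: (val (cocycle s d)) (ex d) (rep d) => c i y; move: (ex d') => j m0A m1A cA'.
rewrite !mulgA -expgS => sE; have jE : s ^- j * s ^+ i.+1 = s ^+ (k.-1 * j + i.+1).
  by rewrite expgnDr expgnA sV expVgn.
(* This power of [s] is conjugate to an element of the central [A], so it lies in [A]; by [skA] its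
   exponent is a multiple of [k], and it is 1. *)
have sA : s ^- j * s ^+ i.+1 \in A.
  have -> : s ^- j * s ^+ i.+1 = y * (m1 * c * m0^-1) * y^-1.
    apply: (canRL (mulgK _)); rewrite mulgA; apply: (canRL (mulgK _)).
    by rewrite -!mulgA; apply: (canLR (mulKg _)); move: sE; gsimp.
  have mA : m1 * c * m0^-1 \in A by apply: AM; [exact: AM | exact: AV].
  by rewrite -(AC y mA) mulgK.
have s1 : s ^- j * s ^+ i.+1 = 1.
  by move: sA; rewrite jE => /skA/dvdnP[q ->]; rewrite mulnC expgnA sk1 expg1n.
have sE1 : s ^+ i.+1 = s ^+ j by move: s1 => /(canRL (mulKg _)); gsimp.
by move: sE; rewrite sE1 -!mulgA => /mulgI/mulgI <-; exact: AC.
Qed.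

(* The transfer into [A] kills each of [s], [t], [u], hence also [s * t * u]. *)
Lemma transfer3_exp s t u i j k : (0 < i)%N -> (0 < j)%N -> (0 < k)%N ->
  s ^+ i = 1 -> t ^+ j = 1 -> u ^+ k = 1 ->
  (forall n, s ^+ n \in A -> (i %| n)%N) ->
  (forall n, t ^+ n \in A -> (j %| n)%N) ->
  (forall n, u ^+ n \in A -> (k %| n)%N) ->
  s * t * u \in A -> (s * t * u) ^+ M = 1.
Proof.
move=> i0 j0 k0 si tj uk sA tA uA zA.
pose z : B := exist (fun x => x \in A) _ zA.
have := transfer_central z; rewrite [central_val z]/= !transferM.
rewrite (transfer_eq0 i0) // (transfer_eq0 j0) // (transfer_eq0 k0) // !addr0.
by move=> /(congr1 (@central_val _ _ _)); rewrite central_valMn => <-.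
Qed.

End Transfer.

(** * Coset enumeration in triangle groups *)

Section CosetTables.
Variables (Y : Type) (S T : Y -> Y) (p : Y).

Definition run (w : seq bool) : Y := foldl (fun y b => if b then T y else S y) p w.

Fixpoint run_all (F : Y -> Prop) (L : seq (seq bool)) : Prop :=
  if L is w :: L' then F (run w) /\ run_all F L' else True.

Lemma run_allT (F : Y -> Prop) L : (forall w, F (run w)) -> run_all F L.
Proof. by move=> FT; elim: L => /=. Qed.

(* Rows [(w, a, b)] of a coset table: the point of [w] is sent by [S] to the *)
(* point of [a] and by [T] to the point of [b].                              *)
Definition table := seq (seq bool * seq bool * seq bool).

Fixpoint table_holds (tab : table) : Prop :=
  if tab is (w, a, b) :: tab' then
    [/\ S (run w) = run a, T (run w) = run b & table_holds tab'] else True.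

Definition table_closed (tab : table) :=
  let L := [seq e.1.1 | e <- tab] in
  ([::] \in L) && all (fun e => (e.1.2 \in L) && (e.2 \in L)) tab.

Lemma table_holdsP tab w : table_holds tab -> table_closed tab ->
  w \in [seq e.1.1 | e <- tab] ->
  (exists2 v, v \in [seq e.1.1 | e <- tab] & S (run w) = run v) /\
  (exists2 v, v \in [seq e.1.1 | e <- tab] & T (run w) = run v).
Proof.
move=> tabT /andP[_ /allP tabC] /mapP[[[w' a] b] e_tab /= ->].
have /andP[/= aL bL] := tabC _ e_tab.
suff [Sw Tw] : S (run w') = run a /\ T (run w') = run b by split; [exists a | exists b].
elim: tab tabT e_tab {tabC aL bL} => [//|[[w1 a1] b1] tab IHtab] /= [Sw Tw tabT].
by rewrite inE => /predU1P[[-> -> ->] // | /(IHtab tabT)].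
Qed.

Hypotheses (SS : forall y, S (S y) = y) (TTT : forall y, T (T (T y)) = y).
Hypothesis TSp : T (S p) = p.

Local Notation s := false.
Local Notation t := true.

(** Todd-Coxeter tables for the cosets of the subgroup generated by [u] and [z], for [m] = 3, 4, 5.
    The 4, 6 and 12 rows correspond to the vertices of the tetrahedron, octahedron and icosahedron;
    [m] times their number is 12, 24, 60. *)
Definition table3 : table :=
  [:: ([::], [:: s], [:: t]);
      ([:: s], [::], [::]);
      ([:: t], [:: t; s], [:: s]);
      ([:: t; s], [:: t], [:: t; s])].

Definition table4 : table :=
  [:: ([::], [:: s], [:: t]);
      ([:: s], [::], [::]);
      ([:: t], [:: t; s], [:: s]);
      ([:: t; s], [:: t], [:: t; s; t]);
      ([:: t; s; t], [:: t; s; t; s], [:: t; s; t; s]);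
      ([:: t; s; t; s], [:: t; s; t], [:: t; s])].

Definition table5 : table :=
  [:: ([::], [:: s], [:: t]);
      ([:: s], [::], [::]);
      ([:: t], [:: t; s], [:: s]);
      ([:: t; s], [:: t], [:: t; s; t]);
      ([:: t; s; t], [:: t; s; t; s], [:: t; s; t; t]);
      ([:: t; s; t; s], [:: t; s; t], [:: t; s; t; s; t]);
      ([:: t; s; t; t], [:: t; s; t; s; t], [:: t; s]);
      ([:: t; s; t; s; t], [:: t; s; t; t], [:: t; s; t; s; t; t]);
      ([:: t; s; t; s; t; t], [:: t; s; t; s; t; t; s], [:: t; s; t; s]);
      ([:: t; s; t; s; t; t; s], [:: t; s; t; s; t; t], [:: t; s; t; s; t; t; s; t]);
      ([:: t; s; t; s; t; t; s; t], [:: t; s; t; s; t; t; s; t; s],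
        [:: t; s; t; s; t; t; s; t; s]);
      ([:: t; s; t; s; t; t; s; t; s], [:: t; s; t; s; t; t; s; t],
        [:: t; s; t; s; t; t; s])].

(** Instantiating the three relations at every listed point produces finitely many equations between
    points; the coincidences of the enumeration then follow by congruence closure. *)
Ltac coset_table m tab TSm :=
  have := @run_allT (fun y => S (S y) = y) [seq e.1.1 | e <- tab] (fun w => SS (run w));
  have := @run_allT (fun y => T (T (T y)) = y) [seq e.1.1 | e <- tab] (fun w => TTT (run w));
  have := @run_allT (fun y => iter m (T \o S) y = y) [seq e.1.1 | e <- tab] TSm;
  rewrite /= /run /=; intros;
  repeat match goal with H : _ /\ _ |- _ => destruct H end;
  repeat split; congruence.

(** The relation for [T \o S] is assumed on the orbit of [p] only: in the application its [m]-th
    power translates by a central element, which fixes the cosets in question but not arbitrary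
    subsets. *)
Lemma table3_holds : (forall w, iter 3 (T \o S) (run w) = run w) -> table_holds table3.
Proof. move=> TSm; coset_table 3 table3 TSm. Qed.

Lemma table4_holds : (forall w, iter 4 (T \o S) (run w) = run w) -> table_holds table4.
Proof. move=> TSm; coset_table 4 table4 TSm. Qed.

Lemma table5_holds : (forall w, iter 5 (T \o S) (run w) = run w) -> table_holds table5.
Proof. move=> TSm; coset_table 5 table5 TSm. Qed.

End CosetTables.

Section CyclicCenter.
Variables (X : groupType) (z : X).

(** The cyclic subgroup generated by [z]; an integer exponent is written as a difference of two
    natural ones. *)
Definition cyc : {pred X} := fun y => `[< exists m n, y = z ^+ m * z ^- n >].

Lemma cycP y : reflect (exists m n, y = z ^+ m * z ^- n) (y \in cyc).
Proof. exact: asboolP. Qed.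

Lemma cyc_id : z \in cyc.
Proof. by apply/cycP; exists 1%N, 0%N; gsimp. Qed.

Lemma cyc_closed : group_closed cyc.
Proof.
have zC m n : commute (z ^+ m) (z ^- n).
  exact/commuteV/commuteX2.
split; first by apply/cycP; exists 0%N, 0%N; gsimp.
move=> _ _ /cycP[m [n ->]] /cycP[i [j ->]]; apply/cycP.
exists (m + j)%N, (i + n)%N; rewrite expgnDr invgM invgK expgnDr invgM !mulgA.
by congr (_ * _); rewrite -!mulgA (zC j n).
Qed.

Lemma cycX k : z ^+ k \in cyc.
Proof. by apply/cycP; exists k, 0%N; gsimp. Qed.

Hypothesis z_central : forall x, commute z x.

Lemma cyc_central : central_subgroup cyc.
Proof.
split; first exact: cyc_closed.
move=> _ /cycP[m [n ->]] x; apply/commute_sym; apply: commuteM.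
  exact/commuteX/commute_sym.
exact/commuteV/commuteX/commute_sym.
Qed.

End CyclicCenter.

Lemma cyc_inv (X : groupType) (z : X) : cyc z^-1 =i cyc z.
Proof.
have zC m n : z ^+ m * z ^- n = z ^- n * z ^+ m.
  exact/commuteV/commuteX2.
by move=> y; apply/cycP/cycP => -[m [n ->]]; exists n, m; rewrite ?expVgn ?invgK zC.
Qed.

(* [x0], [x1], [x2] generate [X] as a monoid, which is all that is needed as  *)
(* they have finite order.                                                   *)
Definition J_triple (X : groupType) (x0 x1 x2 : X) (a b c : nat) :=
  [/\ forall x, commute (x0 * x1 * x2) x,
      [/\ x0 ^+ a = 1, x1 ^+ b = 1 & x2 ^+ c = 1] &
      forall P : X -> Prop, P 1 ->
        (forall x, P x -> [/\ P (x * x0), P (x * x1) & P (x * x2)]) -> forall x, P x].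

Definition coset_bound (a b c N : nat) :=
  forall (X : groupType) (x0 x1 x2 : X), J_triple x0 x1 x2 a b c ->
  exists2 l : seq X, (size l <= N)%N &
    forall x, exists2 r, r \in l & r^-1 * x \in cyc (x0 * x1 * x2).

Lemma coset_bound_rot a b c N : coset_bound a b c N -> coset_bound b c a N.
Proof.
move=> bound X x0 x1 x2 [zC [x0b x1c x2a] gen].
have zE : x2 * x0 * x1 = x0 * x1 * x2.
  by apply: (mulIg x2); rewrite zC; gsimp.
rewrite -zE; apply: bound; split=> // [x | P P1 PM]; first by rewrite zE.
by apply: gen => // x /PM[].
Qed.

(** Inverting reverses a triple and replaces the central product by its inverse; finite order lets
    the inverses generate as a monoid. Together with the rotations this gives all orderings of the
    three exponents. *)
Lemma coset_bound_rev a b c N : (0 < a)%N -> (0 < b)%N -> (0 < c)%N ->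
  coset_bound a b c N -> coset_bound c b a N.
Proof.
move=> a0 b0 c0 bound X x0 x1 x2 [zC [x0c x1b x2a] gen].
have zE : x2^-1 * x1^-1 * x0^-1 = (x0 * x1 * x2)^-1 by gsimp.
have invX (x : X) n : (0 < n)%N -> x ^+ n = 1 -> x = x^-1 ^+ n.-1.
  move=> n0 xn; rewrite expVgn; apply: (mulIg (x ^+ n.-1)).
  by rewrite -expgS prednK // xn mulVg.
have [|l sl lP] := bound X x2^-1 x1^-1 x0^-1.
  split; first by rewrite zE => x; exact/commute_sym/commuteV/commute_sym.
    by rewrite !expVgn x0c x1b x2a invg1.
  move=> P P1 PM; apply: gen => // x Px.
  have PX y n : (forall x, P x -> P (x * y)) -> P (x * y ^+ n).
    move=> PMy; elim: n => [|n IHn]; first by rewrite mulg1.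
    by rewrite expgSr mulgA; exact: PMy.
  rewrite (invX x0 c) // (invX x1 b) // (invX x2 a) //.
  by split; apply: PX => y /PM[].
exists l => // x; have [r rl rx] := lP x; exists r => //.
by move: rx; rewrite zE cyc_inv.
Qed.

(* Cosets of the subgroup generated by [x2] and the center, acted on from the *)
(* right by [x0] and [x1].                                                   *)
Lemma coset_bound_table m (tab : table) : (0 < m)%N ->
  (forall (Y : Type) (S T : Y -> Y) (p : Y), (forall y, S (S y) = y) ->
     (forall y, T (T (T y)) = y) -> T (S p) = p ->
     (forall w, iter m (T \o S) (run S T p w) = run S T p w) -> table_holds S T p tab) ->
  table_closed tab -> coset_bound 2 3 m (m * size tab).
Proof.
move=> m0 tab_holds tab_closed X s t u [zC [s2 t3 um] gen].
set z := s * t * u in zC *.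
have cA := cyc_central zC; have A1 := cA.1.1; have AM := group_closedM cA.1.
have AV := group_closedV cA.1; have Az := cyc_id z.
have AC a x : a \in cyc z -> a * x = x * a by move=> /(cA.2)/(_ x).
have uV i : u ^- i = u ^+ (m.-1 * i).
  apply: mulg1_eq; rewrite -expgnDr -[X in (X + _)%N]mul1n -mulnDl add1n prednK //.
  by rewrite expgnA um expg1n.
(* The coset of [w] for the subgroup generated by [u] and [z], as a subset of [X]. [S] and [T]
   translate arbitrary subsets on the right. *)
pose pt w : set X := [set x | exists k, u ^+ k * x * w^-1 \in cyc z]%classic.
pose S (y : set X) : set X := [set x | y (x * s^-1)]%classic.
pose T (y : set X) : set X := [set x | y (x * t^-1)]%classic.
have ptS w : S (pt w) = pt (w * s).
  by apply/predeqP => x; split=> -[k kP]; exists k; move: kP; gsimp.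
have ptT w : T (pt w) = pt (w * t).
  by apply/predeqP => x; split=> -[k kP]; exists k; move: kP; gsimp.
have pt_sub i a w : a \in cyc z -> (pt w `<=` pt (u ^+ i * a * w))%classic.
  move=> aA x [k kA]; exists (i + k)%N.
  have -> : u ^+ (i + k) * x * (u ^+ i * a * w)^-1 =
      u ^+ i * (u ^+ k * x * w^-1 * a^-1) * u ^- i by rewrite expgnDr; gsimp.
  have bA : u ^+ k * x * w^-1 * a^-1 \in cyc z by apply: AM => //; exact: AV.
  by rewrite -(AC _ (u ^+ i) bA) mulgK.
have pt_eq i a w : a \in cyc z -> pt (u ^+ i * a * w) = pt w.
  move=> aA; apply/seteqP; split; last exact: pt_sub.
  have {2}-> : w = u ^+ (m.-1 * i) * a^-1 * (u ^+ i * a * w).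
    by rewrite -uV -(AC _ _ (AV _ aA)); gsimp.
  by apply: pt_sub; exact: AV.
have SS y : S (S y) = y.
  by apply/predeqP => x; rewrite /S /= -mulgA -invgM -expg2 s2 invg1 mulg1.
have TTT y : T (T (T y)) = y.
  apply/predeqP => x; rewrite /T /= -!mulgA -!invgM.
  by rewrite -mulgA -[t * (t * t)]/(t ^+ 3) t3 invg1 mulg1.
(* This is [u^-1 * z], which fixes the base coset; the factor 1 is there to match [pt_eq]. *)
have stE : s * t = u ^+ m.-1 * z * 1.
  by rewrite -[m.-1]muln1 -uV expg1 -(AC _ _ Az) mulg1 /z mulgK.
pose val w := foldl (fun g (b : bool) => g * (if b then t else s)) 1 w.
have runE w : run S T (pt 1) w = pt (val w).
  elim/last_ind: w => [//|w b IHw].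
  by rewrite /run /val !foldl_rcons -/(run S T (pt 1) w) IHw; case: b.
have TSp : T (S (pt 1)) = pt 1 by rewrite ptS ptT mul1g stE pt_eq.
have TSm w : iter m (T \o S) (run S T (pt 1) w) = run S T (pt 1) w.
  rewrite runE; have -> n g : iter n (T \o S) (pt g) = pt (g * (s * t) ^+ n).
    elim: n g => [|n IHn] g; first by rewrite mulg1.
    by rewrite iterSr /= ptS ptT IHn expgS !mulgA.
  have -> : (s * t) ^+ m = z ^+ m.
    have -> : s * t = z * u^-1 by rewrite /z mulgK.
    by rewrite expgnFl ?um ?divg1 //; exact: zC.
  by rewrite -(AC _ _ (cycX z m)) -[z ^+ m]mul1g -(expg0 u) pt_eq // cycX.
have tabT := tab_holds _ S T (pt 1) SS TTT TSp TSm.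
have closed := table_holdsP tabT tab_closed.
set L := [seq e.1.1 | e <- tab] in closed.
have cover : forall x, exists2 w, w \in L & pt x = pt (val w).
  apply: gen => [|x [w wL wE]]; first by exists [::] => //; case/andP: tab_closed.
  have Sw y v : v \in L -> pt y = pt (val v) -> exists2 w', w' \in L & pt (y * s) = pt (val w').
    by move=> /closed[[w' w'L +] _] yE; rewrite !runE => w'E; exists w'; rewrite // -ptS yE.
  have Tw y v : v \in L -> pt y = pt (val v) -> exists2 w', w' \in L & pt (y * t) = pt (val w').
    by move=> /closed[_ [w' w'L +]] yE; rewrite !runE => w'E; exists w'; rewrite // -ptT yE.
  split; [exact: Sw wE | exact: Tw wE |].
  have [w1 w1L w1E] := Tw _ _ wL wE; have [w2 w2L w2E] := Tw _ _ w1L w1E.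
  have [w3 w3L w3E] := Sw _ _ w2L w2E; exists w3 => //; rewrite -w3E.
  (* The third generator is a word in [s], [t] and [z], so it is enough that the table is closed
     under [S] and [T]. *)
  have uE : u = t * t * s * z.
    have sV : s^-1 = s by apply: mulg1_eq; rewrite -expg2.
    have tV : t^-1 = t * t by exact: mulg1_eq.
    by rewrite /z -{1}tV -{1}sV; gsimp.
  rewrite {1}uE mulgA -(AC _ _ Az) -[z]mul1g -(expg0 u) pt_eq //.
  by rewrite !mulgA.
exists [seq u ^+ k * val w | k <- iota 0 m, w <- L].
  by rewrite size_allpairs size_iota size_map.
move=> x; have [w wL wE] := cover x.
have : pt x x by exists 0%N; rewrite mul1g mulgV cA.1.1.
rewrite wE => -[k kA]; exists (u ^+ (m.-1 * k %% m) * val w).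
  by apply/allpairsP; exists ((m.-1 * k %% m)%N, w); rewrite mem_iota ltn_mod m0.
have -> : u ^+ (m.-1 * k %% m) = u ^- k.
  rewrite uV [in RHS](divn_eq (m.-1 * k) m) expgnDr [(_ %/ m * m)%N]mulnC.
  by rewrite expgnA um expg1n mul1g.
have -> : (u ^- k * val w)^-1 * x = (val w)^-1 * (u ^+ k * x * (val w)^-1 * val w) by gsimp.
by rewrite (AC _ _ kA) mulKg.
Qed.

(** Every element has a normal form [u ^+ k * s ^+ e * a] with [a] a power of [z]: here
    [t = s * u^-1 * z], and [t ^+ 2 = 1] becomes the dihedral relation
    [s * u = u^-1 * s * z ^+ 2]. *)
Lemma coset_bound_dihedral n : (0 < n)%N -> coset_bound 2 2 n (2 * n).
Proof.
move=> n0 X s t u [zC [s2 t2 un] gen]; set z := s * t * u in zC *.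
have cA := cyc_central zC; have A1 := cA.1.1; have AM := group_closedM cA.1.
have AV := group_closedV cA.1; have Az := cyc_id z.
have AC a x : a \in cyc z -> a * x = x * a by move=> /(cA.2)/(_ x).
have sV : s^-1 = s by apply: mulg1_eq; rewrite -expg2.
have tV : t^-1 = t by apply: mulg1_eq; rewrite -expg2.
have uV : u^-1 = u ^+ n.-1 by apply: mulg1_eq; rewrite -expgS prednK.
have tE : t = s * u ^+ n.-1 * z.
  by rewrite -uV -mulgA -(zC u^-1) /z mulgK mulgA -expg2 s2 mul1g.
have suE : s * u = u ^+ n.-1 * s * z ^+ 2.
  have z2 : z ^+ 2 = u * s * (u * s).
    have : (s * u^-1) ^+ 2 * z ^+ 2 = 1.
      rewrite -expgMn; first by rewrite uV -tE t2.
      exact/commute_sym/zC.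
    by move=> /mulg1_eq; rewrite -expVgn invgM invgK sV expg2 => <-.
  rewrite -uV -[in RHS]mulgA -(AC _ _ (cycX z 2)) z2.
  by rewrite -!mulgA -(expg2 s) s2 mulg1 mulKg.
pose P (x : X) := exists k (e : bool) a, [/\ (k < n)%N, a \in cyc z & x = u ^+ k * s ^+ e * a].
have Pz x a : a \in cyc z -> P x -> P (x * a).
  move=> aA [k [e [b [kn bA ->]]]]; exists k, e, (b * a).
  by split => //; [exact: AM | rewrite mulgA].
have Ps x : P x -> P (x * s).
  move=> [k [e [b [kn bA ->]]]]; exists k, (~~ e), b; split=> //.
  rewrite -mulgA (AC b) // mulgA; congr (_ * _); rewrite -mulgA; congr (_ * _).
  by case: e; rewrite ?mul1g // -expg2.
have Pu x : P x -> P (x * u).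
  move=> [k [e [b [kn bA ->]]]].
  rewrite -mulgA (AC b) // mulgA; apply: (Pz) => //.
  case: e; last first.
    exists ((k + 1) %% n)%N, false, 1; split=> //; first by rewrite ltn_mod.
    rewrite !mulg1 -[X in _ * X]expg1 -expgnDr [in LHS](divn_eq (k + 1) n) expgnDr mulnC.
    by rewrite expgnA un expg1n mul1g.
  rewrite -mulgA suE mulgA; apply: (Pz); first exact: cycX.
  exists ((k + n.-1) %% n)%N, true, 1; split=> //; first by rewrite ltn_mod.
  rewrite mulg1 mulgA -expgnDr [in LHS](divn_eq (k + n.-1) n) expgnDr mulnC.
  by rewrite expgnA un expg1n mul1g.
have PuX j x : P x -> P (x * u ^+ j).
  move=> Px; elim: j => [|j IHj]; first by rewrite mulg1.
  by rewrite expgSr mulgA; exact: Pu.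
have PT : forall x, P x.
  apply: gen => [|x Px]; first by exists 0%N, false, 1; rewrite !mulg1.
  split; [exact: Ps | | exact: Pu].
  have -> : x * t = x * s * u ^+ n.-1 * z by rewrite {1}tE -2!(mulgA x).
  exact: (Pz _ z Az (PuX _ _ (Ps _ Px))).
exists [seq u ^+ k * s ^+ e | k <- iota 0 n, e <- [:: 0%N; 1%N]].
  by rewrite size_allpairs size_iota mulnC.
move=> x; have [k [e [a [kn aA ->]]]] := PT x.
exists (u ^+ k * s ^+ e); last by rewrite mulKg.
by apply/allpairsP; exists (k, e : nat); rewrite mem_iota kn; case: (e).
Qed.

(** [N] is the order of the dihedral or polyhedral rotation group, and [na + nb + nc = N + 2] is its
    Euler relation, later the determinant condition on the generators. The inequality says 1/a + 1/b
    + 1/c > 1; rotations and reversal of the triple reduce to (2, 2, c), (2, 3, 3), (2, 3, 4), (2,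
    3, 5). *)
Lemma coset_bound_spherical a b c : (1 < a)%N -> (1 < b)%N -> (1 < c)%N ->
  (a * b * c < b * c + a * c + a * b)%N ->
  exists N na nb nc, [/\ (0 < N)%N, [/\ N = a * na, N = b * nb & N = c * nc]%N,
    (na + nb + nc = N + 2)%N & coset_bound a b c N].
Proof.
pose Q a b c := (1 < a)%N -> (1 < b)%N -> (1 < c)%N ->
  (a * b * c < b * c + a * c + a * b)%N ->
  exists N na nb nc, [/\ (0 < N)%N, [/\ N = a * na, N = b * nb & N = c * nc]%N,
    (na + nb + nc = N + 2)%N & coset_bound a b c N].
have Qrot a' b' c' : Q a' b' c' -> Q b' c' a'.
  move=> Qabc a1 b1 c1 lt; have [||||N [na [nb [nc [N0 [Ea Eb Ec] E cb]]]]] := Qabc => //.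
    by move: lt; clear; nia.
  exists N, nb, nc, na; split => //; last exact: coset_bound_rot.
  by rewrite -E; lia.
have Qrev a' b' c' : Q a' b' c' -> Q c' b' a'.
  move=> Qabc a1 b1 c1 lt; have [||||N [na [nb [nc [N0 [Ea Eb Ec] E cb]]]]] := Qabc => //.
    by move: lt; clear; nia.
  exists N, nc, nb, na; split => //; last by apply: coset_bound_rev => //; exact: ltnW.
  by rewrite -E; lia.
suff Qsorted a' b' c' : (a' <= b' <= c')%N -> Q a' b' c'.
  have [ab|/ltnW ab] := leqP a b; have [bc|/ltnW bc] := leqP b c;
      have [ac|/ltnW ac] := leqP a c.
  - by apply: Qsorted; rewrite ab.
  - by apply: Qsorted; rewrite ab.
  - by apply/Qrot/Qrot/Qrev/Qsorted; rewrite ac.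
  - by apply/Qrot/Qsorted; rewrite ac.
  - by apply/Qrot/Qrev/Qsorted; rewrite ab.
  - by apply/Qrot/Qrot/Qsorted; rewrite bc.
  - by apply/Qrev/Qsorted; rewrite bc.
  - by apply/Qrev/Qsorted; rewrite bc.
move=> /andP[ab bc] a1 b1 c1 lt.
have a2 : a' = 2%N by nia.
subst a'.
have b3 : (b' <= 3)%N by nia.
have [b2|b2] : b' = 2%N \/ b' = 3%N by lia.
  subst b'; exists (2 * c')%N, c', c', 2%N.
  by split; [lia | split; lia | lia | apply: coset_bound_dihedral; lia].
subst b'; have [->|[->|->]] : c' = 3%N \/ c' = 4%N \/ c' = 5%N by lia.
- exists 12%N, 6%N, 4%N, 4%N; split=> //.
  by apply: (@coset_bound_table 3 table3) => // Y S T p; exact: table3_holds.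
- exists 24%N, 12%N, 8%N, 6%N; split=> //.
  by apply: (@coset_bound_table 4 table4) => // Y S T p; exact: table4_holds.
- exists 60%N, 30%N, 20%N, 12%N; split=> //.
  by apply: (@coset_bound_table 5 table5) => // Y S T p; exact: table5_holds.
Qed.

(** * Morphisms of groups and their images *)

Section Multiplicative.
Variables (X H : groupType) (phi : {multiplicative X -> H}).

Lemma mult1 : phi 1 = 1.
Proof. by apply: (mulgI (phi 1)); rewrite -gmulfM !mulg1. Qed.

Lemma multV x : phi x^-1 = (phi x)^-1.
Proof. by apply/esym/mulg1_eq; rewrite -gmulfM mulgV mult1. Qed.

Lemma multX x n : phi (x ^+ n) = phi x ^+ n.
Proof. by elim: n => [|n IHn]; rewrite ?mult1 // !expgS gmulfM IHn. Qed.

Lemma multJ x y : phi (x ^ y) = phi x ^ phi y.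
Proof. by rewrite /conjg !gmulfM multV. Qed.

Lemma mult_inj : (forall x, phi x = 1 -> x = 1) -> injective phi.
Proof.
move=> ker1 x y xy; apply/eqP; rewrite -divg_eq1; apply/eqP/ker1.
by rewrite gmulfM multV xy mulgV.
Qed.

End Multiplicative.

Section MorphismImage.
Variables (X H : groupType) (phi : {multiplicative X -> H}).

Definition morphism_image : {pred H} := fun h => `[< exists x, phi x = h >].

Lemma morphism_image_closed : group_closed morphism_image.
Proof.
split; first by apply/asboolP; exists 1; exact: mult1.
move=> _ _ /asboolP[x <-] /asboolP[y <-]; apply/asboolP.
by exists (x * y^-1); rewrite gmulfM multV.
Qed.

(** The transfer needs a subgroup of finite index. Scalars have infinite index in GL_2, so the
    transfer is taken in the image of [phi]. *)
Definition image_type := {h : H | h \in morphism_image}.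

HB.instance Definition _ := SubChoice.on image_type.
HB.instance Definition _ :=
  SubChoice_isSubGroup.Build H morphism_image image_type morphism_image_closed.

Definition image_val (x : image_type) : H := val x.

Lemma image_val_inj : injective image_val.
Proof. exact: val_inj. Qed.

Lemma image_valM (x y : image_type) : image_val (x * y) = image_val x * image_val y.
Proof. exact: valM. Qed.

Lemma image_valV (x : image_type) : image_val x^-1 = (image_val x)^-1.
Proof. exact: (@gmulfV _ _ (val : image_type -> H)). Qed.

Definition to_image (x : X) : image_type :=
  Sub (phi x) (asboolT (ex_intro (fun y => phi y = phi x) x erefl)).

Lemma to_imageK x : image_val (to_image x) = phi x.
Proof. by rewrite /image_val SubK. Qed.

Lemma to_imageM : {morph to_image : x y / x * y}.
Proof. by move=> x y; apply: image_val_inj; rewrite image_valM !to_imageK gmulfM. Qed.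

HB.instance Definition _ := isMultiplicative.Build _ _ to_image to_imageM.

Lemma to_image_surj y : exists x, to_image x = y.
Proof.
have /asboolP[x xE] := valP y.
by exists x; apply: val_inj; rewrite SubK.
Qed.

End MorphismImage.

Lemma subseq_reps (X : eqType) (e : rel X) (l : seq X) :
  equivalence_rel e ->
  exists l', [/\ subseq l' l, pairwise (fun x y => ~~ e x y) l' &
    forall x, x \in l -> exists2 y, y \in l' & e y x].
Proof.
move=> /equivalence_relP[er et].
have es x y : e x y -> e y x by move=> xy; rewrite -(et _ _ xy) er.
elim: l => [|x l [l' [sl pl cl]]]; first by exists [::].
have [[y yl' yx]|nx] := pselect (exists2 y, y \in l' & e y x).
  exists l'; split=> //; first exact: subseq_trans (subseq_cons l x).
  by move=> z; rewrite inE => /predU1P[->|/cl//]; exists y.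
exists (x :: l'); split=> [|/=|z].
- by rewrite /= eqxx.
- rewrite pl andbT; apply/allP => y yl'; apply/negP => /es xy.
  by apply: nx; exists y.
rewrite inE => /predU1P[->|/cl[y yl' yz]]; first by exists x; rewrite ?mem_head.
by exists y; rewrite // inE yl' orbT.
Qed.

Lemma pairwise_nth_inj (X : eqType) (e : rel X) (l : seq X) x i j :
  equivalence_rel e -> pairwise (fun x y => ~~ e x y) l ->
  (i < size l)%N -> (j < size l)%N -> e (nth x l i) (nth x l j) -> i = j.
Proof.
move=> /equivalence_relP[er et] /(pairwiseP x) pl il jl eij.
have eji : e (nth x l j) (nth x l i) by rewrite -(et _ _ eij) er.
by case: (ltngtP i j) => // [/(pl i j il jl)|/(pl j i jl il)]; rewrite ?eij ?eji.
Qed.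

(** * Faithfulness of a representation of a triple *)

Section FaithfulTriple.
Variables (X H : groupType) (phi : {multiplicative X -> H}) (S : {pred H}).
Variables (x0 x1 x2 : X) (a b c N : nat).
Hypothesis S_central : central_subgroup S.
Hypothesis x_triple : J_triple x0 x1 x2 a b c.
Hypothesis abc_bound : coset_bound a b c N.
Hypotheses (a0 : (0 < a)%N) (b0 : (0 < b)%N) (c0 : (0 < c)%N).
Hypothesis x0S : forall n, phi x0 ^+ n \in S -> (a %| n)%N.
Hypothesis x1S : forall n, phi x1 ^+ n \in S -> (b %| n)%N.
Hypothesis x2S : forall n, phi x2 ^+ n \in S -> (c %| n)%N.
Local Notation z := (x0 * x1 * x2).
Hypothesis zS : phi z \in S.
Hypothesis z_order : forall n, phi z ^+ n = 1 -> (N %| n)%N.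

Let S1 : 1 \in S. Proof. by case: S_central => -[]. Qed.
Let SM : {in S &, forall x y, x * y \in S}.
Proof. by case: S_central => /group_closedM. Qed.
Let SV : {in S, forall x, x^-1 \in S}.
Proof. by case: S_central => /group_closedV. Qed.

Let cycS x : x \in cyc z -> phi x \in S.
Proof.
have SX n : phi z ^+ n \in S by elim: n => [//|n IHn]; rewrite expgS; exact: SM.
by move=> /cycP[m [n ->]]; rewrite gmulfM multV !multX; apply: SM => //; exact: SV.
Qed.

Definition same_mod x y := (phi x)^-1 * phi y \in S.

Let same_mod_equiv : equivalence_rel same_mod.
Proof.
have er x : same_mod x x by rewrite /same_mod mulVg.
have es x y : same_mod x y -> same_mod y x by rewrite /same_mod => /SV; gsimp.
have et y x w : same_mod x y -> same_mod y w -> same_mod x w.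
  by rewrite /same_mod => xy yw; move: (SM xy yw); gsimp.
apply/equivalence_relP; split=> // x y xy w.
by apply/idP/idP; apply: et => //; exact: es.
Qed.

(** Thin the list of at most [N] cosets to a system [l'] of representatives modulo [S]. The transfer
    of the image into [S] kills the three generators, so [phi z ^+ size l' = 1] and [N] divides
    [size l']. Hence nothing was removed and the bound is attained. *)
Lemma faithful_triple_cosets : (0 < N)%N ->
  exists l, [/\ size l = N, pairwise (fun x y => ~~ same_mod x y) l &
    forall x, exists2 y, y \in l & y^-1 * x \in cyc z].
Proof.
move=> N0; have [l sl cover] := abc_bound x_triple.
have [l' [sub_l' pl' cl']] := subseq_reps l same_mod_equiv.
suff sl' : (N <= size l')%N.
  have ll' : l' = l.
    apply/eqP; rewrite -(size_subseq_leqif sub_l').2 eqn_leq size_subseq //=.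
    exact: leq_trans sl'.
  rewrite ll' in sl' pl'; exists l; split=> //.
  by apply/eqP; rewrite eqn_leq sl.
have cover' x : exists2 y, y \in l' & same_mod y x.
  have [r /cl'[y yl' yr] rx] := cover x; exists y => //.
  have [_ et] := (equivalence_relP same_mod).1 same_mod_equiv.
  by rewrite (et _ _ yr) /same_mod -multV -gmulfM; exact: cycS.
have l'0 : (0 < size l')%N by have [y] := cover' 1; case: (l').
pose Y := image_type phi; pose SY : {pred Y} := [pred y | image_val y \in S].
have SYc : central_subgroup SY.
  split; first split; rewrite ?inE //.
    by move=> x y; rewrite !inE image_valM image_valV => xS yS; apply: SM => //; exact: SV.
  by move=> x /S_central.2 xC y; apply: image_val_inj; rewrite !image_valM xC.
pose r (d : 'I_(size l')) : Y := to_image phi (nth 1 l' d).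
have SYE x y : ((to_image phi x)^-1 * to_image phi y \in SY) = same_mod x y.
  by rewrite inE image_valM image_valV.
have r_cover y : exists d, (r d)^-1 * y \in SY.
  have [x <-] := to_image_surj y; have [w wl' wx] := cover' x.
  have wi : (index w l' < size l')%N by rewrite index_mem.
  by exists (Ordinal wi); rewrite SYE /= nth_index.
have r_uniq d d' : (r d)^-1 * r d' \in SY -> d = d'.
  by rewrite SYE => /(pairwise_nth_inj same_mod_equiv pl' (ltn_ord d) (ltn_ord d'))/val_inj.
have [_ [x0a x1b x2c] _] := x_triple.
have XY x n : (to_image phi x) ^+ n \in SY -> phi x ^+ n \in S.
  by rewrite -[X in X \in SY]multX -[X in _ -> X \in S]multX inE => xS; exact: xS.
have ti1 x n : x ^+ n = 1 -> to_image phi x ^+ n = 1.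
  by move=> xn; rewrite -[LHS](multX (to_image phi)) xn mult1.
have zM : to_image phi z ^+ size l' = 1.
  rewrite !to_imageM.
  apply: (@transfer3_exp _ _ SYc _ r r_cover r_uniq _ _ _ a b c) => //;
    [exact: ti1 | exact: ti1 | exact: ti1 | by move=> n /XY/x0S | by move=> n /XY/x1S
    | by move=> n /XY/x2S | by rewrite -!to_imageM].
have {}zM : phi z ^+ size l' = 1.
  by move: zM => /(congr1 (@image_val _ _ _)); rewrite -(multX (to_image phi)) -multX.
by apply: dvdn_leq => //; exact: z_order.
Qed.

(** As the [N] representatives stay distinct modulo [S], only powers of [z] map into [S]. A second
    transfer, of [X] into these powers, gives [z ^+ N = 1]; by [z_order], [phi] is then injective on
    the powers of [z]. *)
Lemma faithful_triple : (0 < N)%N -> injective phi.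
Proof.
move=> N0; have [l [sl pl cover]] := faithful_triple_cosets N0.
have kerS x : phi x \in S -> x \in cyc z.
  (* Compare the representatives [y] of [x] and [w] of 1: both map into [S], so they coincide. *)
  move=> xS; have [y yl yx] := cover x; have [w wl w1] := cover 1.
  rewrite mulg1 in w1; have [cyc1 _] := cyc_closed z.
  have cycM := group_closedM (cyc_closed z); have cycV := group_closedV (cyc_closed z).
  have wC : w \in cyc z by rewrite -[w]invgK; exact: cycV.
  suff yw : y = w by rewrite -(mulVKg w x) -{2}yw; exact: cycM.
  have yS : phi y \in S.
    have := SM xS (SV (cycS yx)); rewrite -multV -gmulfM; gsimp.
    by [].
  have : same_mod y w by apply: SM; [exact: SV | exact: cycS].
  rewrite -(nth_index 1 yl) -(nth_index 1 wl) => /(pairwise_nth_inj same_mod_equiv pl) E.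
  by rewrite E ?index_mem.
apply: mult_inj => x phix.
have [zC [x0a x1b x2c] _] := x_triple.
have cA := cyc_central zC.
have zN : z ^+ N = 1.
  pose r (d : 'I_N) := nth 1 l d.
  apply: (@transfer3_exp _ _ cA _ r _ _ _ _ _ a b c) => //.
  - move=> y; have [w wl wy] := cover y.
    have wi : (index w l < N)%N by rewrite -sl index_mem.
    by exists (Ordinal wi); rewrite /r /= nth_index.
  - move=> d d' /cycS; rewrite gmulfM multV => dd'; apply: val_inj.
    by apply: (pairwise_nth_inj same_mod_equiv pl) dd'; rewrite sl.
  - by move=> n /cycS; rewrite multX; exact: x0S.
  - by move=> n /cycS; rewrite multX; exact: x1S.
  - by move=> n /cycS; rewrite multX; exact: x2S.
  - exact: cyc_id.
have /kerS/cycP[m [n xE]] : phi x \in S by rewrite phix.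
have zmn i j : (i <= j)%N -> phi (z ^+ i) = phi (z ^+ j) -> z ^+ i = z ^+ j.
  move=> ij; rewrite -(subnKC ij) !multX expgnDr -[X in X = _]mulg1 => /mulgI/esym/z_order.
  by case/dvdnP=> q ->; rewrite expgnDr mulnC expgnA zN expg1n mulg1.
have phimn : phi (z ^+ m) = phi (z ^+ n).
  by apply/eqP; rewrite -divg_eq1 -multV -gmulfM -xE phix.
have -> : x = 1.
  by rewrite xE; case: (leqP m n) => [mn | /ltnW nm];
    [rewrite (zmn m n) | rewrite -(zmn n m)] => //; rewrite mulgV.
by [].
Qed.

End FaithfulTriple.

(** * Reflections in GL_2 *)

Section GL2.
Variable F : fieldType.
Local Open Scope ring_scope.
Implicit Types (A B X Y : GL 2 F) (M N : 'M[F]_2) (z c : F).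
Local Notation o0 := (ord0 : 'I_2).
Local Notation o1 := (ord_max : 'I_2).

Lemma ord2P (P : 'I_2 -> Prop) : P o0 -> P o1 -> forall i, P i.
Proof.
move=> P0 P1 i; have [i0|i1] : i = o0 \/ i = o1.
- by case: i => -[|[|//]] ?; [left | right]; apply: val_inj.
- by rewrite i0.
- by rewrite i1.
Qed.

Lemma big_ord2 (f : 'I_2 -> F) : \sum_i f i = f o0 + f o1.
Proof. by rewrite big_ord_recl big_ord1; congr (_ + f _); apply: val_inj. Qed.

Lemma mx2P M N : M o0 o0 = N o0 o0 -> M o0 o1 = N o0 o1 ->
  M o1 o0 = N o1 o0 -> M o1 o1 = N o1 o1 -> M = N.
Proof. by move=> *; apply/matrixP; apply: ord2P; apply: ord2P. Qed.

Lemma mul_mx2E M N i j : (M *m N) i j = M i o0 * N o0 j + M i o1 * N o1 j.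
Proof. by rewrite mxE big_ord2. Qed.

Lemma tr_mx2 M : \tr M = M o0 o0 + M o1 o1.
Proof. exact: big_ord2. Qed.

Lemma det_mx2 M : \det M = M o0 o0 * M o1 o1 - M o0 o1 * M o1 o0.
Proof.
rewrite (expand_det_row _ o0) big_ord2 /cofactor !det_mx11 !mxE.
have -> : lift o0 0 = o1 by apply: val_inj.
have -> : lift o1 0 = o0 by apply: val_inj.
by rewrite /= expr0 mul1r expr1 mulN1r mulrN.
Qed.

Lemma GL2P A B : A o0 o0 = B o0 o0 -> A o0 o1 = B o0 o1 ->
  A o1 o0 = B o1 o0 -> A o1 o1 = B o1 o1 -> A = B.
Proof. by move=> *; apply: val_inj; apply: mx2P. Qed.

Lemma GL_mulE A B i j : (A * B)%g i j = A i o0 * B o0 j + A i o1 * B o1 j.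
Proof. exact: mul_mx2E. Qed.

Lemma GL_oneE i j : (1%g : GL 2 F) i j = (i == j)%:R.
Proof. by rewrite mxE. Qed.

Lemma GL_det_neq0 A : \det A != 0.
Proof. by have := GLmx_unit A; rewrite unitmxE unitfE. Qed.

Lemma GL_detM A B : \det (A * B)%g = \det A * \det B.
Proof. exact: det_mulmx. Qed.

Lemma GL_det1 : \det (1%g : GL 2 F) = 1.
Proof. exact: det1. Qed.

Lemma GL_detV A : \det A^-1%g = (\det A)^-1.
Proof. exact: det_inv. Qed.

Lemma GL_trMC A B : \tr (A * B)%g = \tr (B * A)%g.
Proof. exact: mxtrace_mulC. Qed.

Lemma GL_trJ A B : \tr (A ^ B)%g = \tr A.
Proof. by rewrite /conjg GL_trMC -mulgA mulgV mulg1. Qed.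

Lemma GL_detJ A B : \det (A ^ B)%g = \det A.
Proof. by rewrite /conjg !GL_detM GL_detV mulrC mulfK ?GL_det_neq0. Qed.

(** Singular matrices are sent to 1, so unfolding [GL_of] requires a non-zero determinant; in
    particular [scal 0] is 1. *)
Definition GL_of M : GL 2 F := insubd (1%g : GL 2 F) M.

Lemma GL_ofK M : \det M != 0 -> GLmx (GL_of M) = M.
Proof. by move=> M0; rewrite /GL_of -[GLmx _]/(val _) insubdK // unitmxE unitfE. Qed.

Definition scal c : GL 2 F := GL_of c%:M.

Lemma scalE c : c != 0 -> GLmx (scal c) = c%:M.
Proof. by move=> c0; rewrite GL_ofK // det_scalar expf_neq0. Qed.

Definition scalars : {pred GL 2 F} := fun A =>
  [&& A o0 o1 == 0, A o1 o0 == 0 & A o0 o0 == A o1 o1].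

Lemma scalarsP A : reflect (exists2 c, c != 0 & A = scal c) (A \in scalars).
Proof.
apply: (iffP and3P) => [[/eqP A01 /eqP A10 /eqP A00] | [c c0 ->]].
  have c0 : A o0 o0 != 0.
    apply/eqP => c0; have := GL_det_neq0 A.
    by rewrite det_mx2 -A00 c0 A01 !mul0r subr0 eqxx.
  by exists (A o0 o0) => //; apply: GL2P; rewrite scalE // !mxE //= ?mulr1n ?mulr0n.
by rewrite scalE // !mxE /= !mulr0n eqxx.
Qed.

Lemma scal_in c : c != 0 -> scal c \in scalars.
Proof. by move=> c0; apply/scalarsP; exists c. Qed.

Lemma scal_mulE c A : c != 0 -> GLmx (scal c * A)%g = c *: GLmx A.
Proof. by move=> c0; rewrite -mul_scalar_mx -scalE. Qed.

Lemma scal_central c A : commute (scal c) A.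
Proof.
have [->|c0] := eqVneq c 0; last first.
  by apply: val_inj => /=; rewrite scalE // scalar_mxC.
suff -> : scal 0 = 1%g by exact/commute_sym/commute1.
by rewrite /scal /GL_of /insubd insubN // unitmxE unitfE det_scalar expr0n eqxx.
Qed.

Lemma scalM c d : c != 0 -> d != 0 -> (scal c * scal d)%g = scal (c * d).
Proof.
move=> c0 d0; apply: val_inj; rewrite /= !scalE ?mulf_neq0 //.
exact/esym/scalar_mxM.
Qed.

Lemma scal1 : scal 1 = 1%g.
Proof. by apply: val_inj; rewrite [LHS]scalE ?oner_eq0. Qed.

Lemma scalX c n : c != 0 -> (scal c ^+ n)%g = scal (c ^+ n).
Proof.
move=> c0; elim: n => [|n IHn]; first by rewrite scal1.
by rewrite expgS IHn exprS scalM // expf_neq0.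
Qed.

Lemma scal_inj c d : c != 0 -> d != 0 -> scal c = scal d -> c = d.
Proof.
move=> c0 d0 /(congr1 (fun A : GL 2 F => A o0 o0)).
by rewrite !scalE // !mxE.
Qed.

Lemma scalV c : c != 0 -> (scal c)^-1%g = scal c^-1.
Proof.
by move=> c0; apply: mulg1_eq; rewrite scalM ?invr_neq0 // divff // scal1.
Qed.

Lemma scalar_closed : group_closed scalars.
Proof.
split; first by rewrite -scal1; apply: scal_in; rewrite oner_eq0.
move=> _ _ /scalarsP[c c0 ->] /scalarsP[d d0 ->].
by rewrite scalV // scalM ?invr_neq0 // scal_in // mulf_neq0 ?invr_neq0.
Qed.

Lemma scalar_central : central_subgroup scalars.
Proof.
by split; [exact: scalar_closed | move=> _ /scalarsP[c _ ->] A; exact: scal_central].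
Qed.

Lemma scalJ c A : (scal c ^ A)%g = scal c.
Proof. by rewrite /conjg scal_central mulKg. Qed.

Lemma scalarsJ A B : ((A ^ B)%g \in scalars) = (A \in scalars).
Proof.
apply/idP/idP => /scalarsP[c c0 E]; last by rewrite E scalJ scal_in.
by rewrite -(conjgK B A) E scalJ scal_in.
Qed.

Lemma mx2_Cayley M : M *m M = \tr M *: M - (\det M)%:M.
Proof. by rewrite tr_mx2 det_mx2; apply: mx2P; rewrite mul_mx2E !mxE /=; ring. Qed.

(** Stands for a linear-combination tactic: a known equation [l = r] reduces the goal to
    [x - y = l - r], left to [ring] or [field]. *)
Lemma lin_comb (l r x y : F) : l = r -> x - y = l - r -> x = y.
Proof. by move=> -> /eqP; rewrite subrr subr_eq0 => /eqP. Qed.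

(** Both [p] and [q] are multiples of [v]; hypotheses and conclusions are vanishing 2x2 minors.
    Permuting coordinates covers any non-zero entry of [v]. *)
Lemma parallel3 (v1 v2 v3 p1 p2 p3 q1 q2 q3 : F) : v1 != 0 ->
  v1 * p2 = v2 * p1 -> v1 * p3 = v3 * p1 -> v1 * q2 = v2 * q1 -> v1 * q3 = v3 * q1 ->
  [/\ p1 * q2 = p2 * q1, p1 * q3 = p3 * q1 & p2 * q3 = p3 * q2].
Proof.
move=> v0 p2E p3E q2E q3E.
have -> : p2 = v2 * p1 / v1 by rewrite -p2E mulrC mulKf.
have -> : p3 = v3 * p1 / v1 by rewrite -p3E mulrC mulKf.
have -> : q2 = v2 * q1 / v1 by rewrite -q2E mulrC mulKf.
have -> : q3 = v3 * q1 / v1 by rewrite -q3E mulrC mulKf.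
by split; ring.
Qed.

(* the centraliser of a non-scalar 2x2 matrix [A] is [F[A]], hence abelian *)
Lemma commute_nonscalar A X Y : A \notin scalars ->
  commute A X -> commute A Y -> commute X Y.
Proof.
move=> nA AX AY.
have AXe i j := congr1 (fun B : GL 2 F => B i j) AX.
have AYe i j := congr1 (fun B : GL 2 F => B i j) AY.
move: (AXe o0 o0) (AXe o0 o1) (AXe o1 o0) (AYe o0 o0) (AYe o0 o1) (AYe o1 o0).
rewrite !GL_mulE => {AX AY AXe AYe} X00 X01 X10 Y00 Y01 Y10.
(* Commuting with [A] means that the traceless parts, with coordinates (a, b, c) and (x, x1, x2),
   are proportional. *)
pose a := A o0 o0 - A o1 o1; pose b := A o0 o1; pose c := A o1 o0.
have abc : [|| a != 0, b != 0 | c != 0].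
  apply: contraR nA; rewrite !negb_or !negbK subr_eq0 => /and3P[a0 b0 c0].
  by apply/and3P.
pose x := X o0 o0 - X o1 o1; pose y := Y o0 o0 - Y o1 o1.
pose x1 := X o0 o1; pose x2 := X o1 o0; pose y1 := Y o0 o1; pose y2 := Y o1 o0.
have X1 : b * x2 = c * x1 by apply: (lin_comb X00); rewrite /b /c /x1 /x2; ring.
have X2 : a * x1 = b * x by apply: (lin_comb X01); rewrite /a /b /x /x1; ring.
have X3 : a * x2 = c * x by apply: (lin_comb (esym X10)); rewrite /a /c /x /x2; ring.
have Y1 : b * y2 = c * y1 by apply: (lin_comb Y00); rewrite /b /c /y1 /y2; ring.
have Y2 : a * y1 = b * y by apply: (lin_comb Y01); rewrite /a /b /y /y1; ring.
have Y3 : a * y2 = c * y by apply: (lin_comb (esym Y10)); rewrite /a /c /y /y2; ring.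
have [E1 E2 E3] : [/\ x * y1 = x1 * y, x * y2 = x2 * y & x1 * y2 = x2 * y1].
  case/or3P: abc => v0.
  - exact: (parallel3 v0 X2 X3 Y2 Y3).
  - by have [-> -> ->] := parallel3 v0 (esym X2) X1 (esym Y2) Y1.
  - by have [-> -> ->] := parallel3 v0 (esym X3) (esym X1) (esym Y3) (esym Y1).
apply: GL2P; rewrite !GL_mulE.
- by apply: (lin_comb E3); rewrite /x1 /x2 /y1 /y2; ring.
- by apply: (lin_comb E1); rewrite /x /x1 /y /y1; ring.
- by apply: (lin_comb (esym E2)); rewrite /x /x2 /y /y2; ring.
- by apply: (lin_comb (esym E3)); rewrite /x1 /x2 /y1 /y2; ring.
Qed.
End GL2.

Arguments scalars {F}.

Section Reflections.
Variable F : fieldType.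
Local Open Scope ring_scope.
Implicit Types (A B : GL 2 F) (M N : 'M[F]_2) (z c : F).
Local Notation o0 := (ord0 : 'I_2).
Local Notation o1 := (ord_max : 'I_2).

Lemma GL_invE A : GLmx A^-1%g = (\det A)^-1 *: ((\tr A)%:M - GLmx A).
Proof.
have dA := GL_det_neq0 A; have CA := mx2_Cayley A.
have AV : A^-1%g *m A = 1%:M by rewrite -[LHS]/(GLmx (A^-1 * A)%g) mulVg.
apply: (@scalerI F 'M[F]_2 _ dA); rewrite scalerA divff // scale1r.
have : A^-1%g *m (A *m A) = A^-1%g *m (\tr A *: GLmx A - (\det A)%:M) by rewrite CA.
rewrite mulmxA AV mul1mx mulmxBr -scalemxAr AV mul_mx_scalar scalemx1.
by move/eqP; rewrite eq_sym subr_eq addrC -subr_eq => /eqP.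
Qed.

Lemma GL_trV A : \tr A^-1%g = \tr A / \det A.
Proof. by rewrite GL_invE mxtraceZ raddfB /= mxtrace_scalar mulr2n addrK mulrC. Qed.

(** Eigenvalues 1 and [z], encoded by trace and determinant. As [z] differs from 1 such a matrix is
    diagonalisable, so its order is that of [z]. *)
Definition refl z A := [/\ \tr A = 1 + z, \det A = z & z != 1].

Lemma refl_neq0 z A : refl z A -> z != 0.
Proof. by case=> _ <- _; exact: GL_det_neq0. Qed.

Lemma reflJ z A B : refl z A -> refl z (A ^ B)%g.
Proof. by case=> trA detA z1; split; rewrite ?GL_trJ ?GL_detJ. Qed.

Lemma refl_nonscalar z A : refl z A -> A \notin scalars.
Proof.
move=> [trA detA z1]; apply: contra z1 => /and3P[/eqP A01 _ /eqP A00].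
move: trA detA; rewrite tr_mx2 det_mx2 A01 A00 mul0r subr0 => tr2 zE.
have : (A o1 o1 - 1) ^+ 2 = 0.
  by apply: (lin_comb (esym tr2)); rewrite -[in RHS]zE; ring.
by move=> /eqP; rewrite expf_eq0 /= subr_eq0 => /eqP w1; rewrite -zE w1 mulr1.
Qed.

(** Interpolation of the [n]-th power at the eigenvalues 1 and [z], with the denominator [z - 1]
    cleared. *)
Lemma refl_exp z A n : refl z A ->
  (z - 1) *: GLmx (A ^+ n)%g = (z ^+ n - 1) *: GLmx A + (z - z ^+ n)%:M.
Proof.
move=> [trA detA _]; elim: n => [|n IHn].
  by rewrite !expr0 subrr scale0r add0r -scalemx1.
rewrite expgSr -[GLmx _]/(GLmx (A ^+ n)%g *m A) scalemxAl IHn mulmxDl -scalemxAl.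
rewrite mx2_Cayley trA detA mul_scalar_mx exprS.
by apply: mx2P; rewrite !mxE /=; ring.
Qed.

Lemma refl_exp_eq1 z A n : refl z A -> z ^+ n = 1 -> (A ^+ n)%g = 1%g.
Proof.
move=> rA zn; have [_ _ z1] := rA; apply: val_inj.
have := refl_exp n rA; rewrite zn subrr scale0r add0r -scalemx1.
by move/(@scalerI F 'M[F]_2 _ _); apply; rewrite subr_eq0.
Qed.

Lemma refl_exp_scalar z A n : refl z A -> (A ^+ n)%g \in scalars -> z ^+ n = 1.
Proof.
move=> rA /scalarsP[c c0 AE].
have := refl_exp n rA; rewrite AE scalE // => E.
apply/eqP; rewrite -subr_eq0; apply: contraT => zn.
have := refl_nonscalar rA; rewrite -[_ \notin _]/(~~ _); case/negP.
have Eij i j := congr1 (fun M : 'M[F]_2 => M i j) E.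
move: (Eij o0 o1) (Eij o1 o0) (Eij o0 o0) (Eij o1 o1).
rewrite !mxE /= !mulr0n !mulr1n !mulr0 !addr0 => E01 E10 -> E11.
apply/and3P; split.
- by move/esym/eqP: E01; rewrite mulf_eq0 (negPf zn).
- by move/esym/eqP: E10; rewrite mulf_eq0 (negPf zn).
- by move: E11 => /addIr/(mulfI zn) ->.
Qed.

Lemma refl_expr z A n : refl z A -> z ^+ n != 1 -> refl (z ^+ n) (A ^+ n)%g.
Proof.
move=> rA zn; have [trA detA z1] := rA; split=> //; last first.
  by rewrite -detA; elim: n {zn} => [|n IHn]; rewrite ?det1 // expgS GL_detM IHn exprS.
have := congr1 mxtrace (refl_exp n rA).
rewrite mxtraceZ mxtraceD mxtraceZ mxtrace_scalar trA => E.
apply: (mulfI (_ : z - 1 != 0)); first by rewrite subr_eq0.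
by rewrite E; ring.
Qed.

Lemma refl_rank z A : refl z A -> \rank (eigenspace A 1) = 1%N.
Proof.
move=> rA; have [trA detA z1] := rA.
rewrite /eigenspace mxrank_ker.
have A1 : GLmx A - 1%:M != 0.
  rewrite subr_eq0; apply: contra (refl_nonscalar rA) => /eqP AE.
  by apply/and3P; rewrite AE !mxE.
have : (\rank (GLmx A - 1%:M)%R < 2)%N.
  rewrite ltn_neqAle rank_leq_row andbT; apply/negP => /eqP rk.
  have : GLmx A - 1%:M \in unitmx by rewrite -row_free_unit /row_free rk.
  rewrite unitmxE unitfE det_mx2 !mxE /= => /negP; apply; apply/eqP.
  move: trA detA; rewrite tr_mx2 det_mx2 => trA detA.
  have E : A o0 o0 * A o1 o1 - A o0 o1 * A o1 o0 - (A o0 o0 + A o1 o1) = z - (1 + z).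
    by rewrite detA trA.
  by apply: (lin_comb E); ring.
by move: A1; rewrite -mxrank_eq0; case: (\rank _) => [|[|]].
Qed.

End Reflections.

Section CharacteristicPolynomial.
Variable F : fieldType.
Local Open Scope ring_scope.
Implicit Types (A B : GL 2 F) (M N : 'M[F]_2) (z c : F).
Local Notation o0 := (ord0 : 'I_2).
Local Notation o1 := (ord_max : 'I_2).

(* [(A - nu) A = mu (A - nu)] for the two eigenvalues [mu], [nu] *)
Lemma eigenvalue_exp A mu nu c n : A \notin scalars ->
  \tr A = mu + nu -> \det A = mu * nu -> c != 0 -> (A ^+ n)%g = scal c -> mu ^+ n = c.
Proof.
move=> nA trA detA c0 An; pose M := GLmx A - nu%:M.
have M0 : M != 0.
  rewrite subr_eq0; apply: contra nA => /eqP AE.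
  by apply/and3P; rewrite AE !mxE.
have MA : M *m A = mu *: M.
  rewrite mulmxBl mx2_Cayley trA detA mul_scalar_mx.
  by apply: mx2P; rewrite !mxE /=; ring.
have MAn : M *m (A ^+ n)%g = mu ^+ n *: M.
  elim: n {An} => [|n IHn]; first by rewrite expr0 scale1r mulmx1.
  by rewrite expgSr mulmxA IHn -scalemxAl MA scalerA exprSr.
move: MAn; rewrite An scalE // mul_mx_scalar => /eqP.
by rewrite -subr_eq0 -scalerBl scaler_eq0 (negPf M0) orbF subr_eq0 => /eqP.
Qed.

Definition mk2 (a b c d : F) : 'M[F]_2 :=
  \matrix_(i, j) if i == o0 then if j == o0 then a else b
                  else if j == o0 then c else d.

Lemma mk2E a b c d : (mk2 a b c d o0 o0 = a) * (mk2 a b c d o0 o1 = b) *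
  (mk2 a b c d o1 o0 = c) * (mk2 a b c d o1 o1 = d).
Proof. by rewrite !mxE. Qed.

Lemma det_mk2 a b c d : \det (mk2 a b c d) = a * d - b * c.
Proof. by rewrite det_mx2 !mk2E. Qed.

(** Some row vector [v = (a, b)] is independent of [v A], since otherwise every vector is an
    eigenvector and [A] is scalar. These two vectors are the rows of [P]. *)
Lemma companion_conj A : A \notin scalars -> exists B : GL 2 F,
  GLmx (A ^ B)%g = mk2 0 1 (- \det A) (\tr A).
Proof.
move=> nA; have [a [b P0]] : exists a b,
    a * (a * A o0 o1 + b * A o1 o1) - b * (a * A o0 o0 + b * A o1 o0) != 0.
  have [A01|A01] := eqVneq (A o0 o1) 0; last by exists 1, 0; rewrite !mul1r !mul0r addr0 subr0.
  have [A10|A10] := eqVneq (A o1 o0) 0; last first.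
    by exists 0, 1; rewrite !mul1r !mul0r !add0r oppr_eq0.
  exists 1, 1; rewrite A01 A10 !mul1r add0r addr0 subr_eq0.
  by apply: contra nA => /eqP A11; apply/and3P; rewrite A01 A10 A11.
pose P := GL_of (mk2 a b (a * A o0 o0 + b * A o1 o0) (a * A o0 o1 + b * A o1 o1)).
have PK := GL_ofK (etrans (congr1 (fun x => x != 0) (det_mk2 _ _ _ _)) P0).
pose Cm := mk2 0 1 (- \det A) (\tr A).
exists P^-1%g; have PA : P *m A = Cm *m P.
  by rewrite /P PK /Cm det_mx2 tr_mx2; apply: mx2P; rewrite !mul_mx2E !mk2E; ring.
rewrite /conjg invgK -[GLmx _]/(P *m (A *m P^-1%g)) mulmxA PA -mulmxA.
by rewrite -[P *m _]/(GLmx (P * P^-1)%g) mulgV mulmx1.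
Qed.

Lemma nonscalar_conj A B : A \notin scalars -> B \notin scalars ->
  \tr A = \tr B -> \det A = \det B -> exists Q, (A ^ Q)%g = B.
Proof.
move=> /companion_conj[P AP] /companion_conj[Q BQ] trE detE.
exists (P * Q^-1)%g; rewrite conjgM.
have -> : (A ^ P)%g = (B ^ Q)%g by apply: val_inj; rewrite [LHS]AP [RHS]BQ trE detE.
by rewrite conjgK.
Qed.

Lemma mk2_GL_det a b c d : a * d - b * c != 0 ->
  GLmx (GL_of (mk2 a b c d)) = mk2 a b c d.
Proof. by move=> d0; rewrite GL_ofK // det_mk2. Qed.

(** Triangular matrices whose free entry [c] shifts the trace of the product, so every trace occurs.
    They never commute: the upper right entries of the two products are [z2] and 1. *)
Lemma refl_pair z1 z2 t : z1 != 0 -> z2 != 0 -> z1 != 1 -> z2 != 1 ->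
  exists A B, [/\ refl z1 A, refl z2 B, \tr (A * B)%g = t & ~ commute A B].
Proof.
move=> z10 z20 z11 z21; pose c := t - z1 - z2.
have AK : GLmx (GL_of (mk2 z1 1 0 1)) = mk2 z1 1 0 1.
  by rewrite mk2_GL_det // mulr1 mulr0 subr0.
have BK : GLmx (GL_of (mk2 1 0 c z2)) = mk2 1 0 c z2.
  by rewrite mk2_GL_det // mul1r mul0r subr0.
exists (GL_of (mk2 z1 1 0 1)), (GL_of (mk2 1 0 c z2)); split.
- by split=> //; rewrite AK ?tr_mx2 ?det_mk2 ?mk2E; ring.
- by split=> //; rewrite BK ?tr_mx2 ?det_mk2 ?mk2E; ring.
- by rewrite tr_mx2 !GL_mulE AK BK !mk2E /c; ring.
move=> /(congr1 (fun A : GL 2 F => A o0 o1)); rewrite !GL_mulE AK BK !mk2E => E.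
by case/eqP: z21; apply: (lin_comb E); ring.
Qed.

(** The third reflection has to be [l (A B)^-1]. Its determinant is [l ^+ 2 / (z1 * z2) = z3], and
    asking its trace to be [1 + z3] dictates the trace of [A * B]. *)
Lemma refl_triple z1 z2 z3 l : z1 != 0 -> z2 != 0 -> z3 != 0 ->
  z1 != 1 -> z2 != 1 -> z3 != 1 -> l ^+ 2 = z1 * z2 * z3 ->
  exists A B D, [/\ refl z1 A, refl z2 B, refl z3 D, (A * B * D)%g = scal l &
    ~ commute A B /\ \tr (A * B)%g = l * (1 + z3^-1)].
Proof.
move=> z10 z20 z30 z11 z21 z31 lE.
have l0 : l != 0.
  have : l ^+ 2 != 0 by rewrite lE !mulf_neq0.
  by rewrite expf_eq0.
have [A [B [rA rB trAB nAB]]] := refl_pair (l * (1 + z3^-1)) z10 z20 z11 z21.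
exists A, B, ((A * B)^-1 * scal l)%g; split=> //; last by rewrite mulVKg.
have detAB : \det (A * B)%g = z1 * z2 by rewrite GL_detM; case: rA rB => _ -> _ [_ ->].
have z120 : z1 * z2 != 0 by rewrite mulf_neq0.
split=> //.
  rewrite -scal_central scal_mulE // mxtraceZ GL_trV trAB detAB.
  rewrite mulrA mulrA -expr2 lE -mulrA mulrC.
  by field; rewrite z10 z20 z30.
by rewrite GL_detM GL_detV detAB scalE // det_scalar lE mulKf.
Qed.

End CharacteristicPolynomial.

Section FiniteOrder.
Variable C : numClosedFieldType.
Local Open Scope ring_scope.
Implicit Types (A B : GL 2 C) (c z : C).

Lemma eigenvalues_exist A : exists mu nu, \tr A = mu + nu /\ \det A = mu * nu.
Proof.
pose t := \tr A; pose d := \det A; pose r := sqrtC (t ^+ 2 - 4%:R * d).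
have rE : r * r = t ^+ 2 - 4%:R * d by rewrite -expr2 sqrtCK.
exists ((t + r) / 2%:R), ((t - r) / 2%:R); split; first by field.
rewrite -/d; apply: (mulfI (_ : 4%:R != 0 :> C)); first by rewrite pnatr_eq0.
by apply: (lin_comb rE); field.
Qed.

Lemma parabolic_exp A c n : \tr A = c + c -> \det A = c * c ->
  GLmx (A ^+ n.+1)%g = (n.+1%:R * c ^+ n) *: GLmx A - (n%:R * c ^+ n.+1)%:M.
Proof.
move=> trA detA; elim: n => [|n IHn].
  by rewrite expg1 expr0 mulr1 scale1r mul0r raddf0 subr0.
rewrite expgSr -[GLmx _]/(GLmx (A ^+ n.+1)%g *m A) IHn mulmxBl -scalemxAl.
rewrite mx2_Cayley trA detA mul_scalar_mx -(natr1 n.+1) -(natr1 n) !exprS.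
by apply: mx2P; rewrite !mxE /=; ring.
Qed.

(** In characteristic zero the coefficient [n.+1%:R * c ^+ n] of [A] in [parabolic_exp] does not
    vanish. *)
Lemma parabolic_scalar A c n : \tr A = c + c -> \det A = c * c -> (0 < n)%N ->
  (A ^+ n)%g \in scalars -> A \in scalars.
Proof.
move=> trA detA; case: n => [//|n] _ /scalarsP[d d0 An].
have c0 : c != 0.
  by apply/eqP => c0; have := GL_det_neq0 A; rewrite detA c0 mul0r eqxx.
have nc0 : n.+1%:R * c ^+ n != 0 by rewrite mulf_neq0 ?pnatr_eq0 // expf_neq0.
have E := parabolic_exp n trA detA; rewrite An scalE // in E.
have Eij i j := congr1 (fun M : 'M[C]_2 => M i j) E.
move: (Eij ord0 ord_max) (Eij ord_max ord0) (Eij ord0 ord0) (Eij ord_max ord_max).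
rewrite !mxE /= !mulr0n !mulr1n !subr0 => E01 E10 -> E11.
apply/and3P; split.
- by move/esym/eqP: E01; rewrite mulf_eq0 (negPf nc0).
- by move/esym/eqP: E10; rewrite mulf_eq0 (negPf nc0).
- by move: E11 => /addIr/(mulfI nc0) ->.
Qed.

Lemma finite_order_eigenvalues A n : A \notin scalars -> (0 < n)%N ->
  (A ^+ n)%g \in scalars ->
  exists mu nu, [/\ \tr A = mu + nu, \det A = mu * nu, mu != nu & mu ^+ n = nu ^+ n].
Proof.
move=> nA n0 An; have [mu [nu [trA detA]]] := eigenvalues_exist A.
have /scalarsP[c c0 Ac] := An.
exists mu, nu; split=> //.
  by apply: contra nA => /eqP mn; move: trA detA; rewrite mn => tr2 det2;
    exact: parabolic_scalar tr2 det2 n0 An.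
rewrite (eigenvalue_exp nA trA detA c0 Ac).
by rewrite (@eigenvalue_exp _ A nu mu c n) // 1?addrC 1?mulrC.
Qed.

(** Finite order excludes transvections: a non-scalar matrix with both eigenvalues 1 has no scalar
    positive power. *)
Lemma complex_reflectionP A :
  complex_reflection A <-> exists z n, [/\ (0 < n)%N, z ^+ n = 1 & refl z A].
Proof.
split=> [[[n n0 An] rk] | [z [n [n0 zn rA]]]]; last first.
  split; last exact: refl_rank rA.
  by exists n => //; exact: refl_exp_eq1 rA zn.
have nA : A \notin scalars.
  apply/negP => /scalarsP[c c0 AE]; move: rk; rewrite /eigenspace mxrank_ker AE scalE //.
  rewrite -scalemx1 -{2}[1%:M]scale1r -scalerBl.
  have [->|c1] := eqVneq (c - 1) 0; first by rewrite scale0r mxrank0.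
  by rewrite mxrank_scale_nz ?mxrank1.
have det0 : \det (GLmx A - 1%:M) = 0.
  apply/eqP; apply: contraT => d0; move: rk; rewrite /eigenspace mxrank_ker.
  by rewrite mxrank_unit ?unitmxE ?unitfE.
have trA : \tr A = 1 + \det A.
  move: det0; rewrite !det_mx2 tr_mx2 !mxE /= => E; apply: (lin_comb (esym E)).
  by ring.
have dn : \det A ^+ n = 1.
  rewrite -(GL_det1 C) -An; elim: (n) => [|m IHm]; first by rewrite det1.
  by rewrite exprS IHm expgS GL_detM.
exists (\det A), n; split=> //; split=> //; apply: contra nA => /eqP d1.
apply: (@parabolic_scalar A 1 n); rewrite ?trA ?d1 ?mulr1 // An.
by rewrite -(scal1 C) scal_in // oner_eq0.
Qed.

(* A matrix of finite order has eigenvalues of norm 1, hence trace at most 2. *)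
Lemma hyperbolic_order A n : \det A = 1 -> 2%:R <= \tr A -> A != 1%g ->
  (A ^+ n)%g \in scalars -> n = 0%N.
Proof.
move=> detA trA A1 An; apply/eqP; rewrite -leqn0 leqNgt; apply/negP => n0.
have nA : A \notin scalars.
  apply: contra A1 => /scalarsP[c c0 AE]; move: detA trA.
  rewrite AE scalE // det_scalar mxtrace_scalar => /eqP; rewrite sqrf_eq1.
  case/orP=> /eqP -> ; first by rewrite scal1.
  by rewrite mulNrn -subr_ge0 -opprD -natrD oppr_ge0 lern0.
have [mu [nu [trE detE mn _]]] := finite_order_eigenvalues nA n0 An.
have [c c0 Ac] := scalarsP _ An.
have mu_n := eigenvalue_exp nA trE detE c0 Ac.
have nu_n : nu ^+ n = c by rewrite (@eigenvalue_exp _ A nu mu c n) // 1?addrC 1?mulrC.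
have c2 : c ^+ 2 = 1 by rewrite expr2 -{1}mu_n -nu_n -exprMn -detE detA expr1n.
have norm1 x : x ^+ n = c -> `|x| = 1.
  move=> xn; apply/eqP; rewrite -(pexpr_eq1 (n := (n * 2)%N)) ?muln_gt0 ?n0 ?normr_ge0 //.
  by rewrite -normrX exprM xn c2 normr1.
(* Two numbers of norm 1 whose product is 1 are conjugate. *)
have muE : nu = mu^*.
  have mu1 := norm1 _ mu_n; have mu0 : mu != 0 by rewrite -normr_eq0 mu1 oner_eq0.
  by apply: (mulfI mu0); rewrite -detE detA -normCK mu1 expr1n.
have trle : \tr A <= 2%:R.
  rewrite trE muE; apply: le_trans (_ : `|mu + mu^*| <= _).
    by rewrite real_ler_norm // -muE -trE ger0_real // (le_trans _ trA).
  by apply: le_trans (ler_normD _ _) _; rewrite norm_conjC norm1 // -natr1.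
have tr2 : mu + nu = 2%:R by rewrite -trE; apply/le_anti; rewrite trle.
have : (mu - nu) ^+ 2 = 0.
  have d1 : mu * nu = 1 by rewrite -detE.
  have -> : (mu - nu) ^+ 2 = (mu + nu) ^+ 2 - 4%:R * (mu * nu) by ring.
  by rewrite tr2 d1; ring.
by move/eqP; rewrite expf_eq0 subr_eq0 (negPf mn).
Qed.

End FiniteOrder.

(** * Roots of unity and an inequality between cosines *)

Section Cis.
Variable R : realType.
Local Open Scope ring_scope.
Local Notation C := R[i].
Implicit Types (x y : R) (k j n : nat).

Definition cis x : C := Complex (cos x) (sin x).

Lemma cis0 : cis 0 = 1.
Proof. by rewrite /cis cos0 sin0. Qed.

Lemma cisD x y : cis (x + y) = cis x * cis y.
Proof.
rewrite /cis cosD sinD; apply/eqP; rewrite eq_complex /= eqxx /=.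
by apply/eqP; rewrite addrC [cos x * sin y]mulrC mulrC; ring.
Qed.

Lemma cisX x n : cis x ^+ n = cis (x *+ n).
Proof. by elim: n => [|n IHn]; rewrite ?mulr0n ?cis0 // exprS IHn mulrS cisD. Qed.

Lemma cis_neq0 x : cis x != 0.
Proof.
apply/eqP => c0; have := oner_neq0 C; rewrite -cis0 -(subrr x) cisD c0 mul0r.
by rewrite eqxx.
Qed.

Lemma cispi : cis pi = -1.
Proof. by rewrite /cis cospi sinpi; apply/eqP; rewrite eq_complex /= oppr0 !eqxx. Qed.

Lemma cis2pi : cis (pi *+ 2) = 1.
Proof. by rewrite -cisX cispi expr2 mulrNN mulr1. Qed.

Lemma cis_double x : 1 + cis (x + x) = (2%:R * cos x)%:C%C * cis x.
Proof.
apply/eqP; rewrite eq_complex /= cosD sinD.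
have := cos2Dsin2 x => E; apply/andP; split; apply/eqP; last by ring.
by apply: (lin_comb (esym E)); ring.
Qed.

Definition unity k : C := cis (pi *+ 2 / k%:R).

Lemma unity_exp k : (0 < k)%N -> unity k ^+ k = 1.
Proof.
move=> k0; rewrite /unity cisX -[_ *+ k]mulr_natr divfK ?cis2pi // pnatr_eq0.
by rewrite -lt0n.
Qed.

Lemma unity_order k j : (0 < k)%N -> unity k ^+ j = 1 -> (k %| j)%N.
Proof.
move=> k0; rewrite (divn_eq j k) exprD mulnC exprM unity_exp // expr1n mul1r.
set i := (j %% k)%N; have ik : (i < k)%N by rewrite ltn_mod.
rewrite dvdn_addr ?dvdn_mulr // => E.
case: (posnP i) => [-> //|i0]; exfalso.
(* Half of the angle of [unity k ^+ i]: it lies strictly between 0 and pi, where the sine is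
   positive. *)
pose x : R := pi * (i%:R / k%:R).
have k0R : 0 < k%:R :> R by rewrite ltr0n.
have x0 : 0 < x by rewrite mulr_gt0 ?pi_gt0 // divr_gt0 // ltr0n.
have xpi : x < pi by rewrite gtr_pMr ?pi_gt0 // ltr_pdivrMr // mul1r ltr_nat.
have sx : 0 < sin x by apply: sin_gt0_pi; rewrite x0.
have : cis (x + x) = 1.
  rewrite -E /unity cisX; congr cis.
  by rewrite mulrnAl -[_ *+ i]mulr_natr mulrnAl -mulrA [_^-1 * _]mulrC mulr2n.
move=> /(congr1 (@complex.Re R)) /=; rewrite cosD -!expr2 cos2sin2 => E1.
have : sin x ^+ 2 = 0 by lra.
by move/eqP; rewrite expf_eq0 /= gt_eqF.
Qed.

(** The right-hand side minus 1 factors as [(cos t + cos (x + y)) * (cos t + cos (x - y))], and the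
    first factor is non-negative because [x + y <= pi - t]. *)
Lemma cos_sum_ge1 x y t : 0 < x <= pi / 2 -> 0 < y <= pi / 2 -> 0 < t <= pi / 2 ->
  x + y + t <= pi ->
  1 <= cos x ^+ 2 + cos y ^+ 2 + cos t ^+ 2 + 2%:R * (cos x * cos y * cos t).
Proof.
move=> /andP[x0 x1] /andP[y0 y1] /andP[t0 t1] xyt; have pi0 := pi_gt0 R.
have ct : 0 <= cos t by apply: cos_ge0_pihalf; apply/andP; split; lra.
have cB : 0 <= cos (x - y) by apply: cos_ge0_pihalf; apply/andP; split; lra.
have cD : - cos t <= cos (x + y).
  have -> : - cos t = cos (pi - t) by rewrite cosB cospi sinpi; ring.
  rewrite leNgt ltr_cos ?in_itv /= -?leNgt; first by lra.
    by apply/andP; split; lra.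
  by apply/andP; split; lra.
have : 0 <= (cos t + cos (x + y)) * (cos t + cos (x - y)).
  by apply: mulr_ge0; lra.
have := sin2cos2 x; have := sin2cos2 y; rewrite cosD cosB => sx sy.
have -> : (cos t + (cos x * cos y - sin x * sin y)) * (cos t + (cos x * cos y + sin x * sin y)) =
  cos t ^+ 2 + 2%:R * (cos x * cos y * cos t) + cos x ^+ 2 * cos y ^+ 2 - sin x ^+ 2 * sin y ^+ 2 by ring.
rewrite sx sy; set X := cos x ^+ 2; set Y := cos y ^+ 2 => H.
rewrite -subr_ge0; apply: le_trans H _; rewrite le_eqVlt; apply/orP; left; apply/eqP; ring.
Qed.

End Cis.

Section TraceCommutator.
Variable F : fieldType.
Local Open Scope ring_scope.

(** Fricke's trace identity, with the determinants divided out. *)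
Lemma tr_commutator (A B : GL 2 F) (a b x y w : F) :
  \det A = a -> \det B = b -> \tr A = x -> \tr B = y -> \tr (A * B)%g = w ->
  \tr (A * B * A^-1 * B^-1)%g = x ^+ 2 / a + y ^+ 2 / b + w ^+ 2 / (a * b)
     - x * y * w / (a * b) - 2%:R.
Proof.
move=> detA detB trA trB trAB.
have a0 : a != 0 by rewrite -detA GL_det_neq0.
have b0 : b != 0 by rewrite -detB GL_det_neq0.
have trABB : \tr (A *m B *m B) = y * w - b * x.
  rewrite -mulmxA mx2_Cayley mulmxBr -scalemxAr mul_mx_scalar raddfB /= !mxtraceZ.
  by rewrite trB detB trA -trAB.
have trABA : \tr (A *m B *m A) = x * w - a * y.
  rewrite mxtrace_mulC mulmxA mx2_Cayley mulmxBl -scalemxAl mul_scalar_mx raddfB /= !mxtraceZ.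
  by rewrite trA detA trB -trAB.
have trABAB : \tr (A *m B *m A *m B) = w ^+ 2 - 2%:R * (a * b).
  rewrite -mulmxA mx2_Cayley raddfB /= mxtraceZ mxtrace_scalar.
  by rewrite det_mulmx detA detB -[\tr (A *m B)]/(\tr (A * B)%g) trAB mulr_natl.
have -> : \tr (A * B * A^-1 * B^-1)%g = (a * b)^-1 *
    \tr (A *m B *m (x%:M - GLmx A) *m (y%:M - GLmx B)).
  rewrite -[GLmx (A * B * A^-1 * B^-1)%g]/(A *m B *m A^-1%g *m B^-1%g).
  by rewrite !GL_invE detA detB trA trB -!scalemxAr -!scalemxAl !mxtraceZ invfM mulrA [a^-1 * b^-1]mulrC.
rewrite !mulmxBr !mulmxBl !mul_mx_scalar -!scalemxAl !raddfB /= !mxtraceZ.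
rewrite trABB trABA trABAB -[\tr (A *m B)]/(\tr (A * B)%g) trAB.
by field; rewrite a0 b0.
Qed.
End TraceCommutator.

Section SubgroupLemmas.
Variable G : groupType.
Implicit Types (H S : set G).
Local Open Scope classical_set_scope.

Lemma subgroup1 H : is_subgroup H -> H 1.
Proof. by case. Qed.

Lemma subgroupV H x : is_subgroup H -> H x -> H x^-1.
Proof. by case=> H1 HF Hx; rewrite -[x^-1]mul1g; exact: HF. Qed.

Lemma subgroupM H x y : is_subgroup H -> H x -> H y -> H (x * y).
Proof.
by move=> Hg Hx Hy; rewrite -[y]invgK; apply: Hg.2 => //; exact: subgroupV.
Qed.

Lemma subgroupX H x n : is_subgroup H -> H x -> H (x ^+ n).
Proof.
move=> Hg Hx; elim: n => [|n IHn]; first exact: subgroup1.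
by rewrite expgS; exact: subgroupM.
Qed.

Lemma generated_subgroup S : is_subgroup (Defs.generated S).
Proof.
split=> [A [[A1 _] _] //|x y xS yS A AP].
exact: AP.1.2 (xS A AP) (yS A AP).
Qed.

Lemma sub_generated S : S `<=` Defs.generated S.
Proof. exact: sub_gen_smallest. Qed.

Lemma generated_min S H : is_subgroup H -> S `<=` H -> Defs.generated S `<=` H.
Proof. exact: smallest_sub. Qed.

Lemma normal_closure_normal S : is_normal_subgroup (normal_closure S).
Proof.
split; first split=> [A [[[A1 _] _] _] //|x y xS yS A AP].
  exact: AP.1.1.2 (xS A AP) (yS A AP).
by move=> x y xS A AP; exact: AP.1.2 (xS A AP).
Qed.

Lemma sub_normal_closure S : S `<=` normal_closure S.
Proof. exact: sub_gen_smallest. Qed.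

Lemma normal_closure_min S H : is_normal_subgroup H -> S `<=` H -> normal_closure S `<=` H.
Proof. exact: smallest_sub. Qed.

Lemma finite_set_collision S (f : nat -> G) : finite_set S -> (forall n, S (f n)) ->
  exists i j, (i < j)%N /\ f i = f j.
Proof.
move=> /finite_seqP[s sE] fS; pose t := [seq f i | i <- iota 0 (size s).+1].
have ts : {subset t <= s}.
  by move=> _ /mapP[i _ ->]; have := fS i; rewrite sE.
have tu : ~~ uniq t.
  by apply/negP => /uniq_leq_size/(_ ts); rewrite size_map size_iota ltnn.
have [i [j [ij jt tij]]] : exists i j, [/\ (i < j)%N, (j < size t)%N & nth 1 t i = nth 1 t j].
  by have [i [j [? ? ?]]] := uniqPn 1 tu; exists i, j.
exists i, j; split=> //; rewrite size_map size_iota in jt.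
have it := ltn_trans ij jt.
by move: tij; rewrite !(nth_map 0%N) ?size_iota // !nth_iota.
Qed.

End SubgroupLemmas.

Lemma generated_conj (G : groupType) (S : set G) (y : G) :
  (forall x, S x -> Defs.generated S (x ^ y)) -> forall x, Defs.generated S x -> Defs.generated S (x ^ y).
Proof.
move=> Sy; have gS := generated_subgroup S.
apply: (@generated_min _ S [set x | Defs.generated S (x ^ y)]%classic) => //.
split=> [|x x']; first by rewrite /= conj1g; exact: subgroup1.
by rewrite /= conjMg conjVg; exact: gS.2.
Qed.

Lemma isomorphic_to_image (G J H : groupType) (A : set J) (phi : {multiplicative J -> H}) :
  injective phi -> isomorphic_to G A <-> isomorphic_to G (phi @` A)%classic.
Proof.
move=> phi_inj; split=> -[f [fA fi fs]].
  exists (phi \o f); split.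
  - by move=> x _; exists (f x) => //; exact: fA.
  - by move=> x y xT yT /phi_inj; exact: fi.
  - by move=> _ [a aA <-]; have [x xT <-] := fs a aA; exists x.
have /choice[g gP] : forall x, exists a, A a /\ phi a = f x.
  by move=> x; have [a aA aE] := fA x I; exists a.
have gM : {morph g : x y / x * y}.
  by move=> x y; apply: phi_inj; rewrite gmulfM !(gP _).2 gmulfM.
pose HBg := isMultiplicative.Build _ _ g gM.
pose g' : {multiplicative G -> J} := HB.pack g HBg.
exists g'; split.
- by move=> x _; exact: (gP x).1.
- move=> x y xT yT /= gxy; apply: fi => //.
  by rewrite -(gP x).2 -(gP y).2; congr (phi _).
- move=> a aA; have [x xT xE] := fs (phi a) (ex_intro2 _ _ a aA erefl).
  by exists x => //; apply: phi_inj; rewrite -xE -(gP x).2.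
Qed.

(** * Finite generalized J-groups are reflection groups *)

Section GeneralizedJBasics.
Variables (p : nat) (K : 'I_p -> option nat) (K' : 'I_p -> nat).
Local Notation M := (generalized_J K K').

Lemma generalized_J_gen i : M (Jgen K i ^+ K' i).
Proof. by apply: sub_normal_closure; exists i. Qed.

Lemma generalized_J_subgroup : is_subgroup M.
Proof. exact: (normal_closure_normal _).1. Qed.

Lemma generalized_J_conj x y : M x -> M (x ^ y).
Proof. exact: (normal_closure_normal _).2. Qed.

Lemma generalized_J_min (H : set (Jgroup K)) : is_normal_subgroup H ->
  (forall i, H (Jgen K i ^+ K' i)) -> (M `<=` H)%classic.
Proof.
by move=> Hn HK; apply: normal_closure_min => // _ [i _ <-].
Qed.

End GeneralizedJBasics.

Section ReflectionRealization.
Variables (R : realType) (p : nat) (K : 'I_p -> option nat) (K' : 'I_p -> nat).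
Local Notation C := (R[i])%C.
Local Notation M := (generalized_J K K').
Variables (phi : {multiplicative Jgroup K -> GL 2 C}) (z : 'I_p -> C).
Hypothesis phi_refl : forall i, refl (z i) (phi (Jgen K i)).
Hypothesis z_order : forall i, exists2 n, (0 < n)%N & (z i ^+ n = 1)%R.

(** The reflections are the images of the conjugates of the [s_i ^ k'_i]. They are permuted by
    conjugation with the image of [phi], so the subgroup that they generate pulls back to a normal
    subgroup, to which minimality of the normal closure applies. *)
Lemma generalized_J_reflection_group : finite_set M ->
  rank2_reflection_group (phi @` M)%classic.
Proof.
move=> finM; have Mg := generalized_J_subgroup K K'.
have imM : is_subgroup (phi @` M)%classic.
  split; first by exists 1; [exact: subgroup1 | exact: mult1].
  move=> _ _ [x xM <-] [y yM <-]; exists (x * y^-1); first exact: Mg.2.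
  by rewrite gmulfM multV.
split=> //; first exact: finite_image.
(* [K' i] may be a multiple of the order of [z i], and the identity is not a reflection. *)
pose S : set (GL 2 C) :=
  [set w | w <> 1 /\ exists i x, w = phi (Jgen K i ^+ K' i ^ x)]%classic.
exists S.
  move=> w [w1 [i [x wE]]]; apply/complex_reflectionP.
  have [n n0 zn] := z_order i; have rA := phi_refl i.
  have zK : (z i ^+ K' i != 1)%R.
    apply/eqP => zK; apply: w1.
    by rewrite wE multJ multX (refl_exp_eq1 rA zK) conj1g.
  exists (z i ^+ K' i)%R, n; split=> //.
    by rewrite exprAC zn expr1n.
  by rewrite wE multJ multX; exact/reflJ/refl_expr.
have gS := generated_subgroup S; have Ssub := @sub_generated _ S.
apply/seteqP; split; last first.
  apply: generated_min => // _ [_ [i [x ->]]].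
  by exists (Jgen K i ^+ K' i ^ x) => //; apply: generalized_J_conj; exact: generalized_J_gen.
move=> _ [x xM <-]; move: x xM.
apply: (@generalized_J_min _ _ _ [set x | Defs.generated S (phi x)]%classic) => [|i].
  split; first split=> [|x y]; rewrite /= ?mult1 ?gmulfM ?multV; [exact: subgroup1 | exact: gS.2 |].
  move=> x y xS; rewrite /= multJ; apply: generated_conj => // w [w1 [i [x' wE]]].
  apply: Ssub; split.
    by move=> /eqP; rewrite conjg_eq1 => /eqP.
  by exists i, (x' * y); rewrite wE conjgM [RHS]multJ.
have [E|ne] := pselect (phi (Jgen K i ^+ K' i) = 1); first by rewrite /= E; exact: subgroup1.
by apply: Ssub; split=> //; exists i, 1; rewrite conjg1.
Qed.

End ReflectionRealization.

Lemma trivial_reflection_group (R : realType) :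
  rank2_reflection_group [set (1 : GL 2 R[i]%C)]%classic.
Proof.
have g1 : is_subgroup [set (1 : GL 2 R[i]%C)]%classic.
  by split=> // x y -> ->; rewrite mulgV.
split=> //.
exists set0 => //; apply/seteqP; split; last exact: generated_min.
by move=> _ ->; apply: subgroup1; exact: generated_subgroup.
Qed.

Section Centralizer.
Variables (C : numClosedFieldType) (p : nat) (K : 'I_p -> option nat) (K' : 'I_p -> nat).
Local Notation M := (generalized_J K K').
Variables (phi : {multiplicative Jgroup K -> GL 2 C}) (z : C) (i : 'I_p) (h : Jgroup K).
Hypothesis finM : finite_set M.
Hypothesis phi_refl : refl z (phi (Jgen K i)).
Hypothesis zK : (z ^+ K' i != 1)%R.
Hypothesis h_order : forall n, phi h ^+ n \in scalars -> n = 0%N.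

(* By finiteness a power of [h] centralizes [s_i ^+ K' i]; both have          *)
(* non-scalar images, whose centralizers in GL_2 are abelian.                *)
Lemma commute_infinite_order : commute (phi (Jgen K i)) (phi h).
Proof.
pose g := Jgen K i ^+ K' i.
have [m [n [mn gmn]]] : exists m n, (m < n)%N /\ g ^ (h ^+ m) = g ^ (h ^+ n).
  apply: (finite_set_collision finM) => n.
  apply: generalized_J_conj; exact: generalized_J_gen.
have gh : commute g (h ^+ (n - m)).
  have : g ^ (h ^+ (n - m)) = g.
    apply: (conjg_inj (h ^+ m)).
    by rewrite -conjgM -expgnDr subnK 1?ltnW // gmn.
  by move/conjg_fixP/commgP.
have phig : phi g = phi (Jgen K i) ^+ K' i by rewrite multX.
have ng : phi g \notin scalars.
  by rewrite phig; apply/negP => /(refl_exp_scalar phi_refl)/eqP; exact/negP.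
have nh : phi (h ^+ (n - m)) \notin scalars.
  by apply/negP; rewrite multX => /h_order/eqP; rewrite subn_eq0 leqNgt mn.
have cgh : commute (phi g) (phi h).
  apply: (commute_nonscalar nh); first by apply: commute_sym; rewrite /commute -!gmulfM gh.
  by rewrite multX; exact/commute_sym/commuteX.
apply: (commute_nonscalar ng) => //.
by rewrite phig; exact/commute_sym/commuteX.
Qed.

End Centralizer.

(** * Representations in which certain words have infinite order modulo scalars *)

Section Nonspherical.
Variable R : realType.
Local Notation C := (R[i])%C.
Local Open Scope ring_scope.

Lemma unity_neq0 k : unity R k != 0.
Proof. exact: cis_neq0. Qed.

Lemma unity_neq1 k : (1 < k)%N -> unity R k != 1.
Proof.
move=> k1; apply/eqP => u1; have := unity_order (ltnW k1) (etrans (expr1 _) u1).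
by rewrite dvdn1 gtn_eqF.
Qed.

Lemma unity_sqr k : (0 < k)%N -> unity R k = cis (pi / k%:R) ^+ 2.
Proof. by move=> k0; rewrite /unity cisX mulrnAl. Qed.

(* For 1/a + 1/b + 1/c <= 1 take the generators of the (Euclidean or         *)
(* hyperbolic) triangle group with angles pi/a, pi/b, pi/c: the trace of the  *)
(* commutator of two rotations exceeds 2 exactly in the non-spherical case.   *)
Lemma nonspherical_triple a b c : (1 < a)%N -> (1 < b)%N -> (1 < c)%N ->
  (b * c + a * c + a * b <= a * b * c)%N ->
  exists A B D : GL 2 C, [/\ refl (unity R a) A, refl (unity R b) B, refl (unity R c) D,
    (exists2 l, l != 0 & (A * B * D)%g = scal l) &
    forall n, ((A * B * A^-1 * B^-1) ^+ n)%g \in scalars -> n = 0%N].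
Proof.
move=> a1 b1 c1 abc; have pi0 := pi_gt0 R.
pose x : R := pi / a%:R; pose y : R := pi / b%:R; pose t : R := pi / c%:R.
have pos k : (1 < k)%N -> 0 < (pi / k%:R : R) <= pi / 2.
  move=> k1; have k0 : 0 < k%:R :> R by rewrite ltr0n (ltnW k1).
  by rewrite divr_gt0 //= ler_pM2l // lef_pV2 ?posrE ?ler_nat //.
(* The sign of this square root matters: it makes the product of the three cosines enter the trace
   of the commutator with a plus sign, as in [cos_sum_ge1]. *)
pose l : C := - (cis x * cis y * cis t).
have [x0 y0 t0] : [/\ cis x != 0, cis y != 0 & cis t != 0] by rewrite !cis_neq0.
have lE : l ^+ 2 = unity R a * unity R b * unity R c.
  by rewrite !unity_sqr ?(ltnW a1, ltnW b1, ltnW c1) // /l sqrrN !exprMn.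
have l0 : l != 0 by rewrite oppr_eq0 !mulf_neq0.
have [A [B [D [rA rB rD ABD [nAB trAB]]]]] := refl_triple (unity_neq0 a) (unity_neq0 b)
  (unity_neq0 c) (unity_neq1 a1) (unity_neq1 b1) (unity_neq1 c1) lE.
exists A, B, D; split=> //; first by exists l.
move=> n; apply: hyperbolic_order.
- rewrite !GL_detM !GL_detV; have dA := GL_det_neq0 A; have dB := GL_det_neq0 B.
  by field; rewrite dA dB.
- have [trA dA _] := rA; have [trB dB _] := rB.
  rewrite (tr_commutator dA dB trA trB trAB).
  have E k : (0 < k)%N -> 1 + unity R k = (2%:R * cos (pi / k%:R))%:C%C * cis (pi / k%:R).
    by move=> k0; rewrite -cis_double unity_sqr // expr2 -cisD.
  rewrite (E a) ?(ltnW a1, ltnW b1, ltnW c1) // (E b) ?(ltnW a1, ltnW b1, ltnW c1) //.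
  have -> : 1 + (unity R c)^-1 = (2%:R * cos t)%:C%C * (cis t)^-1.
    have -> : 1 + (unity R c)^-1 = (1 + unity R c) / unity R c.
      by rewrite mulrDl divff ?unity_neq0 // mul1r addrC.
    rewrite (E c) ?(ltnW a1, ltnW b1, ltnW c1) // unity_sqr ?(ltnW a1, ltnW b1, ltnW c1) // -/t.
    by field.
  rewrite !unity_sqr ?(ltnW a1, ltnW b1, ltnW c1) // -/x -/y /l.
  set X := (_)%:C%C; set Y := (2%:R * cos y)%:C%C; set T := (2%:R * cos t)%:C%C.
  have -> : (X * cis x) ^+ 2 / cis x ^+ 2 + (Y * cis y) ^+ 2 / cis y ^+ 2 +
     (- (cis x * cis y * cis t) * (T / cis t)) ^+ 2 / (cis x ^+ 2 * cis y ^+ 2) -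
     X * cis x * (Y * cis y) * (- (cis x * cis y * cis t) * (T / cis t)) /
     (cis x ^+ 2 * cis y ^+ 2) - 2%:R = X ^+ 2 + Y ^+ 2 + T ^+ 2 + X * Y * T - 2%:R.
    by field; rewrite x0 y0 t0.
  have -> : X ^+ 2 + Y ^+ 2 + T ^+ 2 + X * Y * T - 2%:R =
     (4%:R * (cos x ^+ 2 + cos y ^+ 2 + cos t ^+ 2 + 2%:R * (cos x * cos y * cos t)) - 2%:R)%:C%C.
    rewrite -[X in _ - X = _](rmorph_nat (real_complex R)) /X /Y /T.
    rewrite -!rmorphXn -!rmorphM -!rmorphD -rmorphB; congr (_%:C)%C; ring.
  have -> : 2%:R = (2%:R)%:C%C :> C by rewrite rmorph_nat.
  rewrite lecR; have H := cos_sum_ge1 (pos a a1) (pos b b1) (pos c c1).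
  rewrite -/x -/y -/t in H.
  suff xyt : x + y + t <= pi by have := H xyt; lra.
  rewrite /x /y /t -!mulrDr -[X in _ <= X]mulr1 ler_pM2l //.
  have [ka kb kc] : [/\ (0 : R) < a%:R, (0 : R) < b%:R & (0 : R) < c%:R].
    by rewrite !ltr0n !(ltnW a1, ltnW b1, ltnW c1).
  have -> : a%:R^-1 + b%:R^-1 + c%:R^-1 =
      (b * c + a * c + a * b)%:R / (a * b * c)%:R :> R.
    by rewrite !natrD !natrM; field; rewrite !gt_eqF.
  rewrite ler_pdivrMr ?mul1r ?ler_nat //.
  by rewrite ltr0n !muln_gt0 !(ltnW a1, ltnW b1, ltnW c1).
- apply/eqP => E; apply: nAB; rewrite /commute.
  by move: E => /(canRL (mulgVK _)); rewrite mul1g => /(canRL (mulgVK _)).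
Qed.

End Nonspherical.

Section Parabolic.
Variable C : numClosedFieldType.
Local Open Scope ring_scope.

(* [A B] and [D E] are inverse to each other up to a scalar, and parabolic. *)
Lemma refl_quadruple (z1 z2 z3 z4 : C) : z1 != 0 -> z2 != 0 -> z3 != 0 -> z4 != 0 ->
  z1 != 1 -> z2 != 1 -> z3 != 1 -> z4 != 1 ->
  exists A B D E : GL 2 C, [/\ [/\ refl z1 A, refl z2 B, refl z3 D & refl z4 E],
    (exists2 l, l != 0 & (A * B * D * E)%g = scal l),
    ~ commute A B /\ ~ commute D E,
    forall n, ((A * B) ^+ n)%g \in scalars -> n = 0%N &
    forall n, ((D * E) ^+ n)%g \in scalars -> n = 0%N].
Proof.
move=> z10 z20 z30 z40 z11 z21 z31 z41.
pose mu := sqrtC (z1 * z2); pose nu := sqrtC (z3 * z4).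
have muE : mu * mu = z1 * z2 by rewrite -expr2 sqrtCK.
have nuE : nu * nu = z3 * z4 by rewrite -expr2 sqrtCK.
have mu0 : mu != 0 by rewrite sqrtC_eq0 mulf_neq0.
have nu0 : nu != 0 by rewrite sqrtC_eq0 mulf_neq0.
have [A [B [rA rB trAB nAB]]] := refl_pair (mu + mu) z10 z20 z11 z21.
have [D [E [rD rE trDE nDE]]] := refl_pair (nu + nu) z30 z40 z31 z41.
have dAB : \det (A * B)%g = mu * mu by rewrite GL_detM muE; case: rA rB => _ -> _ [_ ->].
have dDE : \det (D * E)%g = nu * nu by rewrite GL_detM nuE; case: rD rE => _ -> _ [_ ->].
have scomm (X Y : GL 2 C) : (X * Y)%g \in scalars -> commute X Y.
  move=> /scalarsP[c c0 XY]; have -> : Y = (X^-1 * scal c)%g by rewrite -XY mulKg.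
  apply: commuteM; first exact/commuteV/commute_refl.
  exact/commute_sym/scal_central.
have nsAB : (A * B)%g \notin scalars by apply/negP => /scomm.
have nsDE : (D * E)%g \notin scalars by apply/negP => /scomm.
have parab (X : GL 2 C) m n : X \notin scalars -> \tr X = m + m -> \det X = m * m ->
    (X ^+ n)%g \in scalars -> n = 0%N.
  move=> nX trX dX Xn; apply/eqP; rewrite -leqn0 leqNgt; apply/negP => n0.
  by move/negP: nX; apply; exact: parabolic_scalar trX dX n0 Xn.
have mn0 : mu * nu != 0 by rewrite mulf_neq0.
(* Both sides have the double eigenvalue [nu], so they are conjugate as soon as neither is
   scalar. *)
have [Q QE] : exists Q, ((D * E) ^ Q)%g = (scal (mu * nu) * (A * B)^-1)%g.
  apply: nonscalar_conj => //.
  - apply: contra nsAB => ABV.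
    have -> : (A * B)%g = ((scal (mu * nu) * (A * B)^-1)^-1 * scal (mu * nu))%g.
      by rewrite invgM invgK mulgVK.
    apply: (group_closedM (@scalar_closed C)); last exact: scal_in.
    by apply: (group_closedV (@scalar_closed C)).
  - rewrite trDE scal_mulE // mxtraceZ GL_trV trAB dAB; field.
    by rewrite mu0.
  - rewrite dDE GL_detM scalE // det_scalar GL_detV dAB; field.
    by rewrite mu0.
exists A, B, (D ^ Q)%g, (E ^ Q)%g; split=> //.
- by split=> //; exact: reflJ.
- by exists (mu * nu); rewrite // -mulgA -conjMg QE (scal_central _ (A * B)^-1)%g mulVKg.
- split=> // cDE; apply: nDE; apply: (@conjg_inj _ Q).
  by rewrite !conjMg.
- by move=> n; exact: parab nsAB trAB dAB.
- by move=> n; rewrite -conjMg -conjXg scalarsJ; exact: parab nsDE trDE dDE.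
Qed.

End Parabolic.

Local Notation o20 := (@Ordinal 2 0 isT).
Local Notation o21 := (@Ordinal 2 1 isT).
Local Notation o30 := (@Ordinal 3 0 isT).
Local Notation o31 := (@Ordinal 3 1 isT).
Local Notation o32 := (@Ordinal 3 2 isT).

Lemma prod_enum_support (H : groupType) p (f : 'I_p -> H) (l : seq 'I_p) :
  sorted ltn (map val l) -> (forall i, i \notin l -> f i = 1) ->
  \prod_(i <- enum 'I_p) f i = \prod_(i <- l) f i.
Proof.
move=> sl fl; have -> : l = [seq i <- enum 'I_p | i \in l].
  apply: (inj_map val_inj); apply: (irr_sorted_eq ltn_trans ltnn) => //.
    rewrite sorted_map; apply: sorted_filter; first by move=> a b c; exact: ltn_trans.
    by rewrite -sorted_map val_enum_ord iota_ltn_sorted.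
  move=> n; apply/mapP/mapP => -[i il ->]; exists i => //.
    by rewrite mem_filter il mem_enum.
  by move: il; rewrite mem_filter => /andP[].
rewrite [RHS]big_filter [RHS]big_mkcond /=; apply: eq_bigr => i _.
by case: ifPn => // /fl.
Qed.

(** * J(K) for at most three generators *)

Section SmallJGroups.

Lemma Jgroup1_cyclic (K : 'I_1 -> option nat) k : (0 < k)%N -> K ord0 = Some k ->
  forall x : Jgroup K, exists n, x = Jgen K ord0 ^+ n.
Proof.
move=> k0 Kk; have sk := Jgen_exp Kk; set s := Jgen K ord0 in sk *.
have sV : s^-1 = s ^+ k.-1 by apply: mulg1_eq; rewrite -expgS prednK.
apply: Jgroup_ind => [|i x [n ->]|i x [n ->]]; first by exists 0%N.
  by exists n.+1; rewrite ord1 expgSr.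
by exists (n + k.-1)%N; rewrite ord1 expgnDr -sV.
Qed.

Lemma enum_ord2 : enum 'I_2 = [:: o20; o21].
Proof. by apply: (inj_map val_inj); rewrite val_enum_ord. Qed.

Lemma ord2_cases (i : 'I_2) : i = o20 \/ i = o21.
Proof. by case: i => -[|[|//]] ?; [left|right]; apply: val_inj. Qed.

Lemma Jgroup2_abelian (K : 'I_2 -> option nat) k0 k1 : (0 < k0)%N -> (0 < k1)%N ->
  K o20 = Some k0 -> K o21 = Some k1 ->
  forall x : Jgroup K, exists m n, x = Jgen K o20 ^+ m * Jgen K o21 ^+ n.
Proof.
move=> k00 k10 K0 K1; have s0k := Jgen_exp K0; have s1k := Jgen_exp K1.
have : commute (Jgen K o20) (Jgen K o21).
  have := @Jgen_prod_rot _ K 1 isT.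
  by rewrite enum_ord2 /rot /= !big_cons !big_nil !mulg1.
set s := Jgen K o20 in s0k *; set t := Jgen K o21 in s1k * => st.
have sV : s^-1 = s ^+ k0.-1 by apply: mulg1_eq; rewrite -expgS prednK.
have tV : t^-1 = t ^+ k1.-1 by apply: mulg1_eq; rewrite -expgS prednK.
have Ms m n j : s ^+ m * t ^+ n * s ^+ j = s ^+ (m + j) * t ^+ n.
  by rewrite -mulgA -(commuteX2 j n st) mulgA expgnDr.
have Mt m n j : s ^+ m * t ^+ n * t ^+ j = s ^+ m * t ^+ (n + j).
  by rewrite -mulgA expgnDr.
apply: Jgroup_ind => [|i x [m [n ->]]|i x [m [n ->]]].
- by exists 0%N, 0%N; rewrite mulg1.
- case: (ord2_cases i) => ->.
    by exists (m + 1)%N, n; rewrite -Ms.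
  by exists m, (n + 1)%N; rewrite -Mt.
- case: (ord2_cases i) => ->.
    by exists (m + k0.-1)%N, n; rewrite -Ms -sV.
  by exists m, (n + k1.-1)%N; rewrite -Mt -tV.
Qed.

Lemma enum_ord3 : enum 'I_3 = [:: o30; o31; o32].
Proof. by apply: (inj_map val_inj); rewrite val_enum_ord. Qed.

Lemma ord3_cases (i : 'I_3) : [\/ i = o30, i = o31 | i = o32].
Proof.
by case: i => -[|[|[|//]]] ?; [constructor 1|constructor 2|constructor 3]; apply: val_inj.
Qed.

Lemma Jgroup3_triple (K : 'I_3 -> option nat) a b c :
  (0 < a)%N -> (0 < b)%N -> (0 < c)%N ->
  K o30 = Some a -> K o31 = Some b -> K o32 = Some c ->
  J_triple (Jgen K o30) (Jgen K o31) (Jgen K o32) a b c.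
Proof.
move=> a0 b0 c0 Ka Kb Kc; have sa := Jgen_exp Ka; have tb := Jgen_exp Kb; have uc := Jgen_exp Kc.
have := @Jgen_prod_rot _ K 1 isT; have := @Jgen_prod_rot _ K 2 isT.
rewrite enum_ord3 /rot /= !big_cons !big_nil !mulg1 !mulgA.
set s := Jgen K o30 in sa *; set t := Jgen K o31 in tb *; set u := Jgen K o32 in uc *.
move=> z2 z1.
have VX (x : Jgroup K) k : (0 < k)%N -> x ^+ k = 1 -> x^-1 = x ^+ k.-1.
  by move=> k0 xk; apply: mulg1_eq; rewrite -expgS prednK.
have cs : commute (s * t * u) s by rewrite /commute [X in _ = _ * X]z1 !mulgA.
have ct : commute (s * t * u) t.
  by rewrite /commute {1}z1 [in RHS]z2 !mulgA.
have cu : commute (s * t * u) u by rewrite /commute [in LHS]z2 !mulgA.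
split=> //.
  apply: Jgroup_ind => [|i x Px|i x Px]; first exact: commute1.
    by apply: commuteM => //; case: (ord3_cases i) => ->.
  by apply: commuteM => //; apply: commuteV; case: (ord3_cases i) => ->.
move=> P P1 PM.
have PX y : (forall x, P x -> P (x * y)) -> forall n x, P x -> P (x * y ^+ n).
  move=> Py; elim=> [|n IHn] x Px; first by rewrite mulg1.
  by rewrite expgSr mulgA; apply/Py/IHn.
have [Ps Pt Pu] : [/\ forall x, P x -> P (x * s), forall x, P x -> P (x * t) &
   forall x, P x -> P (x * u)] by split=> x /PM[].
apply: Jgroup_ind => // i x Px; first by case: (ord3_cases i) => ->; auto.
case: (ord3_cases i) => ->.
- by rewrite -/s (VX s a) //; exact: PX.
- by rewrite -/t (VX t b) //; exact: PX.
- by rewrite -/u (VX u c) //; exact: PX.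
Qed.

End SmallJGroups.

Section FaithfulReflections.
Variable C : fieldType.

Lemma refl_order (z : C) A k : refl z A -> (forall n, (z ^+ n = 1)%R -> (k %| n)%N) ->
  forall n, A ^+ n \in scalars -> (k %| n)%N.
Proof. by move=> rA zk n /(refl_exp_scalar rA)/zk. Qed.

(** The second conclusion serves the converse: [N] elements distinct modulo scalars show that the
    image of J(K) meets every class of W modulo scalars. *)
Lemma J3_faithful (K : 'I_3 -> option nat) a b c N
    (phi : {multiplicative Jgroup K -> GL 2 C}) (za zb zc l : C) :
  (0 < a)%N -> (0 < b)%N -> (0 < c)%N -> (0 < N)%N ->
  K o30 = Some a -> K o31 = Some b -> K o32 = Some c -> coset_bound a b c N ->
  refl za (phi (Jgen K o30)) -> refl zb (phi (Jgen K o31)) -> refl zc (phi (Jgen K o32)) ->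
  (forall n, (za ^+ n = 1)%R -> (a %| n)%N) -> (forall n, (zb ^+ n = 1)%R -> (b %| n)%N) ->
  (forall n, (zc ^+ n = 1)%R -> (c %| n)%N) ->
  l != 0%R -> (forall n, (l ^+ n = 1)%R -> (N %| n)%N) ->
  phi (Jgen K o30 * Jgen K o31 * Jgen K o32) = scal l ->
  injective phi /\
  exists2 s, size s = N & pairwise (fun x y => (phi x)^-1 * phi y \notin scalars) s.
Proof.
move=> a0 b0 c0 N0 Ka Kb Kc bound rA rB rD zaP zbP zcP l0 lP zE.
have sC := @scalar_central C; have tri := Jgroup3_triple a0 b0 c0 Ka Kb Kc.
have zS : phi (Jgen K o30 * Jgen K o31 * Jgen K o32) \in scalars by rewrite zE scal_in.
have zN n : phi (Jgen K o30 * Jgen K o31 * Jgen K o32) ^+ n = 1 -> (N %| n)%N.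
  rewrite zE scalX // -scal1 => /scal_inj E; apply/lP/E => //; first exact: expf_neq0.
  exact: GRing.oner_neq0.
have rAP := refl_order rA zaP; have rBP := refl_order rB zbP; have rDP := refl_order rD zcP.
split; first exact: faithful_triple sC tri bound a0 b0 c0 rAP rBP rDP zS zN N0.
by have [s [sN ps _]] := faithful_triple_cosets sC tri bound a0 b0 c0 rAP rBP rDP zS zN N0; exists s.
Qed.

Lemma GL_triple_lift (K : 'I_3 -> option nat) (A B D : GL 2 C) (za zb zc l : C) a b c :
  K o30 = Some a -> K o31 = Some b -> K o32 = Some c ->
  refl za A -> refl zb B -> refl zc D ->
  (za ^+ a = 1)%R -> (zb ^+ b = 1)%R -> (zc ^+ c = 1)%R ->
  A * B * D = scal l ->
  exists phi : {multiplicative Jgroup K -> GL 2 C},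
    [/\ phi (Jgen K o30) = A, phi (Jgen K o31) = B & phi (Jgen K o32) = D].
Proof.
move=> Ka Kb Kc rA rB rD zaa zbb zcc ABD.
pose f (i : 'I_3) := if i == o30 then A else if i == o31 then B else D.
have [||phi phiE] := @Jgroup_lift _ K _ f.
- by move=> i; rewrite enum_ord3 !big_cons big_nil mulg1 /= mulgA ABD; exact: scal_central.
- move=> i k; case: (ord3_cases i) => -> /=; rewrite ?Ka ?Kb ?Kc => -[<-].
  + exact: refl_exp_eq1 rA zaa.
  + exact: refl_exp_eq1 rB zbb.
  + exact: refl_exp_eq1 rD zcc.
by exists phi; rewrite !phiE.
Qed.

End FaithfulReflections.

Section DiagonalMatrices.
Variable C : fieldType.

Definition dg (a b : C) : GL 2 C := GL_of (mk2 a 0 0 b)%R.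

Lemma dgE (a b : C) : (a != 0 -> b != 0 -> GLmx (dg a b) = mk2 a 0 0 b)%R.
Proof. by move=> a0 b0; rewrite mk2_GL_det // mulr0 subr0 mulf_neq0. Qed.

Lemma dgM (a b c d : C) : (a != 0 -> b != 0 -> c != 0 -> d != 0 ->
  (dg a b * dg c d)%g = dg (a * c) (b * d))%R.
Proof.
move=> a0 b0 c0 d0; apply: GL2P; rewrite !GL_mulE !dgE ?mulf_neq0 // !mk2E;
  by rewrite ?(mulr0, mul0r, addr0, add0r).
Qed.

Lemma dg1 : dg 1%R 1%R = 1.
Proof. by apply: GL2P; rewrite dgE ?oner_eq0 // !mk2E GL_oneE. Qed.

Lemma dgX (a b : C) n : (a != 0 -> b != 0 -> (dg a b ^+ n)%g = dg (a ^+ n) (b ^+ n))%R.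
Proof.
move=> a0 b0; elim: n => [|n IHn]; first by rewrite dg1.
by rewrite expgS IHn dgM ?expf_neq0 // !exprS.
Qed.

Lemma dg_inj (a b c d : C) : (a != 0 -> b != 0 -> c != 0 -> d != 0 ->
  dg a b = dg c d -> a = c /\ b = d)%R.
Proof.
move=> a0 b0 c0 d0 E.
have E0 := congr1 (fun A : GL 2 C => A ord0 ord0) E.
have E1 := congr1 (fun A : GL 2 C => A ord_max ord_max) E.
by move: E0 E1; rewrite !dgE // !mk2E.
Qed.

Lemma dg_refl1 (a : C) : (a != 0 -> a != 1 -> refl a (dg a 1))%R.
Proof.
move=> a0 a1; split=> //; rewrite dgE ?oner_eq0 // ?tr_mx2 ?det_mk2 ?mk2E.
  by rewrite addrC.
by rewrite mulr1 mulr0 subr0.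
Qed.

Lemma dg_refl2 (a : C) : (a != 0 -> a != 1 -> refl a (dg 1 a))%R.
Proof.
move=> a0 a1; split=> //; rewrite dgE ?oner_eq0 // ?tr_mx2 ?det_mk2 ?mk2E //.
by rewrite mul1r mulr0 subr0.
Qed.

Lemma diagonal_rep2 (K : 'I_2 -> option nat) a b (u v : C) : (0 < a)%N -> (0 < b)%N ->
  K o20 = Some a -> K o21 = Some b -> (u != 0)%R -> (v != 0)%R ->
  (u ^+ a = 1)%R -> (v ^+ b = 1)%R ->
  (forall n, (u ^+ n = 1)%R -> (a %| n)%N) -> (forall n, (v ^+ n = 1)%R -> (b %| n)%N) ->
  exists phi : {multiplicative Jgroup K -> GL 2 C},
    [/\ injective phi, phi (Jgen K o20) = dg u 1%R & phi (Jgen K o21) = dg 1%R v].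
Proof.
move=> a0 b0 Ka Kb u0 v0 ua vb uP vP; have u1 : (1 != 0 :> C)%R := oner_neq0 _.
pose f (i : 'I_2) := if i == o20 then dg u 1%R else dg 1%R v.
have [||phi phiE] := @Jgroup_lift _ K _ f.
- move=> i; rewrite enum_ord2 !big_cons big_nil mulg1 /= /f /= dgM // mulr1 mul1r.
  by case: (i == _); rewrite /commute !dgM // !mulr1 !mul1r mulrC.
- move=> i k; case: (ord2_cases i) => -> /=; rewrite ?Ka ?Kb => -[<-].
    by rewrite /f /= dgX // ua expr1n dg1.
  by rewrite /f /= dgX // vb expr1n dg1.
exists phi; rewrite !phiE; split=> //; apply: mult_inj => x.
have [m [n ->]] := Jgroup2_abelian a0 b0 Ka Kb x.
rewrite gmulfM !multX !phiE /f /= !dgX // dgM ?expf_neq0 // !expr1n mulr1 mul1r -dg1.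
move=> /dg_inj[||||/uP /dvdnP[q ->] /vP /dvdnP[q' ->]]; rewrite ?expf_neq0 //.
by rewrite mulnC expgnA (Jgen_exp Ka) expg1n mulnC expgnA (Jgen_exp Kb) expg1n mulg1.
Qed.

Lemma diagonal_rep1 (K : 'I_1 -> option nat) a (u : C) : (0 < a)%N -> K ord0 = Some a ->
  (u != 0)%R -> (u ^+ a = 1)%R -> (forall n, (u ^+ n = 1)%R -> (a %| n)%N) ->
  exists phi : {multiplicative Jgroup K -> GL 2 C},
    injective phi /\ phi (Jgen K ord0) = dg u 1%R.
Proof.
move=> a0 Ka u0 ua uP; have u1 : (1 != 0 :> C)%R := oner_neq0 _.
have [||phi phiE] := @Jgroup_lift _ K _ (fun=> dg u 1%R).
- move=> i; have -> : enum 'I_1 = [:: ord0] by apply: (inj_map val_inj); rewrite val_enum_ord.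
  by rewrite big_cons big_nil mulg1.
- by move=> i k; rewrite ord1 Ka => -[<-]; rewrite dgX // ua expr1n dg1.
exists phi; rewrite phiE; split=> //; apply: mult_inj => x.
have [n ->] := Jgroup1_cyclic a0 Ka x.
rewrite multX phiE dgX // -dg1 => /dg_inj[||||/uP/dvdnP[q ->] _]; rewrite ?expf_neq0 //.
by rewrite mulnC expgnA (Jgen_exp Ka) expg1n.
Qed.

End DiagonalMatrices.

Section FiniteJ.
Variable R : realType.
Local Notation C := (R[i])%C.

Definition reflection_rep p (K : 'I_p -> option nat) :=
  exists (phi : {multiplicative Jgroup K -> GL 2 C}) (z : 'I_p -> C),
    [/\ injective phi, forall i, refl (z i) (phi (Jgen K i)) &
        forall i, exists2 n, (0 < n)%N & (z i ^+ n = 1)%R].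

Lemma unityX_order N k m n : (0 < N)%N -> N = (k * m)%N ->
  ((unity R N ^+ m) ^+ n = 1)%R -> (k %| n)%N.
Proof.
move=> N0 NE; rewrite -exprM => /(unity_order N0); rewrite NE mulnC dvdn_pmul2l //.
by move: N0; rewrite NE muln_gt0 => /andP[].
Qed.

Lemma unityX_exp N k m : (0 < N)%N -> N = (k * m)%N -> ((unity R N ^+ m) ^+ k = 1)%R.
Proof. by move=> N0 NE; rewrite -exprM mulnC -NE unity_exp. Qed.

Lemma spherical_rep (K : 'I_3 -> option nat) a b c :
  (1 < a)%N -> (1 < b)%N -> (1 < c)%N -> (a * b * c < b * c + a * c + a * b)%N ->
  K o30 = Some a -> K o31 = Some b -> K o32 = Some c -> reflection_rep K.
Proof.
move=> a1 b1 c1 abc Ka Kb Kc.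
have [N [na [nb [nc [N0 [Na Nb Nc] nE bound]]]]] := coset_bound_spherical a1 b1 c1 abc.
pose l := unity R N.
have z0 n : (l ^+ n != 0)%R by rewrite expf_neq0 // unity_neq0.
have z1 k n : (1 < k)%N -> N = (k * n)%N -> (l ^+ n != 1)%R.
  move=> k1 NE; apply/eqP => ln; have := unityX_order N0 NE (etrans (expr1 _) ln).
  by rewrite dvdn1 gtn_eqF.
(* The Euler relation supplies the square root that [refl_triple] needs: the exponents add up to
   [N + 2], and [l ^+ N = 1]. *)
have lE : (l ^+ 2 = l ^+ na * l ^+ nb * l ^+ nc)%R.
  by rewrite -!exprD nE exprD unity_exp // mul1r.
have [A [B [D [rA rB rD ABD _]]]] :=
  refl_triple (z0 na) (z0 nb) (z0 nc) (z1 a na a1 Na) (z1 b nb b1 Nb) (z1 c nc c1 Nc) lE.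
have [phi [pA pB pD]] := GL_triple_lift Ka Kb Kc rA rB rD (unityX_exp N0 Na)
  (unityX_exp N0 Nb) (unityX_exp N0 Nc) ABD.
exists phi, (fun i => if i == o30 then l ^+ na else if i == o31 then l ^+ nb else l ^+ nc)%R.
split.
- have [] // := @J3_faithful _ K a b c N phi (l ^+ na)%R (l ^+ nb)%R (l ^+ nc)%R l;
    rewrite ?pA ?pB ?pD ?(ltnW a1, ltnW b1, ltnW c1) //.
  + by move=> n; exact: unityX_order.
  + by move=> n; exact: unityX_order.
  + by move=> n; exact: unityX_order.
  + exact: unity_neq0.
  + by move=> n; exact: unity_order.
  + by rewrite !gmulfM pA pB pD.
- by move=> i; case: (ord3_cases i) => -> /=; rewrite ?pA ?pB ?pD.
- move=> i; case: (ord3_cases i) => -> /=; [exists a | exists b | exists c];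
    by rewrite ?(ltnW a1, ltnW b1, ltnW c1) ?unityX_exp.
Qed.

Lemma abelian_rep (K : 'I_2 -> option nat) a b :
  (1 < a)%N -> (1 < b)%N -> K o20 = Some a -> K o21 = Some b ->
  exists phi : {multiplicative Jgroup K -> GL 2 C},
    [/\ injective phi, phi (Jgen K o20) = dg (unity R a) 1%R &
        phi (Jgen K o21) = dg 1%R (unity R b)].
Proof.
move=> a1 b1 Ka Kb; have a0 := ltnW a1; have b0 := ltnW b1.
exact: diagonal_rep2 (unity_neq0 R a) (unity_neq0 R b) (unity_exp R a0) (unity_exp R b0)
  (@unity_order R a ^~ a0) (@unity_order R b ^~ b0).
Qed.

Lemma reflection_rep2 (K : 'I_2 -> option nat) a b :
  (1 < a)%N -> (1 < b)%N -> K o20 = Some a -> K o21 = Some b -> reflection_rep K.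
Proof.
move=> a1 b1 Ka Kb; have [phi [phi_inj pa pb]] := abelian_rep a1 b1 Ka Kb.
exists phi, (fun i => if i == o20 then unity R a else unity R b); split=> // i.
  case: (ord2_cases i) => -> /=; rewrite ?pa ?pb.
    by apply: dg_refl1; [exact: unity_neq0 | exact: unity_neq1].
  by apply: dg_refl2; [exact: unity_neq0 | exact: unity_neq1].
by case: (ord2_cases i) => -> /=; [exists a | exists b];
  rewrite ?unity_exp //; exact: ltnW.
Qed.

Lemma reflection_rep1 (K : 'I_1 -> option nat) a :
  (1 < a)%N -> K ord0 = Some a -> reflection_rep K.
Proof.
move=> a1 Ka; have a0 := ltnW a1.
have [phi [phi_inj phiE]] := diagonal_rep1 a0 Ka (unity_neq0 R a) (unity_exp R a0) (@unity_order R a ^~ a0).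
exists phi, (fun=> unity R a); split=> // i.
- by rewrite ord1 phiE; apply: dg_refl1; [exact: unity_neq0 | exact: unity_neq1].
- by exists a; rewrite ?unity_exp.
Qed.

End FiniteJ.

Section FiniteGeneralizedJ.
Variable R : realType.
Local Notation C := (R[i])%C.

Lemma finite_J_entries p (K : 'I_p -> option nat) (K' : 'I_p -> nat) :
  (forall i, (0 < K' i)%N) -> finite_set (generalized_J K K') -> forall i, K i <> None.
Proof.
move=> K'0 finM i Ki; have c2 : (2%:R != 0 :> C)%R by rewrite pnatr_eq0.
(* The character with value 2 on [s_i] and 1 on the other generators; 2 is not a root of unity. *)
pose f j : GL 2 C := if j == i then scal 2%:R%R else 1.
have fscal j : f j \in scalars.
  by rewrite /f; case: eqP => _; [exact: scal_in | rewrite -scal1 scal_in // oner_neq0].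
have [||phi phiE] := @Jgroup_lift _ K _ f.
- move=> x; apply: commute_sym; apply: commute_prod => j _; apply: commute_sym.
  exact: (@scalar_central C).2 (fscal j) _.
- move=> j k Kj; rewrite /f; case: eqP => [ji|_]; last exact: expg1n.
  by move: Kj; rewrite ji Ki.
have [m [n [mn mnE]]] := @finite_set_collision _ _ (fun n => (Jgen K i ^+ K' i) ^+ n) finM
  (fun n => subgroupX n (generalized_J_subgroup K K') (@generalized_J_gen _ K K' i)).
move: mnE => /(congr1 phi); rewrite !multX phiE /f eqxx -!expgnA !scalX //.
move=> /scal_inj; rewrite !expf_neq0 // -!natrX => /(_ isT isT)/eqP.
rewrite eqr_nat eqn_exp2l // eqn_pmul2l //.
by move=> /eqP E; move: mn; rewrite E ltnn.
Qed.

(** For [h] the commutator of the first two generators, [phi h] is a product of [X^-1] and a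
    conjugate of [X], where [X] can be any of the three generators up to inversion. If [X] commutes
    with [phi h], these factors commute and [phi h] has finite order, a contradiction. *)
Lemma finite_J3_spherical (K : 'I_3 -> option nat) (K' : 'I_3 -> nat) a b c i :
  finite_set (generalized_J K K') -> (1 < a)%N -> (1 < b)%N -> (1 < c)%N ->
  K o30 = Some a -> K o31 = Some b -> K o32 = Some c ->
  (0 < K' i)%N -> (forall k, K i = Some k -> (K' i < k)%N) ->
  (a * b * c < b * c + a * c + a * b)%N.
Proof.
move=> finM a1 b1 c1 Ka Kb Kc K'0 K'lt; rewrite ltnNge; apply/negP => abc.
have [A [B [D [rA rB rD [l l0 ABD] hyp]]]] := nonspherical_triple R a1 b1 c1 abc.
have ux k : (1 < k)%N -> (unity R k ^+ k = 1)%R by move=> k1; rewrite unity_exp // ltnW.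
have [phi [pA pB pD]] := GL_triple_lift Ka Kb Kc rA rB rD (ux _ a1) (ux _ b1) (ux _ c1) ABD.
pose h := Jgen K o30 * Jgen K o31 * (Jgen K o30)^-1 * (Jgen K o31)^-1.
have phih : phi h = A * B * A^-1 * B^-1 by rewrite !gmulfM !multV pA pB.
have h_order n : phi h ^+ n \in scalars -> n = 0%N by rewrite phih; exact: hyp.
have zK k : (1 < k)%N -> K i = Some k -> (unity R k ^+ K' i != 1)%R.
  move=> k1 Ki; apply/eqP => /(unity_order (ltnW k1))/(dvdn_leq K'0).
  by rewrite leqNgt K'lt.
have no k (X Y : GL 2 C) : (1 < k)%N -> X ^+ k = 1 -> phi h = X^-1 * X ^ Y ->
    ~ commute X (phi h).
  move=> k1 Xk hE cX; have cXY : commute X^-1 (X ^ Y).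
    have -> : X ^ Y = X * phi h by rewrite hE mulVKg.
    apply: commuteM; first exact/commute_sym/commuteV.
    by apply/commute_sym/commuteV/commute_sym.
  have hk : phi h ^+ k = 1.
    by rewrite hE expgMn // expVgn -conjXg Xk conj1g invg1 mulg1.
  have /h_order k0 : phi h ^+ k \in scalars.
    by rewrite hk -(scal1 C) scal_in // oner_neq0.
  by move: k1; rewrite k0.
have Vp k X : (1 < k)%N -> refl (unity R k) X -> X^-1 ^+ k = 1.
  by move=> k1 rX; rewrite expVgn (refl_exp_eq1 rX (ux _ k1)) invg1.
have comm z : refl z (phi (Jgen K i)) -> (z ^+ K' i != 1)%R -> commute (phi (Jgen K i)) (phi h).
  by move=> rz zKi; exact: commute_infinite_order finM rz zKi h_order.
have commV X : commute X (phi h) -> commute X^-1 (phi h).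
  by move=> cX; exact/commute_sym/commuteV/commute_sym.
case: (ord3_cases i) => iE; rewrite iE in comm zK.
- apply: (no a A^-1 B^-1); [by [] | exact: Vp | |].
    by rewrite phih /conjg; gsimp.
  by apply: commV; rewrite -pA; apply: (comm (unity R a)); rewrite ?pA // zK.
- have cB : commute B (phi h).
    by rewrite -pB; apply: (comm (unity R b)); rewrite ?pB // zK.
  have cBA : commute B (B ^ A^-1).
    have -> : B ^ A^-1 = phi h * B by rewrite phih /conjg; gsimp.
    by apply: commuteM => //; exact: commute_refl.
  (* For [B] the two factors come in the opposite order, hence the preliminary [cBA]. *)
  apply: (no b B A^-1) => //; first exact: refl_exp_eq1 rB (ux _ b1).
  have -> : phi h = B ^ A^-1 * B^-1 by rewrite phih /conjg; gsimp.
  exact/commuteV/commute_sym.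
- apply: (no c D A); [by [] | exact: refl_exp_eq1 rD (ux _ c1) | |].
    have DE : D = (A * B)^-1 * scal l by rewrite -ABD mulKg.
    rewrite phih DE conjMg scalJ /conjg; gsimp; apply: (mulgI (scal l)); gsimp.
    by rewrite -[RHS]scal_central; gsimp.
  by rewrite -pD; apply: (comm (unity R c)); rewrite ?pD // zK.
Qed.

(** Four generators, [s_i] among them, go to the matrices of [refl_quadruple] and the others to 1.
    The product of either pair has no scalar positive power, so [s_i] commutes with the product of
    its pair, hence with its partner, against the choice of the pair. *)
Lemma finite_J_le3 p (K : 'I_p -> option nat) (K' k : 'I_p -> nat) i :
  finite_set (generalized_J K K') -> (forall j, K j = Some (k j)) ->
  (forall j, (1 < k j)%N) -> (0 < K' i)%N -> (K' i < k i)%N -> (p <= 3)%N.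
Proof.
move=> finM Kk k1 K'0 K'lt; rewrite leqNgt; apply/negP => p3.
have lt n : (n < 4)%N -> (n < p)%N by move=> n4; exact: leq_ltn_trans p3.
pose o0 := Ordinal (lt 0%N isT); pose o1 := Ordinal (lt 1%N isT); pose o2 := Ordinal (lt 2%N isT).
(* [j] is [i] itself if [i] lies beyond the first three indices, and 3 otherwise; in either case the
   four indices increase. *)
have [j [j3 ij]] : exists j : 'I_p, (2 < j)%N /\ i \in [:: o0; o1; o2; j].
  have [i3|i3] := ltnP 2 i; first by exists i; rewrite !inE eqxx !orbT.
  exists (Ordinal (lt 3%N isT)); split=> //; rewrite !inE -!val_eqE /=.
  by move: i3; case: (val i) => [|[|[|]]].
have ux n : (1 < n)%N -> (unity R n ^+ n = 1)%R by move=> n1; rewrite unity_exp // ltnW.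
have [A [B [D [E [[rA rB rD rE] [l l0 ABDE] [nAB nDE] hAB hDE]]]]] := refl_quadruple
  (unity_neq0 R (k o0)) (unity_neq0 R (k o1)) (unity_neq0 R (k o2)) (unity_neq0 R (k j))
  (unity_neq1 R (k1 o0)) (unity_neq1 R (k1 o1)) (unity_neq1 R (k1 o2)) (unity_neq1 R (k1 j)).
pose f (x : 'I_p) := if x == o0 then A else if x == o1 then B else
  if x == o2 then D else if x == j then E else 1.
have j0 : (j == o0) = false by rewrite -val_eqE gtn_eqF //= (leq_ltn_trans _ j3).
have j1 : (j == o1) = false by rewrite -val_eqE gtn_eqF //= (leq_ltn_trans _ j3).
have j2 : (j == o2) = false by rewrite -val_eqE gtn_eqF.
have f0 : f o0 = A by [].
have f1 : f o1 = B by [].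
have f2 : f o2 = D by [].
have fj : f j = E by rewrite /f j0 j1 j2 eqxx.
have [||phi phiE] := @Jgroup_lift _ K _ f.
- move=> x; rewrite (@prod_enum_support _ _ f [:: o0; o1; o2; j]).
  + by rewrite !big_cons big_nil f0 f1 f2 fj mulg1 !mulgA ABDE; exact: scal_central.
  + by rewrite /= j3.
  + by move=> y; rewrite !inE !negb_or /f => /and4P[/negPf-> /negPf-> /negPf-> /negPf->].
- move=> x n; rewrite Kk => -[<-]; rewrite /f.
  case: eqP => [->|_]; first exact: refl_exp_eq1 rA (ux _ (k1 _)).
  case: eqP => [->|_]; first exact: refl_exp_eq1 rB (ux _ (k1 _)).
  case: eqP => [->|_]; first exact: refl_exp_eq1 rD (ux _ (k1 _)).
  by case: eqP => [->|_]; [exact: refl_exp_eq1 rE (ux _ (k1 _)) | exact: expg1n].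
have zK : (unity R (k i) ^+ K' i != 1)%R.
  apply/eqP => /(unity_order (ltnW (k1 i)))/(dvdn_leq K'0).
  by rewrite leqNgt K'lt.
have comm h : refl (unity R (k i)) (phi (Jgen K i)) ->
    (forall n, phi h ^+ n \in scalars -> n = 0%N) -> commute (phi (Jgen K i)) (phi h).
  by move=> rz h_order; exact: commute_infinite_order finM rz zK h_order.
have hAB' : phi (Jgen K o0 * Jgen K o1) = A * B by rewrite gmulfM !phiE.
have hDE' : phi (Jgen K o2 * Jgen K j) = D * E by rewrite gmulfM !phiE f2 fj.
have left (X Y : GL 2 C) : commute X (X * Y) -> commute X Y.
  by rewrite /commute -mulgA => /mulgI.
have right (X Y : GL 2 C) : commute Y (X * Y) -> commute X Y.
  by rewrite /commute mulgA => /mulIg.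
have comm1 := comm (Jgen K o0 * Jgen K o1); have comm2 := comm (Jgen K o2 * Jgen K j).
rewrite hAB' in comm1; rewrite hDE' in comm2; move: comm1 comm2; rewrite phiE.
move: ij; rewrite !inE => /or4P[] /eqP -> c1 c2.
- by apply: nAB; apply: left; exact: c1.
- by apply: nAB; apply: right; exact: c1.
- by apply: nDE; apply: left; exact: c2.
- by rewrite fj in c2; apply: nDE; apply: right; exact: c2.
Qed.

Theorem finite_J_is_reflection_group (G : groupType) :
  isomorphic_to_finite_generalized_J G ->
  exists2 W : set (GL 2 C), rank2_reflection_group W & isomorphic_to G W.
Proof.
move=> [p [K [K' [[p0 KK'] finM isoG]]]].
have /choice[k Kk] : forall i, exists k, K i = Some k.
  move=> i; have := finite_J_entries (fun i => (KK' i).1) finM (i := i).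
  by case: (K i) => // k _; exists k.
have k1 i : (1 < k i)%N by exact: ((KK' i).2 _ (Kk i)).1.
have K'k i : (K' i %| k i)%N by exact: ((KK' i).2 _ (Kk i)).2.
(* If every [k'_i] equals [k_i] the normal closure is trivial and its finiteness says nothing about
   J(K), which may be infinite. *)
have [[i K'lt]|K'E] := pselect (exists i, (K' i < k i)%N); last first.
  have M1 : (generalized_J K K' `<=` [set 1])%classic.
    apply: generalized_J_min => [|i].
      by split; [split=> // x y -> ->; rewrite mulgV | move=> x y ->; rewrite /= conj1g].
    have -> : K' i = k i; last exact: Jgen_exp.
    apply/eqP; rewrite eqn_leq dvdn_leq ?(ltnW (k1 i)) //= leqNgt.
    by apply/negP => lt; apply: K'E; exists i.
  exists [set 1]%classic; first exact: trivial_reflection_group.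
  have [f [fM finj fsurj]] := isoG.
  pose g (x : G) : GL 2 C := 1.
  have gM : {morph g : x y / x * y} by move=> x y; rewrite mulg1.
  pose HBg := isMultiplicative.Build _ _ g gM.
  pose g' : {multiplicative G -> GL 2 C} := HB.pack g HBg.
  exists g'; split=> [x _ //|x y _ _ _|_ ->]; last by exists 1.
  by apply: finj; rewrite ?in_setT // (M1 _ (fM x I)) (M1 _ (fM y I)).
have p3 := finite_J_le3 finM Kk k1 (KK' i).1 K'lt.
suff [phi [z [phi_inj phi_refl z_order]]] : reflection_rep R K.
  exists (phi @` generalized_J K K')%classic.
    exact: generalized_J_reflection_group phi_refl z_order finM.
  exact: (@isomorphic_to_image G _ _ (generalized_J K K') phi phi_inj).1 isoG.
move: p p0 p3 K K' KK' finM isoG k Kk k1 K'k i K'lt.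
move=> [//|[|[|[|//]]]] _ _ K K' KK' finM isoG k Kk k1 K'k i K'lt.
- exact: reflection_rep1 (k1 ord0) (Kk ord0).
- exact: reflection_rep2 (k1 o20) (k1 o21) (Kk o20) (Kk o21).
- apply: spherical_rep (k1 o30) (k1 o31) (k1 o32) _ (Kk o30) (Kk o31) (Kk o32).
  apply: (finite_J3_spherical finM (k1 o30) (k1 o31) (k1 o32) (Kk o30) (Kk o31) (Kk o32)
    (KK' i).1) => n.
  by rewrite Kk => -[<-].
Qed.

End FiniteGeneralizedJ.

(** * Tori in finite subgroups of GL_2 *)

Section Projections.
Variable C : fieldType.
Local Open Scope ring_scope.
Implicit Types (P M : 'M[C]_2) (a b c : C) (A X Q : GL 2 C).
Local Notation o0 := (ord0 : 'I_2).
Local Notation o1 := (ord_max : 'I_2).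

(* the idempotents of rank one, by Cayley-Hamilton *)
Definition is_proj P := \tr P = 1 /\ \det P = 0.

Lemma proj_idem P : is_proj P -> P *m P = P.
Proof. by move=> [trP detP]; rewrite mx2_Cayley trP detP scale1r raddf0 subr0. Qed.

Lemma proj_compl P : is_proj P -> is_proj (1%:M - P).
Proof.
move=> [trP detP]; split; first by rewrite raddfB /= mxtrace1 trP; ring.
move: trP detP; rewrite tr_mx2 !det_mx2 !mxE /= => trP detP.
have E : (1 - P o0 o0) * (1 - P o1 o1) - (0 - P o0 o1) * (0 - P o1 o0) =
  1 - (P o0 o0 + P o1 o1) + (P o0 o0 * P o1 o1 - P o0 o1 * P o1 o0) by ring.
by rewrite E trP detP subrr addr0.
Qed.

(* the reflection with eigenvalue [a] on the image of [P] *)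
Definition rf a P : GL 2 C := GL_of (1%:M + (a - 1) *: P).

Lemma det_rf a P : is_proj P -> \det (1%:M + (a - 1) *: P) = a.
Proof.
move=> [trP detP]; move: trP detP; rewrite tr_mx2 !det_mx2 !mxE /= => trP detP.
have E : (1 + (a - 1) * P o0 o0) * (1 + (a - 1) * P o1 o1) -
    (0 + (a - 1) * P o0 o1) * (0 + (a - 1) * P o1 o0) =
  1 + (a - 1) * (P o0 o0 + P o1 o1) +
    (a - 1) ^+ 2 * (P o0 o0 * P o1 o1 - P o0 o1 * P o1 o0) by ring.
by rewrite E trP detP; ring.
Qed.

Lemma rfE a P : is_proj P -> a != 0 -> GLmx (rf a P) = 1%:M + (a - 1) *: P.
Proof. by move=> pP a0; rewrite GL_ofK // det_rf. Qed.

Lemma rf1 P : is_proj P -> rf 1 P = 1%g.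
Proof.
by move=> pP; apply: val_inj; rewrite [LHS]rfE ?oner_eq0 // subrr scale0r addr0.
Qed.

Lemma rfM a b P : is_proj P -> a != 0 -> b != 0 -> (rf a P * rf b P)%g = rf (a * b) P.
Proof.
move=> pP a0 b0; apply: val_inj; rewrite [RHS]rfE ?mulf_neq0 //.
rewrite -[LHS]/(rf a P *m rf b P) !rfE // mulmxDl mul1mx -scalemxAl mulmxDr mulmx1.
rewrite -scalemxAr (proj_idem pP) !scalerDr !scalerA addrA -addrA -scalerDl -addrA -scalerDl.
by congr (_ + _ *: _); ring.
Qed.

Lemma rfX a P n : is_proj P -> a != 0 -> (rf a P ^+ n)%g = rf (a ^+ n) P.
Proof.
move=> pP a0; elim: n => [|n IHn]; first by rewrite rf1.
by rewrite expgS IHn rfM ?expf_neq0 // exprS.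
Qed.

Lemma refl_rf a P : is_proj P -> a != 0 -> a != 1 -> refl a (rf a P).
Proof.
move=> pP a0 a1; split; rewrite ?rfE ?det_rf //.
by rewrite mxtraceD mxtraceZ mxtrace1 pP.1; ring.
Qed.

Lemma reflE a A : refl a A -> exists2 P, is_proj P & A = rf a P.
Proof.
move=> rA; have [trA detA a1] := rA; have a0 := refl_neq0 rA.
have a10 : a - 1 != 0 by rewrite subr_eq0.
pose P := (a - 1)^-1 *: (GLmx A - 1%:M); have pP : is_proj P.
  split; first by rewrite mxtraceZ raddfB /= mxtrace1 trA; field.
  rewrite detZ; apply/eqP; rewrite mulf_eq0; apply/orP; right; apply/eqP.
  move: trA detA; rewrite tr_mx2 !det_mx2 !mxE /= => trA detA.
  have E : A o0 o0 * A o1 o1 - A o0 o1 * A o1 o0 - (A o0 o0 + A o1 o1) = a - (1 + a).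
    by rewrite detA trA.
  by apply: (lin_comb E); ring.
exists P => //; apply: val_inj; rewrite [RHS]rfE // scalerA divff // scale1r.
by rewrite addrC subrK.
Qed.

Definition conj_proj P Q : 'M[C]_2 := Q^-1%g *m P *m Q.

Lemma proj_conj P Q : is_proj P -> is_proj (conj_proj P Q).
Proof.
have Q1 : Q *m Q^-1%g = 1%:M by rewrite -[LHS]/(GLmx (Q * Q^-1)%g) mulgV.
move=> [trP detP]; split; last by rewrite !det_mulmx detP mulr0 mul0r.
by rewrite mxtrace_mulC mulmxA Q1 mul1mx.
Qed.

Lemma rfJ a P Q : is_proj P -> a != 0 -> (rf a P ^ Q)%g = rf a (conj_proj P Q).
Proof.
move=> pP a0; apply: val_inj; rewrite [RHS]rfE //; last exact: proj_conj.
rewrite -[LHS]/(Q^-1%g *m (rf a P *m Q)) rfE // mulmxA mulmxDr mulmx1 mulmxDl.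
rewrite -scalemxAr -scalemxAl; congr (_ + _).
by rewrite -[LHS]/(GLmx (Q^-1 * Q)%g) mulVg.
Qed.

(** The centraliser of [P] is spanned by 1 and [P], so [X = al + be P]. The determinant
    [al * (al + be)] shows that both eigenvalues are non-zero, and the scalar [al] can be factored
    out. *)
Lemma proj_commute P X : is_proj P -> X *m P = P *m X ->
  exists c a, [/\ c != 0, a != 0 & X = (scal c * rf a P)%g].
Proof.
move=> pP XP; have [trP detP] := pP.
have [al [be XE]] : exists al be, GLmx X = al%:M + be *: P.
  move: trP detP; rewrite tr_mx2 det_mx2.
  have Eij i j := congr1 (fun M => M i j) XP.
  move: (Eij o0 o0) (Eij o0 o1) (Eij o1 o0); rewrite !mul_mx2E => E00 E01 E10 trP detP.
  (* One of [P o0 o1], [P o1 o0], [P o0 o0 - P o1 o1] is non-zero, since a scalar matrix of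
     determinant 0 has trace 0. *)
  have [P01|P01] := eqVneq (P o0 o1) 0; last first.
    exists (X o0 o0 - X o0 o1 / P o0 o1 * P o0 o0), (X o0 o1 / P o0 o1).
    apply: mx2P; rewrite !mxE /= ?mulr1n ?mulr0n.
    - by ring.
    - by rewrite add0r divfK.
    - by rewrite add0r; apply: (mulfI P01); apply: (lin_comb (esym E00)); field.
    - by apply: (mulfI P01); apply: (lin_comb (esym E01)); field.
  have [P10|P10] := eqVneq (P o1 o0) 0; last first.
    exists (X o0 o0 - X o1 o0 / P o1 o0 * P o0 o0), (X o1 o0 / P o1 o0).
    apply: mx2P; rewrite !mxE /= ?mulr1n ?mulr0n.
    - by ring.
    - by rewrite add0r; apply: (mulfI P10); apply: (lin_comb E00); field.
    - by rewrite add0r divfK.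
    - by apply: (mulfI P10); apply: (lin_comb E10); field.
  have d0 : P o0 o0 - P o1 o1 != 0.
    apply/eqP => d0; have P11 : P o0 o0 = P o1 o1 by apply/eqP; rewrite -subr_eq0 d0.
    move: detP trP; rewrite P11 P01 mul0r subr0 => /eqP.
    by rewrite mulf_eq0 orbb => /eqP ->; rewrite addr0 => /esym/eqP; rewrite oner_eq0.
  exists (X o0 o0 - (X o0 o0 - X o1 o1) / (P o0 o0 - P o1 o1) * P o0 o0),
    ((X o0 o0 - X o1 o1) / (P o0 o0 - P o1 o1)).
  apply: mx2P; rewrite !mxE /= ?mulr1n ?mulr0n ?add0r.
  - by ring.
  - rewrite P01 mulr0; apply: (mulfI d0); rewrite mulr0.
    by apply: (lin_comb (esym E01)); rewrite P01; ring.
  - rewrite P10 mulr0; apply: (mulfI d0); rewrite mulr0.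
    by apply: (lin_comb E10); rewrite P10; ring.
  - by field.
have dX : \det X = al * (al + be).
  move: trP detP; rewrite XE tr_mx2 !det_mx2 !mxE /= ?mulr1n ?mulr0n => trP detP.
  have E : (al + be * P o0 o0) * (al + be * P o1 o1) -
     (0 + be * P o0 o1) * (0 + be * P o1 o0) =
     al ^+ 2 + al * be * (P o0 o0 + P o1 o1) +
     be ^+ 2 * (P o0 o0 * P o1 o1 - P o0 o1 * P o1 o0) by ring.
  by rewrite E trP detP; ring.
have := GL_det_neq0 X; rewrite dX mulf_eq0 negb_or => /andP[al0 ab0].
exists al, ((al + be) / al); split=> //; first by rewrite mulf_neq0 ?invr_neq0.
have ab1 : (al + be) / al != 0 by rewrite mulf_neq0 ?invr_neq0.
apply: val_inj; rewrite [RHS]scal_mulE // rfE // [LHS]XE scalerDr scalemx1 scalerA.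
by congr (_ + _ *: _); field.
Qed.

Lemma rf_nonscalar a P : is_proj P -> a != 0 -> a != 1 -> rf a P \notin scalars.
Proof. by move=> pP a0 a1; exact: refl_nonscalar (refl_rf pP a0 a1). Qed.

Lemma rf_commute a P X : is_proj P -> a != 0 -> a != 1 ->
  commute X (rf a P) <-> X *m P = P *m X.
Proof.
move=> pP a0 a1; have a10 : a - 1 != 0 by rewrite subr_eq0.
split=> [/(congr1 val) | XP]; last first.
  apply: val_inj; rewrite -[LHS]/(X *m rf a P) -[RHS]/(rf a P *m X) rfE //.
  by rewrite mulmxDr mulmxDl mulmx1 mul1mx -scalemxAr -scalemxAl XP.
rewrite -[LHS]/(X *m rf a P) -[RHS]/(rf a P *m X) rfE //.
rewrite mulmxDr mulmxDl mulmx1 mul1mx -scalemxAr -scalemxAl => /addrI.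
exact: (@scalerI _ _ _ a10).
Qed.

Lemma scalarsMl c A : c != 0 -> ((scal c * A)%g \in scalars) = (A \in scalars).
Proof.
move=> c0; have gM := group_closedM (@scalar_closed C); have sc := scal_in c0.
apply/idP/idP => As; last exact: gM.
rewrite -[A](mulKg (scal c)); apply: gM => //.
by apply: (group_closedV (@scalar_closed C)).
Qed.

Lemma rf_scalar a P : is_proj P -> a != 0 -> (rf a P \in scalars) = (a == 1).
Proof.
move=> pP a0; have [->|a1] := eqVneq a 1; last by rewrite (negPf (rf_nonscalar pP a0 a1)).
by rewrite rf1 // -scal1 scal_in // oner_neq0.
Qed.

Lemma rf_inj a P P' : is_proj P -> is_proj P' -> a != 0 -> a != 1 ->
  rf a P = rf a P' -> P = P'.
Proof.
move=> pP pP' a0 a1 /(congr1 (@GLmx _ _)); rewrite !rfE // => /addrI.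
by apply: scalerI; rewrite subr_eq0.
Qed.

End Projections.

Section TorusElements.
Variable C : numClosedFieldType.
Local Open Scope ring_scope.
Implicit Types (P M : 'M[C]_2) (a b c : C) (A X Q : GL 2 C).

(** Apply [proj_commute] to a reflection along [P'], with 2 as a sample eigenvalue. Comparing traces
    and determinants leaves [c = 1] or [c = 2], the two alternatives. *)
Lemma proj_commute_eq P P' : is_proj P -> is_proj P' -> P *m P' = P' *m P ->
  P' = P \/ P' = 1%:M - P.
Proof.
move=> pP pP' PP'; have n0 : (2%:R : C) != 0 by rewrite pnatr_eq0.
have n1 : (2%:R : C) != 1 by rewrite pnatr_eq1.
have XP : rf 2%:R P' *m P = P *m rf 2%:R P'.
  by rewrite rfE // mulmxDl mulmxDr mul1mx mulmx1 -scalemxAl -scalemxAr PP'.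
have [c [a [c0 a0 E]]] := proj_commute pP XP.
have trE : 1 + 2%:R = c * (1 + a).
  have [<- _ _] := refl_rf pP' n0 n1; rewrite E scal_mulE // mxtraceZ rfE //.
  by rewrite mxtraceD mxtraceZ mxtrace1 pP.1; ring.
have detE : 2%:R = c ^+ 2 * a.
  have [_ <- _] := refl_rf pP' n0 n1; rewrite E GL_detM scalE // det_scalar.
  by rewrite rfE // det_rf.
have : (c - 1) * (c - 2%:R) = 0.
  have -> : (c - 1) * (c - 2%:R) = c ^+ 2 - c * (1 + 2%:R) + 2%:R by ring.
  by rewrite trE detE; ring.
move/eqP; rewrite mulf_eq0 !subr_eq0 => /orP[]/eqP cE; rewrite {}cE in E detE.
  left; rewrite scal1 mul1g in E; rewrite expr1n mul1r in detE.
  by apply/esym/(rf_inj pP pP' n0 n1); rewrite E detE.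
right; have aE : a - 1 = - 2%:R^-1.
  by apply: (mulfI n0); apply: (mulfI n0); apply: (lin_comb (esym detE)); field.
have := congr1 (@GLmx _ _) E; rewrite scal_mulE // !rfE // aE scalerDr scalerA.
rewrite mulrN divff // scaleN1r => /(canRL (addKr _)).
have -> : 2%:R - 1 = 1 :> C by ring.
by rewrite scale1r => ->; rewrite scaler_nat addrA mulr2n addKr.
Qed.

Lemma torus_element A n : A \notin scalars -> (0 < n)%N -> (A ^+ n)%g \in scalars ->
  exists P c a, [/\ is_proj P, c != 0, a != 0 & a != 1] /\ A = (scal c * rf a P)%g.
Proof.
move=> nA n0 An; have [mu [nu [trA detA mn _]]] := finite_order_eigenvalues nA n0 An.
have mn0 : mu - nu != 0 by rewrite subr_eq0.
have [mu0 nu0] : mu != 0 /\ nu != 0.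
  by have := GL_det_neq0 A; rewrite detA mulf_eq0 negb_or => /andP[].
pose P := (mu - nu)^-1 *: (GLmx A - nu%:M); have pP : is_proj P.
  split; first by rewrite mxtraceZ raddfB /= mxtrace_scalar trA; field.
  rewrite detZ; apply/eqP; rewrite mulf_eq0; apply/orP; right; apply/eqP.
  move: trA detA; rewrite tr_mx2 !det_mx2 !mxE /= ?mulr1n ?mulr0n => trA detA.
  set a00 := A ord0 ord0 in trA detA *; set a01 := A ord0 ord_max in trA detA *.
  set a10 := A ord_max ord0 in trA detA *; set a11 := A ord_max ord_max in trA detA *.
  have E : (a00 - nu) * (a11 - nu) - (a01 - 0) * (a10 - 0) =
    a00 * a11 - a01 * a10 - nu * (a00 + a11) + nu ^+ 2 by ring.
  by rewrite E trA detA; ring.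
exists P, nu, (mu / nu); split.
  split=> //; first by rewrite mulf_neq0 ?invr_neq0.
  by apply: contra mn => /eqP/(canRL (divfK nu0)); rewrite mul1r => ->.
have an0 : mu / nu != 0 by rewrite mulf_neq0 ?invr_neq0.
apply: val_inj; rewrite [RHS]scal_mulE // rfE // scalerDr scalemx1 scalerA /P scalerA.
have -> : nu * (mu / nu - 1) / (mu - nu) = 1 by field; rewrite nu0 mn0.
by rewrite scale1r addrC subrK.
Qed.

End TorusElements.

Section Tori.
Variables (C : numClosedFieldType) (gT : finGroupType) (rho : {multiplicative gT -> GL 2 C}).
Hypothesis rho_inj : injective rho.
Implicit Types (g h x y : gT).
Local Notation G := [set: gT].

Definition scZ : {set gT} := [set g | rho g \in scalars].

Lemma scZP g : (g \in scZ) = (rho g \in scalars).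
Proof. by rewrite inE. Qed.

Lemma scZ_group_set : group_set scZ.
Proof.
have [s1 sF] := @scalar_closed C; apply/group_setP; split; first by rewrite inE mult1.
by move=> x y; rewrite !inE gmulfM; exact: (group_closedM (@scalar_closed C)).
Qed.
Canonical scZ_group := Group scZ_group_set.

Lemma rho_commute g h : commute (rho g) (rho h) <-> commute g h.
Proof.
split=> [E|gh]; last by rewrite /commute -!gmulfM gh.
by apply: rho_inj; rewrite !gmulfM E.
Qed.

Lemma scZ_central z g : z \in scZ -> commute z g.
Proof.
by rewrite inE => zs; apply/rho_commute; exact: (@scalar_central C).2 zs _.
Qed.

Lemma rho_exp_scalar g : rho g ^+ #[g] \in scalars.
Proof. by rewrite -multX expg_order mult1 -scal1 scal_in // oner_neq0. Qed.

Lemma scZ_sub_cent1 g : scZ \subset 'C[g].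
Proof. by apply/fintype.subsetP => z zZ; apply/cent1P; exact: scZ_central. Qed.

Lemma cent1_commute g x y : g \notin scZ -> x \in 'C[g] -> y \in 'C[g] -> commute x y.
Proof.
rewrite inE => nsg /cent1P gx /cent1P gy; apply/rho_commute.
by apply: (commute_nonscalar nsg); apply/rho_commute/commute_sym.
Qed.

Lemma cent1_eq g h : g \notin scZ -> h \in 'C[g] -> h \notin scZ -> 'C[h] = 'C[g].
Proof.
move=> ng hg nh; apply/setP => x; apply/idP/idP => xC.
  apply/cent1P/(cent1_commute nh) => //.
  by apply/cent1P/commute_sym/cent1P.
by apply/cent1P/(cent1_commute ng).
Qed.

(** For the torus of [g]: its order e modulo scalars, the order f of its Weyl group and the number n
    of its conjugates. Their product is N, the order of the whole group modulo scalars. *)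
Definition torus_rank g := #|'C[g] : scZ|.
Definition torus_weyl g := #|'N('C[g]) : 'C[g]|.
Definition torus_conj g := #|G : 'N('C[g])|.
Definition torus_class g := class_support ('C[g] :\: scZ) G.

Lemma card_torus g : #|'C[g]| = (torus_rank g * #|scZ|)%N.
Proof. by rewrite mulnC /torus_rank Lagrange // scZ_sub_cent1. Qed.

Lemma card_torus_diff g : #|'C[g] :\: scZ| = ((torus_rank g).-1 * #|scZ|)%N.
Proof.
rewrite cardsD (finset.setIidPr (scZ_sub_cent1 g)) card_torus.
by rewrite -{2}[#|scZ|]mul1n -mulnBl subn1.
Qed.

Lemma torus_rank_gt1 g : g \notin scZ -> (1 < torus_rank g)%N.
Proof.
move=> ng; rewrite indexg_gt1; apply: contra ng => /fintype.subsetP; apply.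
exact: cent1id.
Qed.

Lemma card_torus_product g :
  #|G : scZ| = (torus_conj g * torus_weyl g * torus_rank g)%N.
Proof.
have sCN : 'C[g] \subset 'N('C[g]) by exact: normG.
rewrite /torus_conj /torus_weyl /torus_rank -mulnA -[RHS]mulnC.
rewrite [(_ * #|'C[g] : scZ|)%N]mulnC.
rewrite (mulnC #|'C[g] : scZ|) (Lagrange_index sCN (scZ_sub_cent1 g)).
by rewrite mulnC Lagrange_index // ?finset.subsetT // (fintype.subset_trans (scZ_sub_cent1 g)).
Qed.

Lemma scZJ z x : (z ^ x \in scZ) = (z \in scZ).
Proof. by rewrite !inE multJ scalarsJ. Qed.

(** Two tori that share a non-scalar element coincide, by [cent1_eq]. This is why a class of tori
    has exactly n (e - 1) |Z| non-scalar elements. *)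
Lemma torus_normedTI g : g \notin scZ -> normedTI ('C[g] :\: scZ) G 'N('C[g]).
Proof.
move=> ng; apply/normedTI_memJ_P; split; first by apply/set0Pn; exists g; rewrite finset.in_setD ng cent1id.
  exact: finset.subsetT.
move=> a x; rewrite finset.in_setD => /andP[na ag] _; rewrite finset.in_setD scZJ na /=.
have Ca : 'C[a] = 'C[g] by exact: cent1_eq.
apply/idP/idP => [axg | xN].
  by rewrite inE -Ca -cent1J (@cent1_eq g (a ^ x)) ?Ca ?scZJ.
by rewrite memJ_norm.
Qed.

Lemma card_torus_class g : g \notin scZ ->
  #|torus_class g| = (torus_conj g * (torus_rank g).-1 * #|scZ|)%N.
Proof.
move=> ng; rewrite /torus_class (card_support_normedTI (torus_normedTI ng)).
by rewrite card_torus_diff /torus_conj mulnC mulnA.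
Qed.

Lemma torus_classP g h : reflect (exists2 x, h \notin scZ & h ^ x \in 'C[g]) (h \in torus_class g).
Proof.
apply: (iffP imset2P) => [[a x aT _ ->] | [x nh hx]].
  move: aT; rewrite finset.in_setD => /andP[na aC]; exists x^-1; first by rewrite scZJ.
  by rewrite conjgK.
exists (h ^ x) x^-1; rewrite ?conjgK ?finset.in_setT //.
by rewrite finset.in_setD scZJ nh.
Qed.

Lemma torus_class_id g : g \notin scZ -> g \in torus_class g.
Proof. by move=> ng; apply/torus_classP; exists 1; rewrite // conjg1 cent1id. Qed.

Lemma torus_class_invariants g h : g \notin scZ -> h \in torus_class g ->
  [/\ torus_rank h = torus_rank g, torus_weyl h = torus_weyl g &
      torus_conj h = torus_conj g].
Proof.
move=> ng /torus_classP[x nh hx].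
have E : 'C[g] = 'C[h] :^ x by rewrite -cent1J; apply/esym/cent1_eq; rewrite ?scZJ.
have ZJ : scZ :^ x = scZ.
  by apply/setP => y; rewrite mem_conjg scZJ.
rewrite /torus_rank /torus_weyl /torus_conj E normJ; split.
- by rewrite -{2}ZJ indexJg.
- by rewrite indexJg.
- by rewrite -{2}(conjGid (finset.in_setT x)) indexJg.
Qed.

Lemma torus_class_eq g h x : g \notin scZ -> h \in torus_class g ->
  x \in torus_class h -> x \in torus_class g.
Proof.
move=> ng /torus_classP[y nh hy] /torus_classP[w nx xw]; apply/torus_classP.
exists (w * y) => //; rewrite conjgM.
have -> : 'C[g] = 'C[h] :^ y by rewrite -cent1J; apply/esym/cent1_eq; rewrite ?scZJ.
by rewrite memJ_conjg.
Qed.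

Lemma torus_class_sym g h : g \notin scZ -> h \in torus_class g -> g \in torus_class h.
Proof.
move=> ng /torus_classP[y nh hy]; apply/torus_classP; exists y^-1 => //.
have E : 'C[h ^ y] = 'C[g] by apply: cent1_eq; rewrite ?scZJ.
by rewrite -(memJ_conjg _ y) conjgKV -cent1J E cent1id.
Qed.

Lemma torus_class_disjoint g h : g \notin scZ -> h \notin scZ ->
  h \notin torus_class g -> [disjoint torus_class g & torus_class h].
Proof.
move=> ng nh hg; apply/pred0Pn => -[x /= /andP[xg xh]]; move/negP: hg; apply.
by apply: torus_class_eq xg _ => //; exact: torus_class_sym.
Qed.

Lemma torus_class_sub g : torus_class g \subset ~: scZ.
Proof. by apply/fintype.subsetP => x /torus_classP[y nx _]; rewrite inE. Qed.

Lemma card_noncentral : #|~: scZ| = ((#|G : scZ|).-1 * #|scZ|)%N.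
Proof.
rewrite cardsCs finset.setCK -cardsT -(Lagrange (finset.subsetT scZ)) mulnC -{2}[#|scZ|]mul1n.
by rewrite -mulnBl subn1.
Qed.

End Tori.

Section ConjProj.
Variable C : fieldType.
Local Open Scope ring_scope.

Lemma conj_projM (P : 'M[C]_2) (Q Q' : GL 2 C) :
  conj_proj P (Q * Q')%g = conj_proj (conj_proj P Q) Q'.
Proof.
rewrite /conj_proj invgM -[GLmx (Q'^-1 * Q^-1)%g]/(Q'^-1%g *m Q^-1%g).
by rewrite -[GLmx (Q * Q')%g]/(Q *m Q') !mulmxA.
Qed.

Lemma conj_proj_compl (P : 'M[C]_2) (Q : GL 2 C) :
  conj_proj (1%:M - P) Q = 1%:M - conj_proj P Q.
Proof.
rewrite /conj_proj mulmxBr mulmx1 mulmxBl; congr (_ - _).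
by rewrite -[LHS]/(GLmx (Q^-1 * Q)%g) mulVg.
Qed.

Lemma conj_proj_fix (P : 'M[C]_2) (Q : GL 2 C) :
  conj_proj P Q = P <-> Q *m P = P *m Q.
Proof.
have Q1 : Q *m Q^-1%g = 1%:M by rewrite -[LHS]/(GLmx (Q * Q^-1)%g) mulgV.
have Q2 : Q^-1%g *m Q = 1%:M by rewrite -[LHS]/(GLmx (Q^-1 * Q)%g) mulVg.
rewrite /conj_proj; split=> E; first by rewrite -{1}E !mulmxA Q1 mul1mx.
by rewrite -mulmxA -E mulmxA Q2 mul1mx.
Qed.

Lemma conj_proj_scal (P : 'M[C]_2) (c : C) (Q : GL 2 C) : c != 0 ->
  conj_proj P (scal c * Q)%g = conj_proj P Q.
Proof.
move=> c0; rewrite conj_projM; congr conj_proj; apply/conj_proj_fix.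
by rewrite scalE // scalar_mxC.
Qed.

End ConjProj.

(** * The eigenlines of a torus *)

Section TorusProjection.
Variables (C : numClosedFieldType) (gT : finGroupType) (rho : {multiplicative gT -> GL 2 C}).
Hypothesis rho_inj : injective rho.
Implicit Types (g h x y : gT).
Local Notation G := [set: gT].
Local Notation Z := (scZ rho).
Local Notation e g := (torus_rank rho g).

(* [P] projects onto one of the two eigenlines of [g] along the other one *)
Definition torus_proj g (P : 'M[C]_2) := is_proj P /\
  exists (c a : C), [/\ c != 0, a != 0 & a != 1]%R /\ rho g = scal c * rf a P.

Lemma torus_projP g : g \notin Z -> exists P, torus_proj g P.
Proof.
rewrite inE => ng; have [P [c [a [[pP c0 a0 a1] gE]]]] :=
  torus_element ng (order_gt0 g) (rho_exp_scalar rho g).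
by exists P; split=> //; exists c, a.
Qed.

Lemma torus_proj_compl g P : torus_proj g P -> torus_proj g (1%:M - P)%R.
Proof.
move=> [pP [c [a [[c0 a0 a1] gE]]]]; split; first exact: proj_compl.
exists (c * a)%R, a^-1%R; split; first by rewrite mulf_neq0 // invr_neq0 // invr_eq1.
rewrite gE; apply: val_inj; rewrite [LHS]scal_mulE // [RHS]scal_mulE ?mulf_neq0 //.
rewrite !rfE ?invr_neq0 //; last exact: proj_compl.
by apply: mx2P; rewrite !mxE /=; field.
Qed.

Lemma torus_proj_cent g P h : torus_proj g P ->
  (h \in 'C[g]) <-> (rho h *m P = P *m rho h)%R.
Proof.
move=> [pP [c [a [[c0 a0 a1] gE]]]].
have rfC := rf_commute (rho h) pP a0 a1; split=> [/cent1P/(rho_commute rho_inj) gh | hP].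
  apply/rfC; have -> : rf a P = (scal c)^-1 * rho g by rewrite gE mulKg.
  by apply: commuteM; [exact/commuteV/commute_sym/scal_central | exact: commute_sym].
apply/cent1P/(rho_commute rho_inj); rewrite gE.
by apply: commuteM; [exact/commute_sym/scal_central | exact/rfC].
Qed.

Lemma torus_proj_other g h P : g \notin Z -> h \notin Z -> h \in 'C[g] ->
  torus_proj g P -> torus_proj h P.
Proof.
move=> ng nh hg tP; have [pP _] := tP; split=> //.
have /(torus_proj_cent h tP) hP := hg.
have [c [a [c0 a0 hE]]] := proj_commute pP hP; exists c, a; split=> //; split=> //.
by move: nh; rewrite inE hE scalarsMl // rf_scalar.
Qed.

Lemma torus_proj_unique g P P' : torus_proj g P -> torus_proj g P' ->
  P' = P \/ P' = (1%:M - P)%R.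
Proof.
move=> tP [pP' [c [a [[c0 a0 a1] gE]]]]; have [pP _] := tP.
apply: proj_commute_eq => //.
have [cg _] := torus_proj_cent g tP; have := cg (cent1id g).
have XE : GLmx (rf a P') = (c^-1 *: GLmx (rho g))%R.
  by rewrite gE scal_mulE // scalerA mulVf // scale1r.
move=> /(congr1 (fun M => c^-1 *: M)%R); rewrite scalemxAl scalemxAr -XE rfE //.
rewrite mulmxDl mulmxDr mul1mx mulmx1 -scalemxAl -scalemxAr => /addrI.
by move/scalerI => -> //; rewrite subr_eq0.
Qed.

Lemma torus_proj_conj g P x : torus_proj g P -> torus_proj (g ^ x) (conj_proj P (rho x)).
Proof.
move=> [pP [c [a [[c0 a0 a1] gE]]]]; split; first exact: proj_conj.
by exists c, a; split=> //; rewrite multJ gE conjMg scalJ rfJ.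
Qed.

(** A normalising element permutes the two eigenlines of the torus, and fixes both exactly when it
    lies in the torus. *)
Lemma torus_norm_proj g P x : g \notin Z -> torus_proj g P -> x \in 'N('C[g]) ->
  conj_proj P (rho x) = (if x \in 'C[g] then P else 1%:M - P)%R.
Proof.
move=> ng tP xN; have gxC : g ^ x \in 'C[g] by rewrite memJ_norm // cent1id.
have tPx : torus_proj (g ^ x) P by apply: torus_proj_other tP; rewrite ?scZJ.
case: ifPn => [/(torus_proj_cent x tP)/conj_proj_fix // | xC].
have [E|//] := torus_proj_unique tPx (torus_proj_conj x tP).
by case/negP: xC; apply/(torus_proj_cent x tP)/conj_proj_fix.
Qed.

Lemma torus_weyl_le2 g : g \notin Z -> (0 < torus_weyl g <= 2)%N.
Proof.
move=> ng; rewrite /torus_weyl indexg_gt0 /=.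
have [P tP] := torus_projP ng.
have sCN : 'C[g] \subset 'N('C[g]) by exact: normG.
rewrite -(leq_pmul2l (cardG_gt0 'C[g])) Lagrange //.
have [NC|/subsetPn[x xN xC]] := boolP ('N('C[g]) \subset 'C[g]).
  by rewrite muln2 -addnn (leq_trans (subset_leq_card NC)) // leq_addr.
have NE : 'N('C[g]) \subset 'C[g] :|: (x^-1 *: 'C[g]).
  apply/fintype.subsetP => y yN; rewrite finset.in_setU.
  case: (boolP (y \in 'C[g])) => //= yC; rewrite mem_lcoset invgK.
  apply/(torus_proj_cent _ tP)/conj_proj_fix.
  rewrite gmulfM conj_projM (torus_norm_proj ng tP xN) (negPf xC) conj_proj_compl.
  by rewrite (torus_norm_proj ng tP yN) (negPf yC) subKr.
apply: leq_trans (subset_leq_card NE) _; apply: leq_trans (leq_card_setU _ _) _.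
by rewrite card_lcoset muln2 addnn.
Qed.

Lemma torus_swap g P : g \notin Z -> torus_proj g P -> torus_weyl g = 2%N ->
  exists x, conj_proj P (rho x) = (1%:M - P)%R.
Proof.
move=> ng tP w2; have /subsetPn[x xN xC] : ~~ ('N('C[g]) \subset 'C[g]).
  by rewrite -indexg_gt1 -/(torus_weyl g) w2.
by exists x; rewrite (torus_norm_proj ng tP xN) (negPf xC).
Qed.

Lemma scZ_normal g : g \notin Z -> Z <| 'C[g].
Proof.
move=> ng; rewrite /normal scZ_sub_cent1 //=; apply/fintype.subsetP => x xC.
by rewrite inE; apply/fintype.subsetP => y; rewrite mem_conjg scZJ.
Qed.

Lemma torus_exp_rank g h : g \notin Z -> h \in 'C[g] -> h ^+ e g \in Z.
Proof.
move=> ng hC; have nZ := scZ_normal ng; have hN := fintype.subsetP (normal_norm nZ) h hC.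
rewrite coset_idr // ?groupX //.
have : coset (scZ_group rho) h ^+ #|'C[g] / Z| = 1 by apply: expg_cardG; exact: mem_quotient.
by rewrite card_quotient ?normal_norm // -morphX.
Qed.

Lemma torus_form g P h : torus_proj g P -> h \in 'C[g] ->
  exists (c a : C), [/\ (c != 0)%R, (a != 0)%R & rho h = scal c * rf a P].
Proof. by move=> tP /(torus_proj_cent h tP); exact/proj_commute/tP.1. Qed.

Lemma torus_form_exp g P h c a : g \notin Z -> torus_proj g P -> h \in 'C[g] ->
  (c != 0)%R -> (a != 0)%R -> rho h = scal c * rf a P -> (a ^+ e g = 1)%R.
Proof.
move=> ng tP hC c0 a0 hE; have := torus_exp_rank ng hC.
rewrite inE multX hE expgMn; last exact: scal_central.
rewrite scalX // scalarsMl ?expf_neq0 // rfX //; last exact: tP.1.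
by rewrite rf_scalar ?expf_neq0 //; [move/eqP | exact: tP.1].
Qed.

(* The ratios of eigenvalues on a torus are [e] distinct [e]-th roots of unity, *)
(* hence all of them.                                                         *)
Lemma torus_form_all g P (a : C) : g \notin Z -> torus_proj g P -> (a ^+ e g = 1)%R ->
  exists h c, [/\ h \in 'C[g], (c != 0)%R & rho h = scal c * rf a P].
Proof.
move=> ng tP ae; have pP := tP.1.
have eg0 : (0 < e g)%N by exact: indexg_gt0.
have /choice[r rP] : forall h, exists b : C, h \in 'C[g] ->
    exists c : C, [/\ (c != 0)%R, (b != 0)%R & rho h = scal c * rf b P].
  move=> h; have [hC|] := boolP (h \in 'C[g]); last by exists 0%R.
  by have [c [b [c0 b0 hE]]] := torus_form tP hC; exists b => _; exists c.
pose vals := [seq r (repr D) | D <- enum (lcosets Z 'C[g])].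
have cosetP D : D \in lcosets Z 'C[g] -> repr D \in 'C[g] /\ D = repr D *: Z.
  case/lcosetsP => x xC ->; have : repr (x *: Z) \in x *: Z by apply: mem_repr (lcoset_refl _ x).
  move=> rx; split; last exact/esym/lcoset_eqP.
  move: rx; rewrite mem_lcoset => xr; rewrite -(mulKVg x (repr _)) groupM //.
  exact: fintype.subsetP (scZ_sub_cent1 rho_inj g) _ xr.
have vals_uniq : uniq vals.
  rewrite map_inj_in_uniq ?enum_uniq // => D D'; rewrite !mem_enum => DC D'C rE.
  have [xC ->] := cosetP D DC; have [yC ->] := cosetP D' D'C.
  apply/lcoset_eqP; rewrite mem_lcoset inE.
  have [c [c0 b0 xE]] := rP _ xC; have [d [d0 b'0 yE]] := rP _ yC.
  rewrite gmulfM multV xE yE rE.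
  set S := rf _ P; have SE u v : (scal u * S)^-1 * (scal v * S) = ((scal u)^-1 * scal v) ^ S.
    by rewrite /conjg; gsimp.
  by rewrite SE scalarsJ scalV // scalM ?invr_neq0 // scal_in // mulf_neq0 ?invr_neq0.
have vals_size : size vals = e g by rewrite size_map -cardE card_lcosets.
have root_vals b : b \in vals -> (b ^+ e g = 1)%R.
  case/mapP=> D; rewrite mem_enum => /cosetP[xC _] ->.
  by have [c [c0 b0 xE]] := rP _ xC; exact: torus_form_exp xE.
have : a \in vals.
  apply: contraT => na.
  have := @max_poly_roots _ ('X^(e g) - 1)%R (a :: vals).
  rewrite -size_poly_eq0 size_XnsubC // => /(_ isT) /=; rewrite na vals_uniq vals_size ltnn.
  apply=> //; apply/andP; split; first by rewrite rootE !hornerE ae subrr.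
  by apply/allP => b /root_vals bE; rewrite rootE !hornerE bE subrr.
case/mapP=> D; rewrite mem_enum => /cosetP[xC _] ->.
by have [c [c0 b0 xE]] := rP _ xC; exists (repr D), c.
Qed.

End TorusProjection.

(** * The class equation: the sum of n (e - 1) over the classes of tori is N - 1 *)

Section TorusArithmetic.
Local Open Scope nat_scope.

Lemma torus_arith1 N n f e : N = n * f * e -> 1 < n -> 0 < f <= 2 -> 1 < e ->
  n * e.-1 <> N.-1.
Proof. by move=> -> n1 /andP[f0 f2] e1; case: e e1 => [//|[//|e]] _; nia. Qed.

(** The share of one class in [N] is (1 - 1/e) / f, at least 1/4; hence there are at most three
    classes. *)
Lemma torus_arith_quarter N n f e : N = n * f * e -> 1 < n -> 0 < f <= 2 -> 1 < e ->
  N <= 4 * (n * e.-1).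
Proof. by move=> -> n1 /andP[f0 f2] e1; case: e e1 => [//|[//|e]] _; nia. Qed.

Lemma torus_arith4 N a b c d : 0 < N -> N <= 4 * a -> N <= 4 * b -> N <= 4 * c -> N <= 4 * d ->
  ~~ (a + b + c + d <= N.-1).
Proof. lia. Qed.

Lemma torus_arith_half N n e : N = n * 1 * e -> 1 < e -> N <= 2 * (n * e.-1).
Proof. by move=> -> e1; case: e e1 => [//|[//|e]] _; nia. Qed.

(** The solution is the tetrahedral group, in which no rotation reverses a three-fold axis. *)
Lemma torus_arith2_12 N n1 e1 n2 e2 : N = n1 * 1 * e1 -> N = n2 * 2 * e2 ->
  1 < n1 -> 1 < n2 -> 1 < e1 -> 1 < e2 -> n1 * e1.-1 + n2 * e2.-1 = N.-1 ->
  [/\ N = 12, e1 = 3 & e2 = 2].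
Proof.
move=> N1 N2 n1g n2g e1g e2g S.
have S1 : n1 * e1 + n2 * e2 + 1 = N + n1 + n2.
  by case: e1 e1g N1 S => [//|e1] _; case: e2 e2g N2 => [//|e2] _ /=; nia.
have E1 : n1 * e1 = N by lia.
have E2 : n2 * e2 * 2 = N by lia.
have E3 : n2 * e2 + 1 = n1 + n2 by lia.
have e13 : 3 <= e1.
  by case: e1 e1g {N1 S S1} E1 => [//|[//|[|e1]]] _ E1 //; nia.
have e2E : e2 = 2.
  by case: e2 e2g {N2 S S1} E2 E3 => [//|[//|[//|e2]]] _ E2 E3; nia.
subst e2; have e1E : e1 = 3.
  by case: e1 {e1g S S1 N1} e13 E1 => [//|[//|[//|[//|e1]]]] _ E1; nia.
by subst e1; split=> //; lia.
Qed.

Lemma torus_arith2 N n1 f1 e1 n2 f2 e2 : N = n1 * f1 * e1 -> N = n2 * f2 * e2 ->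
  1 < n1 -> 1 < n2 -> 0 < f1 <= 2 -> 0 < f2 <= 2 -> 1 < e1 -> 1 < e2 ->
  n1 * e1.-1 + n2 * e2.-1 = N.-1 ->
  N = 12 /\ ([/\ f1 = 1, e1 = 3, f2 = 2 & e2 = 2] \/ [/\ f2 = 1, e2 = 3, f1 = 2 & e1 = 2]).
Proof.
move=> N1 N2 n1g n2g f1g f2g e1g e2g S.
have [f1E|f1E] : f1 = 1 \/ f1 = 2 by lia.
  have [f2E|f2E] : f2 = 1 \/ f2 = 2 by lia.
    subst f1 f2; have := torus_arith_half N1 e1g; have := torus_arith_half N2 e2g.
    have : 0 < N by nia.
    by lia.
  subst f1 f2; have [-> -> ->] := torus_arith2_12 N1 N2 n1g n2g e1g e2g S.
  by split=> //; left.
have [f2E|f2E] : f2 = 1 \/ f2 = 2 by lia.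
  subst f1 f2; rewrite addnC in S.
  have [-> -> ->] := torus_arith2_12 N2 N1 n2g n1g e2g e1g S.
  by split=> //; right.
subst f1 f2; exfalso.
have E1 : n1 * e1.-1 + n1 = n1 * e1 by case: e1 e1g {N1 S} => [//|e1] _ /=; nia.
have E2 : n2 * e2.-1 + n2 = n2 * e2 by case: e2 e2g {N2 S} => [//|e2] _ /=; nia.
by lia.
Qed.

(** With all f = 2 the equation reads 1/e1 + 1/e2 + 1/e3 = 1 + 2/N. The dihedral solutions (2, 2, e)
    would have [n3 = 1]. *)
Lemma torus_arith3_sorted N n1 e1 n2 e2 n3 e3 :
  N = n1 * 2 * e1 -> N = n2 * 2 * e2 -> N = n3 * 2 * e3 ->
  1 < n1 -> 1 < n2 -> 1 < n3 -> 1 < e1 -> e1 <= e2 -> e2 <= e3 ->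
  n1 * e1.-1 + n2 * e2.-1 + n3 * e3.-1 = N.-1 ->
  [/\ e1 = 2, e2 = 3 & [\/ N = 12 /\ e3 = 3, N = 24 /\ e3 = 4 | N = 60 /\ e3 = 5]].
Proof.
move=> N1 N2 N3 n1g n2g n3g e1g e12 e23 S.
have P n e : 1 < e -> n * e.-1 + n = n * e by case: e => [//|e] _ /=; nia.
have e2g := leq_trans e1g e12; have e3g := leq_trans e2g e23.
have := P n1 e1 e1g; have := P n2 e2 e2g; have := P n3 e3 e3g => P3 P2 P1.
pose H := n1 * e1; have H1 : n1 * e1 = H by [].
have HN : N = 2 * H by lia.
have H2 : n2 * e2 = H by lia.
have H3 : n3 * e3 = H by lia.
have Sn : n1 + n2 + n3 = H + 1 by lia.
clear P1 P2 P3 S N1 N2 N3 P.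
have e1E : e1 = 2.
  apply/eqP; rewrite eqn_leq e1g andbT leqNgt; apply/negP => e1l.
  have : 3 * n1 <= H by rewrite -H1 mulnC leq_mul2l e1l orbT.
  have : 3 * n2 <= H by rewrite -H2 mulnC leq_mul2l (leq_trans e1l e12) orbT.
  have : 3 * n3 <= H.
    by rewrite -H3 mulnC leq_mul2l (leq_trans (leq_trans e1l e12) e23) orbT.
  by lia.
subst e1.
have e2E : e2 = 3.
  have [e2l|e2l] := leqP 4 e2.
    have : 4 * n2 <= H by rewrite -H2 mulnC leq_mul2l e2l orbT.
    have : 4 * n3 <= H by rewrite -H3 mulnC leq_mul2l (leq_trans e2l e23) orbT.
    by lia.
  have [e2E|//] : e2 = 2 \/ e2 = 3 by lia.
  by subst e2; lia.
subst e2.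
have e3l : e3 <= 5.
  rewrite leqNgt; apply/negP => e3l.
  have : 6 * n3 <= H by rewrite -H3 mulnC leq_mul2l e3l orbT.
  by lia.
have [e3E|[e3E|e3E]] : e3 = 3 \/ (e3 = 4 \/ e3 = 5) by lia.
- by subst e3; split=> //; constructor 1; split=> //; lia.
- by subst e3; split=> //; constructor 2; split=> //; lia.
- by subst e3; split=> //; constructor 3; split=> //; lia.
Qed.

Lemma torus_arith3 N n1 f1 e1 n2 f2 e2 n3 f3 e3 :
  N = n1 * f1 * e1 -> N = n2 * f2 * e2 -> N = n3 * f3 * e3 ->
  1 < n1 -> 1 < n2 -> 1 < n3 -> 0 < f1 <= 2 -> 0 < f2 <= 2 -> 0 < f3 <= 2 ->
  1 < e1 -> 1 < e2 -> 1 < e3 ->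
  n1 * e1.-1 + n2 * e2.-1 + n3 * e3.-1 = N.-1 ->
  [/\ f1 = 2, f2 = 2 & f3 = 2] /\
  exists m, [\/ N = 12 /\ m = 3, N = 24 /\ m = 4 | N = 60 /\ m = 5] /\
    perm_eq [:: e1; e2; e3] [:: 2; 3; m].
Proof.
move=> N1 N2 N3 n1g n2g n3g f1g f2g f3g e1g e2g e3g S.
have q1 := torus_arith_quarter N1 n1g f1g e1g.
have q2 := torus_arith_quarter N2 n2g f2g e2g.
have q3 := torus_arith_quarter N3 n3g f3g e3g.
have N0 : 0 < N by nia.
have f1E : f1 = 2.
  have [f1E|//] : f1 = 1 \/ f1 = 2 by lia.
  by subst f1; have := torus_arith_half N1 e1g; lia.
have f2E : f2 = 2.
  have [f2E|//] : f2 = 1 \/ f2 = 2 by lia.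
  by subst f2; have := torus_arith_half N2 e2g; lia.
have f3E : f3 = 2.
  have [f3E|//] : f3 = 1 \/ f3 = 2 by lia.
  by subst f3; have := torus_arith_half N3 e3g; lia.
subst f1 f2 f3; split=> //; clear q1 q2 q3.
have fin a b c m : perm_eq [:: e1; e2; e3] [:: a; b; c] ->
    [/\ a = 2, b = 3 & [\/ N = 12 /\ c = 3, N = 24 /\ c = 4 | N = 60 /\ c = 5]] -> c = m ->
    exists m, [\/ N = 12 /\ m = 3, N = 24 /\ m = 4 | N = 60 /\ m = 5] /\
      perm_eq [:: e1; e2; e3] [:: 2; 3; m].
  by move=> p [aE bE cP] _; exists c; split=> //; rewrite aE bE in p.
have P123 : perm_eq [:: e1; e2; e3] [:: e1; e2; e3] by [].
have P132 : perm_eq [:: e1; e2; e3] [:: e1; e3; e2] by rewrite perm_cons (perm_catC [:: e2] [:: e3]).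
have P213 : perm_eq [:: e1; e2; e3] [:: e2; e1; e3] by rewrite (perm_catCA [:: e1] [:: e2] [:: e3]).
have P231 : perm_eq [:: e1; e2; e3] [:: e2; e3; e1] by rewrite (perm_catC [:: e1] [:: e2; e3]).
have P312 : perm_eq [:: e1; e2; e3] [:: e3; e1; e2] by rewrite (perm_catC [:: e1; e2] [:: e3]).
have P321 : perm_eq [:: e1; e2; e3] [:: e3; e2; e1].
  by rewrite (permPl P231) (perm_catCA [:: e2] [:: e3] [:: e1]).
have [l12|/ltnW l12] := leqP e1 e2; have [l23|/ltnW l23] := leqP e2 e3;
  have [l13|/ltnW l13] := leqP e1 e3.
- by apply: (fin _ _ _ e3 P123) => //; apply: (torus_arith3_sorted N1 N2 N3).
- by apply: (fin _ _ _ e3 P123) => //; apply: (torus_arith3_sorted N1 N2 N3).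
- by apply: (fin _ _ _ e2 P132) => //; apply: (torus_arith3_sorted N1 N3 N2) => //; lia.
- by apply: (fin _ _ _ e2 P312) => //; apply: (torus_arith3_sorted N3 N1 N2) => //; lia.
- by apply: (fin _ _ _ e3 P213) => //; apply: (torus_arith3_sorted N2 N1 N3) => //; lia.
- by apply: (fin _ _ _ e1 P231) => //; apply: (torus_arith3_sorted N2 N3 N1) => //; lia.
- by apply: (fin _ _ _ e1 P321) => //; apply: (torus_arith3_sorted N3 N2 N1) => //; lia.
- by apply: (fin _ _ _ e1 P321) => //; apply: (torus_arith3_sorted N3 N2 N1) => //; lia.
Qed.

End TorusArithmetic.

Lemma index2_exp (gT : finGroupType) (H K : {group gT}) x :
  K \subset H -> #|H : K| = 2%N -> x \in H -> x ^+ 2 \in K.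
Proof.
move=> sKH i2 xH; have nK : K <| H by exact: index2_normal.
have xN := fintype.subsetP (normal_norm nK) x xH.
rewrite coset_idr // ?groupX //.
have : coset K x ^+ #|H / K| = 1 by apply: expg_cardG; exact: mem_quotient.
by rewrite card_quotient ?normal_norm // i2 -morphX.
Qed.

(** * Groups in which every torus has several conjugates *)

Section PrimitiveClassification.
Variables (C : numClosedFieldType) (gT : finGroupType) (rho : {multiplicative gT -> GL 2 C}).
Hypothesis rho_inj : injective rho.
Implicit Types (g h x y : gT).
Local Notation G := [set: gT].
Local Notation Z := (scZ rho).
Local Notation e g := (torus_rank rho g).
Local Notation f g := (torus_weyl g).
Local Notation n g := (torus_conj g).
Local Notation U g := (torus_class rho g).
Local Notation N := #|G : Z|.

(** The last clause makes room for the tetrahedral group, whose three-fold axes are not reversed;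
    this is what makes its case special in [polyhedral_cover]. *)
Definition polyhedral_type (m : nat) : Prop :=
  [/\ [\/ N = 12%N /\ m = 3%N, N = 24%N /\ m = 4%N | N = 60%N /\ m = 5%N],
      forall g, g \notin Z -> e g \in [:: 2; 3; m],
      exists2 g, g \notin Z & e g = m,
      forall g h, g \notin Z -> h \notin Z -> e g = e h -> h \in U g &
      forall g, g \notin Z -> f g = 2%N \/ (m = 3%N /\ e g = 3%N)].

Hypothesis noncentral : exists g, g \notin Z.
Hypothesis primitive : forall g, g \notin Z -> (1 < n g)%N.

(** Collect classes of tori until they cover the non-scalar elements; the quarter bound stops this
    at three. Two classes give the tetrahedral group, three classes the other two groups. *)
Lemma polyhedral_exists : exists m, polyhedral_type m.
Proof.
have z0 : (0 < #|Z|)%N := cardG_gt0 _.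
have NE g : N = (n g * f g * e g)%N by exact: card_torus_product.
have fg g : g \notin Z -> (0 < f g <= 2)%N by exact: torus_weyl_le2.
have eg g : g \notin Z -> (1 < e g)%N by exact: torus_rank_gt1.
have cU g : g \notin Z -> #|U g| = (n g * (e g).-1 * #|Z|)%N by exact: card_torus_class.
have cT : #|~: Z| = (N.-1 * #|Z|)%N by exact: card_noncentral.
have sU g : U g \subset ~: Z by exact: torus_class_sub.
have invU := torus_class_invariants rho_inj; have idU := @torus_class_id _ _ rho.
have disjU g h : g \notin Z -> h \notin Z -> h \notin U g -> #|U g :|: U h| = (#|U g| + #|U h|)%N.
  move=> ng nh hg; apply/eqP; rewrite (leq_card_setU _ _).2.
  exact: torus_class_disjoint.
have [g1 ng1] := noncentral.
have [U1|/subsetPn[g2]] := boolP (~: Z \subset U g1).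
  have : #|U g1| = #|~: Z| by apply/eqP; rewrite eqn_leq !subset_leq_card.
  rewrite cU // cT => /eqP; rewrite eqn_pmul2r // => /eqP E.
  by case: (torus_arith1 (NE g1) (primitive ng1) (fg _ ng1) (eg _ ng1) E).
rewrite finset.in_setC => ng2 g21; have c12 := disjU _ _ ng1 ng2 g21.
have [U2|/subsetPn[g3]] := boolP (~: Z \subset U g1 :|: U g2).
  have : #|U g1 :|: U g2| = #|~: Z|.
    by apply/eqP; rewrite eqn_leq !subset_leq_card // finset.subUset !sU.
  rewrite c12 !cU // cT -mulnDl => /eqP; rewrite eqn_pmul2r // => /eqP E.
  have [N12 H] := torus_arith2 (NE g1) (NE g2) (primitive ng1) (primitive ng2)
    (fg _ ng1) (fg _ ng2) (eg _ ng1) (eg _ ng2) E.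
  have in12 g : g \notin Z -> g \in U g1 \/ g \in U g2.
    move=> ng; have := fintype.subsetP U2 g; rewrite finset.in_setC finset.in_setU.
    by move=> /(_ ng)/orP.
  have fin ga gb : ga \notin Z -> gb \notin Z ->
     (forall g, g \notin Z -> g \in U ga \/ g \in U gb) ->
     [/\ f ga = 1, e ga = 3, f gb = 2 & e gb = 2]%N -> polyhedral_type 3.
    move=> nga ngb inab [fa ea fb eb]; split.
    - by constructor 1.
    - move=> g /inab[] gU; first by have [-> _ _] := invU _ _ nga gU; rewrite ea.
      by have [-> _ _] := invU _ _ ngb gU; rewrite eb.
    - by exists ga.
    - move=> g h ng nh; have mix gi : gi \notin Z -> g \in U gi -> h \in U gi -> h \in U g.
        by move=> ngi gUi hUi; apply: (torus_class_eq rho_inj ng) hUi; exact: torus_class_sym.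
      have [gU|gU] := inab g ng; have [hU|hU] := inab h nh.
      + by move=> _; exact: mix gU hU.
      + have [-> _ _] := invU _ _ nga gU; have [-> _ _] := invU _ _ ngb hU.
        by rewrite ea eb.
      + have [-> _ _] := invU _ _ ngb gU; have [-> _ _] := invU _ _ nga hU.
        by rewrite ea eb.
      + by move=> _; exact: mix gU hU.
    - move=> g ng; case: (inab g ng) => gU.
      + by right; have [-> _ _] := invU _ _ nga gU.
      + by left; have [_ -> _] := invU _ _ ngb gU.
  case: H => H; exists 3%N; first exact: (fin g1 g2).
  by apply: (fin g2 g1) => // g /in12[]; auto.
rewrite finset.in_setC => ng3; rewrite finset.in_setU negb_or => /andP[g31 g32].
have c123 : #|U g1 :|: U g2 :|: U g3| = (#|U g1| + #|U g2| + #|U g3|)%N.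
  rewrite -c12; apply/eqP; rewrite (leq_card_setU _ _).2.
  have d1 := torus_class_disjoint rho_inj ng1 ng3 g31.
  have d2 := torus_class_disjoint rho_inj ng2 ng3 g32.
  rewrite -finset.setI_eq0 !finset.setIUl; move: d1 d2; rewrite -!finset.setI_eq0 => /eqP -> /eqP ->.
  by rewrite finset.setU0.
have [U3|/subsetPn[g4]] := boolP (~: Z \subset U g1 :|: U g2 :|: U g3); last first.
  rewrite finset.in_setC => ng4; rewrite !finset.in_setU !negb_or => /andP[/andP[g41 g42] g43].
  exfalso; have c4 : (#|U g1| + #|U g2| + #|U g3| + #|U g4| <= #|~: Z|)%N.
    have c1234 : #|U g1 :|: U g2 :|: U g3 :|: U g4| = (#|U g1| + #|U g2| + #|U g3| + #|U g4|)%N.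
      rewrite -c123; apply/eqP; rewrite (leq_card_setU _ _).2.
      have d1 := torus_class_disjoint rho_inj ng1 ng4 g41.
      have d2 := torus_class_disjoint rho_inj ng2 ng4 g42.
      have d3 := torus_class_disjoint rho_inj ng3 ng4 g43.
      rewrite -finset.setI_eq0 !finset.setIUl; move: d1 d2 d3; rewrite -!finset.setI_eq0.
      by move=> /eqP -> /eqP -> /eqP ->; rewrite !finset.setU0.
    by rewrite -c1234; apply: subset_leq_card; rewrite !finset.subUset !sU.
  move: c4; rewrite !cU // cT -!mulnDl leq_pmul2r //.
  have q1 := torus_arith_quarter (NE g1) (primitive ng1) (fg _ ng1) (eg _ ng1).
  have q2 := torus_arith_quarter (NE g2) (primitive ng2) (fg _ ng2) (eg _ ng2).
  have q3 := torus_arith_quarter (NE g3) (primitive ng3) (fg _ ng3) (eg _ ng3).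
  have q4 := torus_arith_quarter (NE g4) (primitive ng4) (fg _ ng4) (eg _ ng4).
  by rewrite (negPf (torus_arith4 (indexg_gt0 G Z) q1 q2 q3 q4)).
have : #|U g1 :|: U g2 :|: U g3| = #|~: Z|.
  by apply/eqP; rewrite eqn_leq !subset_leq_card // !finset.subUset !sU.
rewrite c123 !cU // cT -!mulnDl => /eqP; rewrite eqn_pmul2r // => /eqP E.
have [[f1 f2 f3] [m [mN pm]]] := torus_arith3 (NE g1) (NE g2) (NE g3) (primitive ng1)
  (primitive ng2) (primitive ng3) (fg _ ng1) (fg _ ng2) (fg _ ng3)
  (eg _ ng1) (eg _ ng2) (eg _ ng3) E.
have in123 g : g \notin Z -> [\/ g \in U g1, g \in U g2 | g \in U g3].
  move=> ng; have := fintype.subsetP U3 g; rewrite finset.in_setC !finset.in_setU => /(_ ng).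
  by rewrite -orbA => /or3P.
(* Rules out a second class of rank 3 when [N = 12] and f = 2. The normaliser of the torus of [ga]
   then has index 2, so it contains [gb ^+ 2], and with the scalar [gb ^+ 3] also [gb]; the torus
   has index 2 in the normaliser, and the same argument puts [gb] in it. *)
have excl ga gb : ga \notin Z -> gb \notin Z -> gb \notin U ga -> f ga = 2%N ->
    e ga = 3%N -> e gb = 3%N -> N = 12%N -> False.
  move=> nga ngb gbU fa ea eb N12; have na : n ga = 2%N.
    by apply/eqP; rewrite -(@eqn_pmul2r 6) // -[(2 * 6)%N]N12 (NE ga) fa ea -mulnA.
  have sCN : 'C[ga] \subset 'N('C[ga]) by exact: normG.
  have gb3 : gb ^+ 3 \in 'C[ga].
    apply: fintype.subsetP (scZ_sub_cent1 rho_inj ga) _ _.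
    by rewrite -eb; apply: torus_exp_rank => //; exact: cent1id.
  have gbE : gb = gb ^+ 3 * (gb ^+ 2)^-1 by rewrite expgS mulgK.
  have gbN : gb \in 'N('C[ga]).
    rewrite gbE groupM ?groupV ?(fintype.subsetP sCN _ gb3) //.
    by apply: index2_exp (finset.subsetT _) na _; rewrite finset.in_setT.
  have gbC : gb \in 'C[ga].
    by rewrite gbE groupM ?groupV //; exact: index2_exp sCN fa gbN.
  by move/negP: gbU; apply; apply/torus_classP; exists 1; rewrite // conjg1.
have e_in g : g \notin Z -> exists i : nat, (i < 3)%N /\
    [/\ e g = nth 0%N [:: e g1; e g2; e g3] i, f g = 2%N & g \in nth finset.set0 [:: U g1; U g2; U g3] i].
  move=> /in123[] gU.
  - by exists 0%N; have [-> -> _] := invU _ _ ng1 gU.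
  - by exists 1%N; have [-> -> _] := invU _ _ ng2 gU.
  - by exists 2%N; have [-> -> _] := invU _ _ ng3 gU.
have [m3|m3] := eqVneq m 3%N.
  have N12 : N = 12%N by case: mN => -[] //; lia.
  move: pm; rewrite m3 => pm.
  have mem3 (k : nat) : k \in [:: e g1; e g2; e g3] -> k = 2%N \/ k = 3%N.
    by rewrite (seq.perm_mem pm) !inE => /or3P[] /eqP; auto.
  have ex1 := excl g1 g2 ng1 ng2 g21 f1; have ex2 := excl g1 g3 ng1 ng3 g31 f1.
  have ex3 := excl g2 g3 ng2 ng3 g32 f2.
  have H1 : e g1 = 2%N \/ e g1 = 3%N by apply: mem3; rewrite !inE eqxx.
  have H2 : e g2 = 2%N \/ e g2 = 3%N by apply: mem3; rewrite !inE eqxx orbT.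
  have H3 : e g3 = 2%N \/ e g3 = 3%N by apply: mem3; rewrite !inE eqxx !orbT.
  have /seq.permP/(_ (pred1 2%N)) /= := pm.
  by case: H1 => E1; case: H2 => E2; case: H3 => E3; rewrite E1 E2 E3 //= => _; exfalso; auto.
exists m; split=> //.
- move=> g /e_in[i [i3 [-> _ _]]]; rewrite -(seq.perm_mem pm).
  by rewrite mem_nth.
- have : m \in [:: e g1; e g2; e g3] by rewrite (seq.perm_mem pm) !inE eqxx !orbT.
  by rewrite !inE => /or3P[] /eqP ->; [exists g1 | exists g2 | exists g3].
- have ue : uniq [:: e g1; e g2; e g3].
    by rewrite (perm_uniq pm); move: m3; case: mN => -[_ ->].
  move=> g h ng nh; have [i [i3 [-> _ gU]]] := e_in g ng; have [j [j3 [-> _ hU]]] := e_in h nh.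
  move=> /eqP; rewrite nth_uniq // => /eqP ij; rewrite -{}ij in hU.
  have mix gi : gi \notin Z -> g \in U gi -> h \in U gi -> h \in U g.
    by move=> ngi gUi hUi; apply: (torus_class_eq rho_inj ng) hUi; exact: torus_class_sym.
  by case: i i3 gU hU => [|[|[|//]]] _ /=; exact: mix.
- by move=> g /e_in[i [_ [_ -> _]]]; left.
Qed.

End PrimitiveClassification.

(** * Reflection groups are generalized J-groups *)

Section FromReflectionGroup.
Variable R : realType.
Local Notation C := (R[i])%C.
Variables (W : set (GL 2 C)) (p : nat) (K : 'I_p -> option nat) (k : 'I_p -> nat).
Variable phi : {multiplicative Jgroup K -> GL 2 C}.
Hypothesis W_refl : rank2_reflection_group W.
Hypothesis p0 : (0 < p)%N.
Hypothesis Kk : forall i, K i = Some (k i).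
Hypothesis k1 : forall i, (1 < k i)%N.
Hypothesis phi_inj : injective phi.
Hypothesis W_conj : forall x w, W w -> W (w ^ phi x).
Hypothesis W_gen : forall w a, W w -> refl a w ->
  exists i j x, w = (phi (Jgen K i) ^+ j) ^ phi x.

Let Wg : is_subgroup W. Proof. by case: W_refl. Qed.

Lemma min_exponent i : exists m, [/\ (0 < m)%N, W (phi (Jgen K i) ^+ m) &
  forall j, W (phi (Jgen K i) ^+ j) -> (m %| j)%N].
Proof.
have ex : exists j, `[< (0 < j)%N /\ W (phi (Jgen K i) ^+ j) >].
  exists (k i); apply/asboolP; split; first exact: ltnW.
  by rewrite -multX Jgen_exp // mult1; exact: subgroup1.
case: (ex_minnP ex) => m /asboolP[m0 Wm] m_min; exists m; split=> // j Wj.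
rewrite /dvdn; apply/negPn; rewrite -lt0n; apply/negP => jm.
have : W (phi (Jgen K i) ^+ (j %% m)).
  have -> : phi (Jgen K i) ^+ (j %% m) =
      (phi (Jgen K i) ^+ m ^+ (j %/ m))^-1 * phi (Jgen K i) ^+ j.
    by rewrite {3}(divn_eq j m) expgnDr mulnC expgnA mulKg.
  by apply: subgroupM => //; apply: subgroupV => //; exact: subgroupX.
move=> Wjm; have /m_min : `[< (0 < j %% m)%N /\ W (phi (Jgen K i) ^+ (j %% m)) >].
  by apply/asboolP.
by rewrite leqNgt ltn_mod m0.
Qed.

Lemma reflection_group_is_J (G : groupType) : isomorphic_to G W ->
  isomorphic_to_finite_generalized_J G.
Proof.
move=> isoG; have /choice[K' K'P] := min_exponent.
have [_ finW [S S_refl WS]] := W_refl.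
have WE : W = (phi @` generalized_J K K')%classic.
  have Mg := generalized_J_subgroup K K'.
  apply/seteqP; split; last first.
    move=> _ [x xM <-]; move: x xM.
    apply: (@generalized_J_min _ _ _ [set x | W (phi x)]%classic) => [|i]; last first.
      by rewrite /= multX; case: (K'P i).
    split; first split; rewrite /= ?mult1; first exact: subgroup1.
      by move=> x y; rewrite /= gmulfM multV; exact: Wg.2.
    by move=> x y; rewrite /= multJ; exact: W_conj.
  rewrite [X in (X `<=` _)%classic]WS; apply: generated_min.
    split; first by exists 1; [exact: subgroup1 | exact: mult1].
    move=> _ _ [x xM <-] [y yM <-]; exists (x * y^-1); last by rewrite gmulfM multV.
    exact: Mg.2.
  move=> w Sw; have Ww : W w by rewrite WS; exact: sub_generated.
  have /complex_reflectionP[a [n [n0 an rw]]] := S_refl _ Sw.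
  have [i [j [x wE]]] := W_gen Ww rw; have [m0 Wm mP] := K'P i.
  have /mP/dvdnP[q jE] : W (phi (Jgen K i) ^+ j).
    by have := W_conj x^-1 Ww; rewrite wE multV conjgK.
  exists (Jgen K i ^+ j ^ x); last by rewrite wE multJ multX.
  apply: generalized_J_conj; rewrite jE mulnC expgnA; apply: (subgroupX q Mg).
  exact: generalized_J_gen.
exists p, K, K'; split.
- split=> // i; have [m0 Wm mP] := K'P i; split=> // n; rewrite Kk => -[<-].
  split; first exact: k1.
  by apply: mP; rewrite -multX Jgen_exp // mult1; exact: subgroup1.
- apply: (@sub_finite_set _ _ (phi @^-1` W)%classic).
    by move=> x xM; rewrite /= WE; exists x.
  by apply: finite_preimage finW => x y _ _; exact: phi_inj.
- by apply/(@isomorphic_to_image G _ _ (generalized_J K K') phi phi_inj); rewrite -WE.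
Qed.

End FromReflectionGroup.

Lemma finite_subgroup_exponent (H : groupType) (W : set H) : is_subgroup W -> finite_set W ->
  exists2 E, (0 < E)%N & forall w, W w -> w ^+ E = 1.
Proof.
move=> Wg finW; have /choice[n nP] : forall w, exists n, (0 < n)%N /\ (W w -> w ^+ n = 1).
  move=> w; have [Ww|nW] := pselect (W w); last by exists 1%N.
  have [i [j [ij wij]]] := finite_set_collision finW (fun n => subgroupX n Wg Ww).
  exists (j - i)%N; split=> [|_]; first by rewrite subn_gt0.
  by apply: (mulIg (w ^+ i)); rewrite -expgnDr subnK 1?ltnW // mul1g.
have /finite_seqP[s sE] := finW; exists (\prod_(w <- s) n w)%N.
  by rewrite prodn_gt0 // => w; exact: (nP w).1.
move=> w Ww; have ws : w \in s by move: Ww; rewrite sE.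
by rewrite (big_rem w ws) /= expgnA (nP w).2 // expg1n.
Qed.

Lemma conj_morphism (X H : groupType) (phi : {multiplicative X -> H}) (Q : H) :
  exists psi : {multiplicative X -> H}, forall x, psi x = phi x ^ Q.
Proof.
pose psi x := phi x ^ Q.
have psiM : {morph psi : x y / x * y} by move=> x y; rewrite /psi gmulfM conjMg.
pose HBpsi := isMultiplicative.Build _ _ psi psiM.
by exists (HB.pack psi HBpsi : {multiplicative X -> H}).
Qed.

Section TorusReflections.
Variable C : fieldType.

Lemma rf_compl (a : C) P : is_proj P -> (a != 0)%R ->
  rf a (1%:M - P)%R = scal a * (rf a P)^-1.
Proof.
move=> pP a0; apply: (mulIg (rf a P)); rewrite mulgVK; apply: val_inj.
rewrite [RHS]scalE // -[LHS]/(rf a (1%:M - P)%R *m rf a P)%R !rfE //; last exact: proj_compl.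
rewrite mulmxDl mul1mx -scalemxAl mulmxBl mul1mx mulmxDr mulmx1 -scalemxAr (proj_idem pP).
by apply: mx2P; rewrite !mxE /=; ring.
Qed.

(** The eigenvalues are [c * a] and [c], and trace and determinant of a reflection say that one of
    them is 1. *)
Lemma refl_torus (c a b : C) P : is_proj P -> (c != 0)%R -> (a != 0)%R ->
  refl b (scal c * rf a P) ->
  scal c * rf a P = rf b P \/ scal c * rf a P = rf b (1%:M - P)%R.
Proof.
move=> pP c0 a0 [trE detE b1].
rewrite scal_mulE // mxtraceZ rfE // mxtraceD mxtraceZ mxtrace1 pP.1 in trE.
rewrite GL_detM scalE // det_scalar rfE // det_rf // in detE.
have : ((1 - c) * (1 - c * a) = 0)%R.
  have -> : ((1 - c) * (1 - c * a) = 1 - c * (2%:R + (a - 1) * 1) + c ^+ 2 * a)%R by ring.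
  by rewrite trE detE; ring.
move/eqP; rewrite mulf_eq0 !subr_eq0 => /orP[] /eqP cE.
  by left; rewrite -cE scal1 mul1g -detE -cE expr1n mul1r.
right; have bE : b = c by rewrite -detE expr2 -mulrA -cE mulr1.
rewrite rf_compl // ?bE //; congr (_ * _).
apply: (mulgI (rf c P)); rewrite mulgV rfM // -cE; exact: rf1.
Qed.

End TorusReflections.

Section AbelianReflectionGroup.
Variable R : realType.
Local Notation C := (R[i])%C.

Lemma unity_primitive n : (0 < n)%N -> (n.-primitive_root (unity R n))%R.
Proof.
move=> n0; have [m mP mn] := prim_order_exists n0 (unity_exp R n0).
suff nm : n = m by rewrite {1}nm.
apply/eqP; rewrite eqn_dvd mn andbT; apply: unity_order => //.
exact: prim_expr_order mP.
Qed.

Lemma unity_power n (a : C) : (0 < n)%N -> (a ^+ n = 1)%R -> exists j, (a = unity R n ^+ j)%R.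
Proof.
by move=> n0 an; have [j ->] := prim_rootP (unity_primitive n0) an; exists j.
Qed.

Lemma dg_compl (a : C) : (a != 0)%R -> dg 1%R a = scal a * (dg a 1%R)^-1.
Proof.
move=> a0; have u1 : (1 != 0 :> C)%R := oner_neq0 _.
apply: (mulIg (dg a 1%R)); rewrite mulgVK (dgM u1 a0 a0 u1) mul1r mulr1.
apply: val_inj; rewrite [LHS](dgE a0 a0) [RHS](scalE a0).
by apply: mx2P; rewrite mk2E !mxE.
Qed.

(** Both [W] and the image of J(E, E) lie in the torus of [P], so conjugation is trivial, and each
    reflection of [W] is a power of one of the two generators. *)
Lemma abelian_reflection_group (W : set (GL 2 C)) (P : 'M[C]_2) (G : groupType) :
  rank2_reflection_group W -> is_proj P -> (forall w, W w -> w *m P = P *m w)%R ->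
  isomorphic_to G W -> isomorphic_to_finite_generalized_J G.
Proof.
move=> W_refl pP WP isoG; have [Wg finW _] := W_refl.
have [E' E'0 E'P] := finite_subgroup_exponent Wg finW.
(* Doubling the exponent makes [E] at least 2, as required of the entries of [K], even for the
   trivial group. *)
pose E := (2 * E')%N; have E1 : (1 < E)%N by rewrite /E; lia.
have E0 := ltnW E1; pose K (i : 'I_2) : option nat := Some E.
have [phi [phi_inj phi0 phi1]] := abelian_rep R E1 E1 (erefl : K o20 = Some E) (erefl : K o21 = Some E).
have u_power b := @unity_power E b E0; have u0 := unity_neq0 R E.
have u1 : (unity R E != 1)%R by exact: unity_neq1.
move: (unity R E) u_power u0 u1 phi0 phi1 => u u_power u0 u1 phi0 phi1.
have ruP := refl_rf pP u0 u1; have rud := dg_refl1 u0 u1.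
have [t1 d1 _] := ruP; have [t2 d2 _] := rud.
have [Q QE] : exists Q, dg u 1%R ^ Q = rf u P.
  by apply: nonscalar_conj (refl_nonscalar rud) (refl_nonscalar ruP) _ _;
    [exact: etrans t2 (esym t1) | exact: etrans d2 (esym d1)].
have QE' : dg 1%R u ^ Q = rf u (1%:M - P)%R.
  rewrite (rf_compl pP u0) -QE (dg_compl u0) conjMg scalJ conjVg; reflexivity.
have [Psi PsiE] := conj_morphism phi Q.
have Psi0 : Psi (Jgen K o20) = rf u P by exact: etrans (PsiE _) (etrans (congr1 (conjg^~ Q) phi0) QE).
have Psi1 : Psi (Jgen K o21) = rf u (1%:M - P)%R by exact: etrans (PsiE _) (etrans (congr1 (conjg^~ Q) phi1) QE').
have Psi_inj : injective Psi by move=> x y; rewrite !PsiE => /conjg_inj/phi_inj.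
have WrfC w : W w -> commute w (rf u P) by move=> /WP; exact: (rf_commute w pP u0 u1).2.
have ns := rf_nonscalar pP u0 u1.
apply: (@reflection_group_is_J _ W 2 K (fun=> E) Psi W_refl) isoG => //.
- move=> x w Ww; suff cxw : commute w (Psi x) by rewrite /conjg cxw mulKg.
  apply: (commute_nonscalar ns); first exact/commute_sym/WrfC.
  have [m [n ->]] := Jgroup2_abelian E0 E0 (erefl : K o20 = Some E) (erefl : K o21 = Some E) x.
  rewrite gmulfM !multX Psi0 Psi1 rf_compl //; apply: commuteM; first exact/commuteX/commute_refl.
  apply: commuteX; apply: commuteM; first exact/commute_sym/scal_central.
  exact/commuteV/commute_refl.
- move=> w b Ww rw; have bE : (b ^+ E = 1)%R.
    apply: (refl_exp_scalar rw); rewrite expgnA expgnAC E'P // expg1n.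
    by rewrite -(scal1 C) scal_in // oner_neq0.
  have [j bj] := u_power b bE.
  have [c [a [c0 a0 wE]]] := proj_commute pP (WP w Ww).
  have pP' := proj_compl pP.
  rewrite wE in rw; have [wb|wb] := refl_torus pP c0 a0 rw.
    exists o20, j, 1; rewrite mult1 conjg1 wE wb bj.
    exact: esym (etrans (congr1 (expgn^~ j) Psi0) (rfX j pP u0)).
  exists o21, j, 1; rewrite mult1 conjg1 wE wb bj.
  exact: esym (etrans (congr1 (expgn^~ j) Psi1) (rfX j pP' u0)).
Qed.

End AbelianReflectionGroup.

(** * Covers of a group by some J(a, b, c), up to scalars *)

Section SphericalCover.
Variables (C : numClosedFieldType) (gT : finGroupType) (rho : {multiplicative gT -> GL 2 C}).
Hypothesis rho_inj : injective rho.
Implicit Types (g h : gT) (A B : GL 2 C).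
Local Notation Z := (scZ rho).
Local Notation e g := (torus_rank rho g).

(** The group C^* W. A cover only has to land in it: scalars do not affect conjugation, so the cover
    normalises W. *)
Definition scaled_image A := exists c g, (c != 0)%R /\ A = scal c * rho g.

Lemma scaled_scal (c : C) : (c != 0)%R -> scaled_image (scal c).
Proof. by move=> c0; exists c, 1; rewrite mult1 mulg1. Qed.

Lemma scaled_imageM A B : scaled_image A -> scaled_image B -> scaled_image (A * B).
Proof.
move=> [c [g [c0 ->]]] [d [h [d0 ->]]]; exists (c * d)%R, (g * h).
rewrite mulf_neq0 // -scalM // gmulfM !mulgA; split=> //; congr (_ * _).
by rewrite -!mulgA (scal_central d (rho g)).
Qed.

Lemma scaled_imageV A : scaled_image A -> scaled_image A^-1.
Proof.
move=> [c [g [c0 ->]]]; exists c^-1%R, g^-1; rewrite invr_neq0 //; split=> //.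
by rewrite invgM multV scalV // (scal_central _ (rho g)^-1).
Qed.

Lemma scaled_image_J K (phi : {multiplicative @Jgroup 3 K -> GL 2 C}) :
  (forall i, scaled_image (phi (Jgen K i))) -> forall x, scaled_image (phi x).
Proof.
move=> gen; apply: Jgroup_ind => [|i x IHx|i x IHx].
- by rewrite mult1 -scal1; apply: scaled_scal; exact: oner_neq0.
- by rewrite gmulfM; exact: scaled_imageM.
- by rewrite gmulfM multV; apply: scaled_imageM => //; exact: scaled_imageV.
Qed.

Lemma scaled_torus g P a : g \notin Z -> torus_proj rho g P -> (a ^+ e g = 1)%R ->
  scaled_image (rf a P).
Proof.
move=> ng tP ae; have [h [c [_ c0 hE]]] := torus_form_all rho_inj ng tP ae.
exists c^-1%R, h; rewrite invr_neq0 // hE mulgA -scalV // mulVg mul1g.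
by [].
Qed.

Definition spherical_cover := exists (K : 'I_3 -> option nat) (k : 'I_3 -> nat)
    (phi : {multiplicative Jgroup K -> GL 2 C}),
  [/\ forall i, K i = Some (k i) /\ (1 < k i)%N, injective phi,
      forall x, scaled_image (phi x) &
      forall g a, refl a (rho g) ->
        exists i j x, rho g = (phi (Jgen K i) ^+ j) ^ phi x].

Lemma refl_torus_rank g h a : g \notin Z -> h \in 'C[g] -> refl a (rho h) -> (a ^+ e g = 1)%R.
Proof.
move=> ng hC rh; apply: (refl_exp_scalar rh).
by rewrite -multX -scZP; exact: torus_exp_rank.
Qed.

Lemma torus_refl g h a P : g \notin Z -> h \in 'C[g] -> torus_proj rho g P -> refl a (rho h) ->
  rho h = rf a P \/ rho h = rf a (1%:M - P)%R.
Proof.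
move=> ng hC tP rh; have [c [b [c0 b0 hE]]] := torus_form rho_inj tP hC.
rewrite hE in rh *; exact: refl_torus tP.1 c0 b0 rh.
Qed.

End SphericalCover.

Section Monomial.
Variables (C : numClosedFieldType) (gT : finGroupType) (rho : {multiplicative gT -> GL 2 C}).
Hypothesis rho_inj : injective rho.
Hypothesis roots : forall n, (0 < n)%N -> exists l : C, (n.-primitive_root l)%R.
Implicit Types (g h : gT).
Local Notation Z := (scZ rho).
Local Notation e g := (torus_rank rho g).

Lemma swap_trace (P : 'M[C]_2) (A : GL 2 C) : is_proj P -> conj_proj P A = (1%:M - P)%R ->
  (\tr (A *m P) = 0 /\ \tr A = 0)%R.
Proof.
move=> pP AP; have A1 : (A *m A^-1%g)%R = 1%:M%R by rewrite -[LHS]/(GLmx (A * A^-1)) mulgV.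
have PA : (P *m A = A *m (1%:M - P))%R by rewrite -AP /conj_proj !mulmxA A1 mul1mx.
have PP : (P *m (1%:M - P) = 0)%R by rewrite mulmxBr mulmx1 (proj_idem pP) subrr.
have tPA : (\tr (P *m A) = 0)%R.
  by rewrite -{1}(proj_idem pP) -mulmxA mxtrace_mulC PA -mulmxA mulmxBl mul1mx (proj_idem pP) subrr mulmx0 raddf0.
split; first by rewrite mxtrace_mulC.
have -> : (GLmx A = A *m P + A *m (1%:M - P))%R by rewrite -mulmxDr subrKC mulmx1.
by rewrite mxtraceD -PA tPA mxtrace_mulC tPA addr0.
Qed.

(** Exchanging two eigenlines forces trace zero, so rescaling the determinant to -1 gives the
    eigenvalues 1 and -1. *)
Lemma swap_reflection (P : 'M[C]_2) (A : GL 2 C) : is_proj P -> conj_proj P A = (1%:M - P)%R ->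
  exists c, (c != 0)%R /\ refl (-1)%R (scal c * A).
Proof.
move=> pP AP; have [_ trA] := swap_trace pP AP.
have d0 := GL_det_neq0 A; pose c := (sqrtC (- \det A))^-1%R.
have cc : (c ^+ 2 * \det A = -1)%R.
  by rewrite /c exprVn sqrtCK invrN mulNr mulVf.
have c0 : (c != 0)%R by rewrite invr_eq0 sqrtC_eq0 oppr_eq0.
exists c; split=> //; split; last by rewrite -subr_eq0 -opprD oppr_eq0 -(natrD C 1 1) pnatr_eq0.
  by rewrite scal_mulE // mxtraceZ trA mulr0 subrr.
by rewrite GL_detM scalE // det_scalar cc.
Qed.

(** The cover is J(2, 2, e). On the torus the reflections are powers of [u] or of its conjugate by
    [s], which exchanges the eigenlines. Off the torus they have order 2 and the form
    [f * s * u ^+ j] with [f ^+ 2 * z ^+ j = 1], and are conjugate to [s] or [t] by powers of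
    [u]. *)
Lemma monomial_cover g : g \notin Z -> torus_conj g = 1%N -> 'C[g] != [set: gT] ->
  spherical_cover rho.
Proof.
move=> ng cg1 CG; have [P tP] := torus_projP ng; have [pP _] := tP.
have NG x : x \in 'N('C[g]).
  have /eqP : torus_conj g = 1%N by []. rewrite indexg_eq1 => /fintype.subsetP; apply.
  exact: finset.in_setT.
have swapP x : conj_proj P (rho x) = (if x \in 'C[g] then P else 1%:M - P)%R.
  exact: torus_norm_proj.
have /subsetPn[n _ nC] : ~~ ([set: gT] \subset 'C[g]).
  by apply: contra CG => GC; rewrite finset.eqEsubset finset.subsetT.
have nP : conj_proj P (rho n) = (1%:M - P)%R by rewrite swapP (negPf nC).
have [c [c0 rs]] := swap_reflection pP nP; have [s sE] : exists s, s = scal c * rho n by eexists.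
rewrite -sE in rs.
have sP : conj_proj P s = (1%:M - P)%R by rewrite sE conj_proj_scal.
have [trsP trs] := swap_trace pP sP.
have ss : s * s = 1.
  by have := refl_exp_eq1 (n := 2) rs; rewrite expr2 mulrNN mulr1 => /(_ erefl).
have e1 := torus_rank_gt1 ng; set E := e g in e1 *; have E0 := ltnW e1.
(* With [z = l ^+ 2] the determinants allow [s * t * u = scal l], and the order [2 * E] of [l] is
   the index in the dihedral coset bound. *)
have [l lP] : exists l : C, ((2 * E).-primitive_root l)%R by apply: roots; lia.
have l0 : (l != 0)%R.
  apply/eqP => l0; have := prim_expr_order lP; rewrite l0 expr0n muln_eq0 (gtn_eqF E0) => /eqP.
  by rewrite eq_sym oner_eq0.
pose z := (l ^+ 2)%R; have z0 : (z != 0)%R by rewrite expf_neq0.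
have zE k : (z ^+ k == 1)%R = (E %| k)%N.
  by rewrite -exprM -(prim_order_dvd lP) dvdn_pmul2l.
have zP : (E.-primitive_root z)%R.
  by have := exp_prim_root lP 2; rewrite gcdnMr mulKn.
have z1 : (z != 1)%R by rewrite -(expr1 z) zE dvdn1 gtn_eqF.
have zE1 : (z ^+ E = 1)%R by apply/eqP; rewrite zE.
pose u := rf z P; have ru : refl z u := refl_rf pP z0 z1.
pose t := scal l * (s * u^-1).
have n1 : (-1 != 1 :> C)%R by case: rs.
have uV : u^-1 = rf z^-1%R P.
  by apply: mulg1_eq; rewrite rfM ?invr_neq0 // divff // rf1.
have [_ dets _] := rs.
have rt : refl (-1)%R t.
  split=> //; last first.
    rewrite /t !GL_detM scalE // det_scalar uV rfE ?invr_neq0 // det_rf //.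
    by rewrite dets mulN1r mulrN -/z divff.
  rewrite scal_mulE // mxtraceZ -[GLmx (s * _)]/(s *m GLmx u^-1%g)%R uV rfE ?invr_neq0 //.
  by rewrite mulmxDr mulmx1 -scalemxAr mxtraceD mxtraceZ trs trsP mulr0 addr0 mulr0 subrr.
have stu : s * t * u = scal l.
  by rewrite /t (mulgA s) -(scal_central l s) -!mulgA mulVg mulg1 ss mulg1.
pose k (i : 'I_3) := if i == o32 then E else 2%N; pose K i := Some (k i).
have n2 : ((-1) ^+ 2 = 1 :> C)%R by rewrite expr2 mulrNN mulr1.
have [phi [ps pt pu]] := GL_triple_lift (erefl : K o30 = Some 2%N) (erefl : K o31 = Some 2%N)
  (erefl : K o32 = Some E) rs rt ru n2 n2 zE1 stu.
have n2P j : ((-1) ^+ j = 1 :> C)%R -> (2 %| j)%N.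
  by rewrite -signr_odd dvdn2; case: (odd j) => //= /eqP; rewrite expr1 (negPf n1).
have phi_inj : injective phi.
  have [] // := @J3_faithful _ K 2 2 E (2 * E) phi (-1)%R (-1)%R z l; rewrite ?ps ?pt ?pu //.
  - by rewrite muln_gt0.
  - exact: coset_bound_dihedral.
  - by move=> j /eqP; rewrite zE.
  - by move=> j lj; rewrite (prim_order_dvd lP) lj.
  - by rewrite !gmulfM ps pt pu.
have scu : scaled_image rho u by exact: scaled_torus tP zE1.
have scs : scaled_image rho s by rewrite sE; exists c, n.
exists K, k, phi; split=> //.
- by move=> i; split=> //; rewrite /k; case: ifP.
- apply: scaled_image_J => i; case: (ord3_cases i) => ->; rewrite ?ps ?pt ?pu //.
  by do 2?apply: scaled_imageM => //; [exact: scaled_scal | exact: scaled_imageV].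
move=> h a rh; have [hC|hC] := boolP (h \in 'C[g]).
  have ae := refl_torus_rank rho_inj ng hC rh.
  have [j aE] := prim_rootP zP ae; exists o32, j.
  have [hE|hE] := torus_refl rho_inj ng hC tP rh.
    by exists 1; rewrite mult1 conjg1 pu rfX // -aE.
  have a0 := refl_neq0 rh.
  by exists (Jgen K o30); rewrite pu ps rfX // -aE rfJ // sP.
have nhC : n * h \in 'C[g].
  apply/(torus_proj_cent rho_inj _ tP)/conj_proj_fix.
  by rewrite gmulfM conj_projM nP conj_proj_compl swapP (negPf hC) subKr.
have [d [b [d0 b0 nhE]]] := torus_form rho_inj tP nhC.
have be := torus_form_exp rho_inj ng tP nhC d0 b0 nhE.
have [j bE] := prim_rootP zP be.
have hE0 : rho h = scal (c * d)%R * (s * u ^+ j).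
  have -> : rho h = (rho n)^-1 * rho (n * h) by rewrite gmulfM mulKg.
  have -> : (rho n)^-1 = scal c * s.
    by apply: mulg1_eq; rewrite mulgA -(scal_central c) -sE ss.
  rewrite nhE bE /u rfX // -scalM // -!mulgA; congr (_ * _).
  by rewrite !mulgA (scal_central d).
set f := (c * d)%R in hE0; have f0 : (f != 0)%R by rewrite mulf_neq0.
have zj0 : (z ^+ j != 0)%R by rewrite expf_neq0.
have [trh deth _] := rh; rewrite hE0 /u rfX // in trh deth.
have a1 : a = (-1)%R.
  rewrite scal_mulE // mxtraceZ -[GLmx (s * _)]/(s *m GLmx (rf _ P))%R rfE // in trh.
  rewrite mulmxDr mulmx1 -scalemxAr mxtraceD mxtraceZ trs trsP mulr0 addr0 mulr0 in trh.
  by apply/eqP; rewrite -subr_eq0 opprK addrC -trh.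
have fz : (f ^+ 2 * z ^+ j = 1)%R.
  rewrite !GL_detM scalE // det_scalar rfE // det_rf // a1 in deth.
  by rewrite dets mulN1r mulrN in deth; apply: oppr_inj.
have fN : (f ^+ (2 * E) = 1)%R.
  have := congr1 (fun x => x ^+ E)%R fz.
  by rewrite exprMn -(exprM f) (exprAC z) zE1 !expr1n mulr1.
have [m fE] := prim_rootP lP fN.
have ujm : u ^+ j = (u ^+ m)^-1.
  apply/esym/mulg1_eq; rewrite -expgnDr; apply: (refl_exp_eq1 ru).
  by rewrite exprD -fz fE /z -!exprM mulnC.
have conj_s q : s ^ (u ^- q) = scal (l ^+ (2 * q))%R * (s * u ^- (2 * q)).
  have uq : (u ^+ q) ^ s = scal (z ^+ q)%R * u ^- q.
    by rewrite /u rfX // rfJ ?expf_neq0 // sP rf_compl // expf_neq0.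
  rewrite conjgE invgK mulgA; have -> : u ^+ q * s = s * (u ^+ q) ^ s by rewrite /conjg mulVKg.
  rewrite uq exprM -/z !mulgA (scal_central _ s) -!mulgA; congr (_ * (_ * _)).
  by rewrite -invgM -expgnDr addnn mul2n.
have conj_t q : t ^ (u ^- q) = scal (l ^+ (2 * q).+1)%R * (s * u ^- (2 * q).+1).
  have uq : u ^ (u ^- q) = u by rewrite /conjg (commuteV (commuteX q (commute_refl u))) mulKg.
  rewrite /t !conjMg scalJ conj_s conjVg uq exprS -scalM ?expf_neq0 // expgS invgM.
  by rewrite !mulgA.
(* The reflection is [l ^ m * s * u ^ -m]: a conjugate of [s] for even [m], of [t] for odd [m]. *)
rewrite hE0 ujm fE -(odd_double_half m) -mul2n addnC; case: (odd m); rewrite /= ?addn1 ?addn0.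
  by exists o31, 1%N, (Jgen K o32 ^- m./2); rewrite expg1 pt multV multX pu conj_t.
by exists o30, 1%N, (Jgen K o32 ^- m./2); rewrite expg1 ps multV multX pu conj_s.
Qed.

End Monomial.

(** * Traces of products of two rotations *)

Section TraceDichotomy.
Variable C : numClosedFieldType.
Local Open Scope ring_scope.
Implicit Types (t z w y : C).

(** Up to sign, [t] is the trace after rescaling to determinant 1 of a matrix with eigenvalue ratio
    [y]: its square is tr^2 / det = (1 + y)^2 / y. *)
Definition rotation_trace m t := exists n y,
  [/\ n \in [:: 2; 3; m]%N, y ^+ n = 1, y != 1 & t ^+ 2 * y = (1 + y) ^+ 2].

Lemma root1_neq0 n y : (0 < n)%N -> y ^+ n = 1 -> y != 0.
Proof. by move=> n0 yn; apply/eqP => y0; move/eqP: yn; rewrite y0 expr0n gtn_eqF // eq_sym oner_eq0. Qed.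

Lemma geometric_sum0 n y : y ^+ n = 1 -> y != 1 -> \sum_(i < n) y ^+ i = 0.
Proof.
move=> yn y1; have := subrX1 y n; rewrite yn subrr => /esym/eqP.
by rewrite mulf_eq0 subr_eq0 (negPf y1) => /eqP.
Qed.

Lemma rotation_trace2 t y : y ^+ 2 = 1 -> y != 1 -> t ^+ 2 * y = (1 + y) ^+ 2 -> t = 0.
Proof.
move=> yn y1; have := geometric_sum0 yn y1; rewrite !big_ord_recl big_ord0 /= => E.
have yE : y = -1 by apply: (lin_comb E); ring.
by rewrite yE subrr expr0n /= mulrN1 => /eqP; rewrite oppr_eq0 expf_eq0 => /eqP.
Qed.

Lemma rotation_trace3 t y : y ^+ 3 = 1 -> y != 1 -> t ^+ 2 * y = (1 + y) ^+ 2 -> t ^+ 2 = 1.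
Proof.
move=> yn y1; have y0 := root1_neq0 (isT : 0 < 3)%N yn.
have := geometric_sum0 yn y1; rewrite !big_ord_recl big_ord0 /= => E tE.
by apply: (mulIf y0); rewrite tE; apply: (lin_comb E); ring.
Qed.

Lemma rotation_trace4 t y : y ^+ 4 = 1 -> y != 1 -> t ^+ 2 * y = (1 + y) ^+ 2 ->
  t = 0 \/ t ^+ 2 = 2%:R.
Proof.
move=> yn y1 tE; have y0 := root1_neq0 (isT : 0 < 4)%N yn.
have [y2|y2] := eqVneq (y ^+ 2) 1; first by left; exact: rotation_trace2 y2 y1 tE.
right; have yE : y ^+ 2 = -1.
  apply/eqP; rewrite -subr_eq0 opprK; apply: contraT => yE.
  have : (y ^+ 2 - 1) * (y ^+ 2 + 1) = 0.
    have -> : (y ^+ 2 - 1) * (y ^+ 2 + 1) = y ^+ 4 - 1 by ring.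
    by rewrite yn subrr.
  by move/eqP; rewrite mulf_eq0 subr_eq0 (negPf y2) (negPf yE).
by apply: (mulIf y0); rewrite tE; apply: (lin_comb yE); ring.
Qed.

Lemma golden z : z ^+ 5 = 1 -> z != 1 -> (z + z^-1) ^+ 2 + (z + z^-1) = 1.
Proof.
move=> zn z1; have z0 := root1_neq0 (isT : 0 < 5)%N zn.
have := geometric_sum0 zn z1; rewrite !big_ord_recl big_ord0 /= => E.
apply: (mulfI (expf_neq0 2 z0)); apply: (lin_comb E).
by rewrite /bump /=; field.
Qed.

(** The possible values of [y + y^-1] are [w] and [-1 - w], and [t ^+ 2] is [y + y^-1 + 2]. *)
Lemma rotation_trace5 t y w : w ^+ 2 + w = 1 -> y ^+ 5 = 1 -> y != 1 ->
  t ^+ 2 * y = (1 + y) ^+ 2 -> t ^+ 2 = (1 + w) ^+ 2 \/ t ^+ 2 = w ^+ 2.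
Proof.
move=> wE yn y1 tE; have y0 := root1_neq0 (isT : 0 < 5)%N yn.
have gE := golden yn y1; set v := y + y^-1 in gE.
have tv : t ^+ 2 = v + 2%:R.
  by apply: (mulIf y0); rewrite tE /v; field.
have : (v - w) * (v + w + 1) = 0.
  have -> : (v - w) * (v + w + 1) = v ^+ 2 + v - (w ^+ 2 + w) by ring.
  by rewrite gE wE subrr.
move/eqP; rewrite mulf_eq0 => /orP[] /eqP vw; [left|right]; rewrite tv.
  by have {}vw : v = w := subr0_eq vw; rewrite vw; apply: (lin_comb (esym wE)); ring.
have {}vw : v = - w - 1 by apply: (lin_comb vw); ring.
by rewrite vw; apply: (lin_comb (esym wE)); ring.
Qed.

Definition golden_val w (x : int * int) : C := x.1%:~R + x.2%:~R * w.

(** The integer is the norm (a + b w)(a - b - b w) of a + b w; it turns equations in [w] into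
    decidable conditions on integers. *)
Lemma golden_val0 w (a b : int) : w ^+ 2 + w = 1 -> golden_val w (a, b) = 0 ->
  a * a - a * b - b * b == 0.
Proof.
rewrite /golden_val /= => wE E; rewrite -(intr_eq0 C) !rmorphB !rmorphM /=.
set A := a%:~R in E *; set B := b%:~R in E *.
have AE : A = - (B * w) by apply: (lin_comb E); ring.
by apply/eqP; rewrite AE; apply: (lin_comb (congr1 (fun x => B ^+ 2 * x) wE)); ring.
Qed.

(** The coordinates of 0, 1, 1 + w, w and their opposites, the rescaled traces that occur for
    [m = 5]. *)
Definition golden_seq : seq (int * int) :=
  [:: (0, 0); (1, 0); (-1, 0); (1, 1); (-1, -1); (0, 1); (0, -1)].

Lemma golden_sum w (x y : int * int) : w ^+ 2 + w = 1 -> x \in golden_seq -> y \in golden_seq ->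
  golden_val w x + golden_val w y = 2%:R + w -> golden_val w x = 1 \/ golden_val w y = 1.
Proof.
move=> wE xs ys E.
have tab : all (fun x => all (fun y : int * int =>
   let a := x.1 + y.1 - 2 in let b := x.2 + y.2 - 1 in
   (a * a - a * b - b * b == 0) ==> ((x == (1, 0)) || (y == (1, 0)))) golden_seq) golden_seq.
  by vm_compute.
have /allP/(_ y ys) /= := allP tab x xs.
rewrite (@golden_val0 w) //; last first.
  by rewrite /golden_val /= !intrD !rmorphN /=; apply: (lin_comb E); rewrite /golden_val; ring.
by move=> /orP[] /eqP ->; rewrite /golden_val /= mul0r addr0; [left|right].
Qed.

Lemma sqr_cases t w (x : int * int) : t ^+ 2 = golden_val w x ^+ 2 ->
  x \in golden_seq -> exists2 x', x' \in golden_seq & t = golden_val w x'.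
Proof.
move=> /eqP; rewrite eqf_sqr => /orP[] /eqP -> xs; first by exists x.
exists (- x.1, - x.2); last by rewrite /golden_val /= !rmorphN /=; ring.
by move: xs; rewrite !inE => /or4P[|||/or4P[]] /eqP ->.
Qed.

(** For [m] = 3, 4, 5 the prescribed sum is 1, 2, 2 + w. The traces are 0, 1, -1, for [m = 4] also
    the square roots of 2, for [m = 5] also w, 1 + w and their opposites; inspection leaves only 0 +
    1, 1 + 1 and 1 + (1 + w). *)
Lemma rotation_trace_sum m z t t' : m \in [:: 3; 4; 5]%N -> (m.-primitive_root z) ->
  rotation_trace m t -> rotation_trace m t' -> t + t' = 2%:R + (z + z^-1) ->
  t = 1 \/ t' = 1.
Proof.
move=> mE zP; have zm := prim_expr_order zP.
have z1 : z != 1.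
  by rewrite -(expr1 z) -(prim_order_dvd zP) dvdn1; move: mE; rewrite !inE => /or3P[] /eqP ->.
have natC k : (k.+1%:R : C) = 0 -> False by move/eqP; rewrite pnatr_eq0.
move: mE; rewrite !inE => /or3P[] /eqP mE; rewrite {}mE in zP zm *.
- have z0 := root1_neq0 (isT : 0 < 3)%N zm.
  have -> : z + z^-1 = -1.
    have := geometric_sum0 zm z1; rewrite !big_ord_recl big_ord0 /= => E.
    by apply: (mulIf z0); apply: (lin_comb E); rewrite /bump /=; field.
  have cases u : rotation_trace 3 u -> [\/ u = 0, u = 1 | u = -1].
    move=> [n [y [ns yn y1 uE]]]; move: ns; rewrite !inE orbb => /orP[] /eqP nE; rewrite nE in yn.
      by constructor 1; exact: rotation_trace2 yn y1 uE.
    have /eqP := rotation_trace3 yn y1 uE; rewrite sqrf_eq1 => /orP[] /eqP; by [constructor 2|constructor 3].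
  move=> /cases[] tE /cases[] tE'; rewrite tE tE' => E; try (by left); try (by right).
  - by case: (natC 0); apply: (lin_comb (esym E)); ring.
  - by case: (natC 1); apply: (lin_comb (esym E)); ring.
  - by case: (natC 1); apply: (lin_comb (esym E)); ring.
  - by case: (natC 2); apply: (lin_comb (esym E)); ring.
- have z0 := root1_neq0 (isT : 0 < 4)%N zm.
  have z2 : z ^+ 2 != 1 by rewrite -(prim_order_dvd zP).
  have -> : z + z^-1 = 0.
    have : (z ^+ 2 - 1) * (z ^+ 2 + 1) = 0.
      have -> : (z ^+ 2 - 1) * (z ^+ 2 + 1) = z ^+ 4 - 1 by ring.
      by rewrite zm subrr.
    move/eqP; rewrite mulf_eq0 subr_eq0 (negPf z2) /= => /eqP E.
    by apply: (mulIf z0); apply: (lin_comb E); field.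
  have cases u : rotation_trace 4 u -> [\/ u = 0, u = 1, u = -1 | u ^+ 2 = 2%:R].
    move=> [n [y [ns yn y1 uE]]]; move: ns; rewrite !inE => /or3P[] /eqP nE; rewrite nE in yn.
    - by constructor 1; exact: rotation_trace2 yn y1 uE.
    - have /eqP := rotation_trace3 yn y1 uE; rewrite sqrf_eq1 => /orP[] /eqP; by [constructor 2|constructor 3].
    - by case: (rotation_trace4 yn y1 uE); [constructor 1 | constructor 4].
  move=> tc tc'; rewrite addr0 => /(canRL (addKr _)) E; move: tc'; rewrite {}E => /cases tc'.
  case/cases: tc => tE; try (by left); case: tc' => tE'; try (by right); exfalso;
    rewrite ?tE in tE'.
  + by case: (natC 1); apply: (lin_comb tE'); ring.
  + by case: (natC 2); apply: (lin_comb tE'); ring.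
  + by case: (natC 1); apply: (lin_comb tE'); ring.
  + by case: (natC 2); apply: (lin_comb tE'); ring.
  + by case: (natC 3); apply: (lin_comb tE'); ring.
  + by case: (natC 6); apply: (lin_comb tE'); ring.
  + have t2 : t = 2%:R by apply: (lin_comb (esym tE')); ring.
    by case: (natC 1); rewrite t2 in tE; apply: (lin_comb tE); ring.
  + have t3 : t = 3%:R by apply: (lin_comb (esym tE')); ring.
    by case: (natC 6); rewrite t3 in tE; apply: (lin_comb tE); ring.
  + have t3 : 4%:R * t = 4%:R * 1.
      by apply: (lin_comb (f_equal2 (fun a b => a - b) tE tE')); ring.
    have t1 : t = 1 by apply: (mulfI _ t3); rewrite pnatr_eq0.
    by case: (natC 0); rewrite t1 in tE; apply: (lin_comb (esym tE)); ring.
have wE := golden zm z1; set w := z + z^-1 in wE *.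
have cases u : rotation_trace 5 u -> exists2 x, x \in golden_seq & u = golden_val w x.
  move=> [n [y [ns yn y1 uE]]]; move: ns; rewrite !inE => /or3P[] /eqP nE; rewrite nE in yn.
  - exists (0, 0) => //; rewrite (rotation_trace2 yn y1 uE) /golden_val /=; ring.
  - apply: (@sqr_cases _ _ (1, 0)) => //; rewrite (rotation_trace3 yn y1 uE) /golden_val /=; ring.
  - case: (rotation_trace5 wE yn y1 uE) => uw.
      by apply: (@sqr_cases _ _ (1, 1)) => //; rewrite uw /golden_val /=; ring.
    by apply: (@sqr_cases _ _ (0, 1)) => //; rewrite uw /golden_val /=; ring.
by move=> /cases[x xs ->] /cases[y ys ->]; exact: golden_sum.
Qed.

End TraceDichotomy.

(** * A (2, 3, m) triple from two m-fold rotations *)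

Section ReflectionPairs.
Variable C : numClosedFieldType.
Implicit Types (P Q : 'M[C]_2) (a b z w l : C).
Local Open Scope ring_scope.

Lemma tr_rf2 a b P Q : is_proj P -> is_proj Q -> a != 0 -> b != 0 ->
  \tr (rf a P * rf b Q)%g = a + b + (a - 1) * (b - 1) * \tr (P *m Q).
Proof.
move=> pP pQ a0 b0; rewrite -[GLmx _]/(rf a P *m rf b Q) !rfE //.
rewrite mulmxDl mul1mx mulmxDr mulmx1 -scalemxAl -scalemxAr !mxtraceD !mxtraceZ mxtrace1 pP.1 pQ.1.
by ring.
Qed.

Lemma tr_projC P Q : is_proj P -> \tr (P *m (1%:M - Q)) = 1 - \tr (P *m Q).
Proof. by move=> pP; rewrite mulmxBr mulmx1 raddfB /= pP.1. Qed.

Lemma rf_commute2 a b P Q : is_proj P -> is_proj Q -> a != 0 -> a != 1 -> b != 0 -> b != 1 ->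
  commute (rf a P) (rf b Q) -> P *m Q = Q *m P.
Proof.
move=> pP pQ a0 a1 b0 b1 /(rf_commute (rf a P) pQ b0 b1).
rewrite rfE // mulmxDl mulmxDr mul1mx mulmx1 -scalemxAl -scalemxAr => /addrI.
by apply: scalerI; rewrite subr_eq0.
Qed.

Lemma rf_product_nonscalar a b P Q : is_proj P -> is_proj Q -> a != 0 -> a != 1 -> b != 0 -> b != 1 ->
  P *m Q <> Q *m P -> (rf a P * rf b Q)%g \notin scalars.
Proof.
move=> pP pQ a0 a1 b0 b1 nC; apply/negP => /scalarsP[c c0 E]; apply: (nC).
apply: (rf_commute2 pP pQ a0 a1 b0 b1).
have -> : rf b Q = ((rf a P)^-1 * scal c)%g by rewrite -E mulKg.
apply: commuteM; first exact/commuteV/commute_refl.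
exact/commute_sym/scal_central.
Qed.

(* The trace condition makes the product of [rf z Q] and [rf z P] a three-fold *)
(* rotation and its product with [rf z P] a half-turn.                         *)
Lemma rf_triple P Q z w l : is_proj P -> is_proj Q -> z != 0 -> z != 1 ->
  w ^+ 2 + w + 1 = 0 -> w != 1 -> l ^+ 2 = - (w * z) -> (z - 1) ^+ 2 * \tr (P *m Q) = - z ->
  exists b s t, [/\ b != 0, t = (scal b * (rf z Q * rf z P))%g,
    (s * t * rf z P)%g = scal l, refl (-1) s & refl w t].
Proof.
move=> pP pQ z0 z1 wE w1 lE qE.
have w0 : w != 0 by apply: contraTneq (oner_neq0 C) => w0; rewrite -wE w0 expr0n !add0r eqxx.
have l0 : l != 0 by rewrite -sqrf_eq0 lE oppr_eq0 mulf_neq0.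
have b0 : - (w ^+ 2 / z) != 0 by rewrite oppr_eq0 mulf_neq0 ?invr_neq0 ?expf_neq0.
(* The product of [rf z Q] and [rf z P] has trace [z] and determinant [z ^+ 2]; [b] rescales them to
   [- w ^+ 2 = 1 + w] and [w ^+ 4 = w]. *)
pose b := - (w ^+ 2 / z); pose u := rf z P.
have qE' : (z - 1) ^+ 2 * \tr (Q *m P) = - z by rewrite mxtrace_mulC.
pose t := (scal b * (rf z Q * u))%g; pose s := (scal l * (t * u)^-1)%g.
have rt : refl w t.
  split=> //; rewrite /t.
    rewrite scal_mulE // mxtraceZ tr_rf2 // -expr2 qE' /b.
    by apply: (lin_comb (esym wE)); field.
  rewrite !GL_detM scalE // det_scalar !rfE // !det_rf // /b.
  have w3 : w ^+ 3 = 1 by apply: (lin_comb (congr1 (fun x => (w - 1) * x) wE)); ring.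
  by apply: (lin_comb (congr1 (fun x => w * x) w3)); field.
have [trt dett _] := rt.
have detu : \det u = z by rewrite rfE // det_rf.
have trtu : \tr (t * u)%g = 0.
  have -> : (t * u)%g = (scal b * (rf z Q * rf (z ^+ 2) P))%g.
    by rewrite /t -!mulgA rfM // expr2.
  rewrite scal_mulE // mxtraceZ tr_rf2 ?expf_neq0 //.
  have -> : (z - 1) * (z ^+ 2 - 1) * \tr (Q *m P) = (z + 1) * ((z - 1) ^+ 2 * \tr (Q *m P)) by ring.
  by rewrite qE'; ring.
exists b, s, t; split=> //.
  by rewrite /s -!mulgA mulVg mulg1.
split; last by rewrite -subr_eq0 -opprD oppr_eq0 -(natrD C 1 1) pnatr_eq0.
  by rewrite scal_mulE // mxtraceZ GL_trV trtu mul0r mulr0 subrr.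
rewrite GL_detM scalE // det_scalar GL_detV GL_detM dett detu lE mulNr divff //.
by rewrite mulf_neq0.
Qed.

End ReflectionPairs.

Section PolyhedralPairs.
Variables (C : numClosedFieldType) (gT : finGroupType) (rho : {multiplicative gT -> GL 2 C}).
Hypothesis rho_inj : injective rho.
Implicit Types (g h : gT) (A : GL 2 C).
Local Notation Z := (scZ rho).
Local Notation e g := (torus_rank rho g).
Variable m : nat.
Hypothesis m345 : m \in [:: 3; 4; 5]%N.
Hypothesis ranks : forall g, g \notin Z -> e g \in [:: 2; 3; m].

Lemma scaled_rotation A (t : C) : scaled_image rho A -> A \notin scalars ->
  (t ^+ 2 * \det A = (\tr A) ^+ 2)%R -> rotation_trace m t.
Proof.
move=> [c [g [c0 AE]]]; rewrite AE scalarsMl // -scZP => ng.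
have [P tP] := torus_projP ng; have pP := tP.1; have gC := cent1id g.
have [d [b [d0 b0 gE]]] := torus_form rho_inj tP gC.
have be := torus_form_exp rho_inj ng tP gC d0 b0 gE.
have b1 : (b != 1)%R by move: ng; rewrite scZP gE scalarsMl // rf_scalar.
rewrite gE !GL_detM !scalE // !det_scalar rfE // det_rf // scal_mulE // scal_mulE //.
rewrite rfE // scalerA mxtraceZ mxtraceD mxtraceZ mxtrace1 pP.1 => E.
exists (e g), b; split=> //; first exact: ranks.
have cd0 : (c * d != 0)%R by rewrite mulf_neq0.
by apply: (mulfI (expf_neq0 2 cd0)); apply: (lin_comb E); ring.
Qed.

(** The rescaled traces for [Q] and for its complement add up to [2 + z + z^-1], because the traces
    of the products of [P] with the two projections add up to 1. By [rotation_trace_sum] one of them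
    is 1. *)
Lemma torus_pair g g' P Q (z : C) : g \notin Z -> g' \notin Z -> e g = m -> e g' = m ->
  torus_proj rho g P -> torus_proj rho g' Q -> (m.-primitive_root z)%R ->
  (P *m Q)%R <> (Q *m P)%R ->
  ((z - 1) ^+ 2 * \tr (P *m Q) = - z)%R \/ ((z - 1) ^+ 2 * \tr (P *m (1%:M - Q)) = - z)%R.
Proof.
move=> ng ng' em em' tP tQ zP nC; have zm := prim_expr_order zP.
have m0 : (0 < m)%N by move: m345; rewrite !inE => /or3P[] /eqP ->.
have z0 : (z != 0)%R := root1_neq0 m0 zm.
have z1 : (z != 1)%R.
  rewrite -(expr1 z) -(prim_order_dvd zP) dvdn1.
  by move: m345; rewrite !inE => /or3P[] /eqP ->.
have pP := tP.1; have pQ := tQ.1; have pQ' := proj_compl pQ; have tQ' := torus_proj_compl tQ.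
have rot Q' : torus_proj rho g' Q' -> (P *m Q')%R <> (Q' *m P)%R ->
    rotation_trace m (2%:R + (z - 1) ^+ 2 * \tr (P *m Q') / z)%R.
  move=> tQ0 nC'; have pQ0 := tQ0.1.
  apply: (@scaled_rotation (rf z P * rf z Q')).
  - by apply: scaled_imageM; [apply: scaled_torus tP _ | apply: scaled_torus tQ0 _];
      rewrite ?em ?em'.
  - exact: rf_product_nonscalar.
  - have -> : (\det (rf z P * rf z Q')%g = z * z)%R by rewrite GL_detM !rfE // !det_rf.
    rewrite (tr_rf2 pP pQ0 z0 z0).
    by field.
have nC' : (P *m (1%:M - Q))%R <> ((1%:M - Q) *m P)%R.
  by rewrite mulmxBr mulmxBl mulmx1 mul1mx => /addrI/oppr_inj.
have := rotation_trace_sum m345 zP (rot _ tQ nC) (rot _ tQ' nC').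
rewrite tr_projC //; set q := (\tr _)%R.
case=> [|E|E]; first by field.
  by left; apply: (mulIf (invr_neq0 z0)); apply: (lin_comb E); field.
by right; apply: (mulIf (invr_neq0 z0)); apply: (lin_comb E); field.
Qed.

End PolyhedralPairs.

Lemma prim_root_exp (F : fieldType) (l : F) N k n : (N.-primitive_root l)%R -> N = (k * n)%N ->
  (k.-primitive_root (l ^+ n))%R.
Proof.
move=> lP NE; have := exp_prim_root lP n; have := prim_order_gt0 lP.
by rewrite NE muln_gt0 => /andP[k0 n0]; rewrite gcdnMl mulnK.
Qed.

(** * Polyhedral groups are covered by J(2, 3, m) *)

Section Polyhedral.
Variables (C : numClosedFieldType) (gT : finGroupType) (rho : {multiplicative gT -> GL 2 C}).
Hypothesis rho_inj : injective rho.
Hypothesis roots : forall n, (0 < n)%N -> exists l : C, (n.-primitive_root l)%R.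
Implicit Types (g h : gT) (A : GL 2 C).
Local Notation Z := (scZ rho).
Local Notation e g := (torus_rank rho g).
Local Notation f g := (torus_weyl g).
Local Notation U g := (torus_class rho g).

Section Covered.
Variables (K : 'I_3 -> option nat) (phi : {multiplicative Jgroup K -> GL 2 C}).

Definition covered A := exists i j x, A = (phi (Jgen K i) ^+ j) ^ phi x.
Hypothesis full : forall g, exists c x, (c != 0)%R /\ rho g = scal c * phi x.

Lemma covered_gen i : covered (phi (Jgen K i)).
Proof. by exists i, 1%N, 1; rewrite mult1 conjg1. Qed.

Lemma coveredX A n : covered A -> covered (A ^+ n).
Proof. by move=> [i [j [x ->]]]; exists i, (j * n)%N, x; rewrite expgnA -conjXg. Qed.

Lemma conj_scaled A B c : A ^ (scal c * B) = A ^ B.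
Proof. by rewrite conjgM; congr (_ ^ _); rewrite /conjg -(scal_central c A) mulKg. Qed.

Lemma coveredJ A g : covered A -> covered (A ^ rho g).
Proof.
move=> [i [j [x ->]]]; have [c [y [c0 ->]]] := full g.
by exists i, j, (x * y); rewrite conj_scaled gmulfM conjgM.
Qed.

Lemma covered_swap g P z : g \notin Z -> torus_proj rho g P -> f g = 2%N -> (z != 0)%R ->
  covered (rf z P) -> covered (rf z (1%:M - P)%R).
Proof.
move=> ng tP fg z0 cov; have [x xP] := torus_swap rho_inj ng tP fg.
by rewrite -xP -rfJ ?tP.1 //; [exact: coveredJ | exact: tP.1].
Qed.

(** Up to conjugacy the reflection lies in the torus of [g], so it is a power of the reflection
    along [P] or along its complement; both ends of the axis have to be covered. *)
Lemma torus_covered g P z h a : g \notin Z -> torus_proj rho g P -> ((e g).-primitive_root z)%R ->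
  covered (rf z P) -> covered (rf z (1%:M - P)%R) ->
  h \in U g -> refl a (rho h) -> covered (rho h).
Proof.
move=> ng tP zP cov cov' /torus_classP[x nh hx] rh.
have eg0 : (0 < e g)%N by exact/ltnW/torus_rank_gt1.
have z0 : (z != 0)%R := root1_neq0 eg0 (prim_expr_order zP).
have rhx : refl a (rho (h ^ x)) by rewrite multJ; exact: reflJ.
have [j aE] := prim_rootP zP (refl_torus_rank rho_inj ng hx rhx).
have pP := tP.1; have pP' := proj_compl pP.
have : covered (rho (h ^ x)).
  by case: (torus_refl rho_inj ng hx tP rhx) => ->; rewrite aE -rfX //; exact: coveredX.
by move/(coveredJ x^-1); rewrite -multJ conjgK.
Qed.

End Covered.

Lemma gen_torus A a : scaled_image rho A -> refl a A ->
  exists P g, [/\ A = rf a P, g \notin Z, torus_proj rho g P & (a ^+ e g = 1)%R].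
Proof.
move=> [c [g [c0 AE]]] rA; have [P pP AP] := reflE rA; have [_ _ a1] := rA.
have a0 := refl_neq0 rA.
have gE : rho g = scal c^-1%R * rf a P by rewrite -AP AE -scalV // mulKg.
have cV : (c^-1 != 0)%R by rewrite invr_neq0.
have ng : g \notin Z by rewrite scZP gE scalarsMl // rf_scalar.
have tP : torus_proj rho g P by split=> //; exists c^-1%R, a.
exists P, g; split=> //; exact: torus_form_exp (cent1id g) cV a0 gE.
Qed.

(* By the bound on the number of cosets, [phi] meets every class of scalars. *)
Lemma cosets_full (X : groupType) (phi : {multiplicative X -> GL 2 C}) (s : seq X) :
  (forall x, scaled_image rho (phi x)) -> size s = #|[set: gT] : Z| ->
  pairwise (fun x y => (phi x)^-1 * phi y \notin scalars) s ->
  forall g, exists c x, (c != 0)%R /\ rho g = scal c * phi x.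
Proof.
move=> im sN ps g.
have /choice[r rP] : forall x, exists h, exists2 c : C, (c != 0)%R & phi x = scal c * rho h.
  by move=> x; have [c [h [c0 xE]]] := im x; exists h, c.
have same x y : (r x)^-1 * r y \in Z -> (phi x)^-1 * phi y \in scalars.
  rewrite scZP; have [c c0 ->] := rP x; have [d d0 ->] := rP y.
  rewrite gmulfM multV => xyZ.
  have -> : (scal c * rho (r x))^-1 * (scal d * rho (r y)) =
      scal (c^-1 * d)%R * ((rho (r x))^-1 * rho (r y)).
    rewrite invgM scalV // -scalM ?invr_neq0 // -(scal_central c^-1%R (rho (r x))^-1) -!mulgA.
    by congr (_ * _); rewrite !mulgA (scal_central d).
  by rewrite scalarsMl // mulf_neq0 ?invr_neq0.
pose cs := [seq r x *: Z | x <- s].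
have ucs : uniq cs.
  rewrite uniq_pairwise pairwise_map; apply: sub_pairwise ps => x y /=.
  by apply: contraNneq => /lcoset_eqP; rewrite mem_lcoset => xy; apply: same; rewrite -groupV invgM invgK.
have : g *: Z \in cs.
  have sub : {subset cs <= lcosets Z [set: gT]}.
    by move=> _ /mapP[x _ ->]; apply/lcosetsP; exists (r x); rewrite ?finset.in_setT.
  have [||_ E] := @uniq_min_size _ cs (enum (lcosets Z [set: gT])) ucs.
  - by move=> D /sub; rewrite mem_enum.
  - by rewrite size_map sN -cardE card_lcosets.
  by rewrite E mem_enum; apply/lcosetsP; exists g; rewrite ?finset.in_setT.
case/mapP=> x _ /lcoset_eqP; rewrite mem_lcoset scZP gmulfM multV => /scalarsP[c c0 cE].
have [d d0 xE] := rP x.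
exists (c * d^-1)%R, x; rewrite mulf_neq0 ?invr_neq0 //; split=> //.
rewrite xE -scalM ?invr_neq0 // -scalV // -!mulgA mulKg scal_central.
by rewrite -cE mulVKg.
Qed.

End Polyhedral.

Section PolyhedralCover.
Variables (C : numClosedFieldType) (gT : finGroupType) (rho : {multiplicative gT -> GL 2 C}).
Hypothesis rho_inj : injective rho.
Implicit Types (g h : gT) (A : GL 2 C).
Local Notation Z := (scZ rho).
Local Notation e g := (torus_rank rho g).
Local Notation f g := (torus_weyl g).
Local Notation U g := (torus_class rho g).

(** The second torus is a conjugate of the first. If the projections commuted, the two centralisers
    would coincide and the conjugating element would normalise the torus. *)
Lemma noncommuting_tori g : g \notin Z -> (1 < torus_conj g)%N ->
  exists g' P Q, [/\ g' \notin Z, e g' = e g, torus_proj rho g P, torus_proj rho g' Q &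
    (P *m Q)%R <> (Q *m P)%R].
Proof.
move=> ng; rewrite indexg_gt1 => /subsetPn[x _ xN].
have [P tP] := torus_projP ng; have nx : g ^ x \notin Z by rewrite scZJ.
exists (g ^ x), P, (conj_proj P (rho x)); split=> //.
- have gU : g ^ x \in U g by apply/torus_classP; exists x^-1; rewrite ?conjgK ?cent1id.
  by have [] := torus_class_invariants rho_inj ng gU.
- exact: torus_proj_conj.
move=> PQ; case/negP: xN; rewrite inE -cent1J; apply/fintype.subsetP => y.
have [_ [c [a [[c0 a0 a1] gE]]]] := torus_proj_conj x tP.
rewrite (cent1_eq rho_inj ng) //; apply/(torus_proj_cent rho_inj _ tP).
rewrite gE; have -> : (GLmx (scal c * rf a (conj_proj P (rho x)))%g =
    c *: (1%:M + (a - 1) *: conj_proj P (rho x)))%R.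
  by rewrite scal_mulE // rfE //; exact: proj_conj tP.1.
by rewrite -scalemxAl -scalemxAr mulmxDl mulmxDr mul1mx mulmx1 -scalemxAl -scalemxAr PQ.
Qed.

(* the generators [t] and [u] of J(2, 3, 3) are told apart by a linear character *)
Lemma J233_not_conj (K : 'I_3 -> option nat) (w : C) x : (w ^+ 3 = 1)%R -> (w != 1)%R ->
  K o30 = Some 2%N -> K o31 = Some 3%N -> Jgen K o32 ^ x <> Jgen K o31.
Proof.
move=> w3 w1 K0 K1; have w0 : (w != 0)%R := root1_neq0 (isT : 0 < 3)%N w3.
pose ch (i : 'I_3) : GL 2 C := if i == o31 then scal w else 1.
have [||chi chiE] := @Jgroup_lift _ K _ ch.
- move=> i; rewrite enum_ord3 !big_cons big_nil /ch /= mulg1 mul1g mulg1; exact: scal_central.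
- move=> i k Ki; rewrite /ch; case: eqP => [i1|_]; last by rewrite expg1n.
  move: Ki; rewrite i1 K1 => -[<-]; rewrite scalX // w3; exact: scal1.
move=> /(congr1 chi); rewrite multJ !chiE /ch /= conj1g -scal1 => /scal_inj E.
by case/eqP: w1; rewrite E ?oner_neq0.
Qed.

Variables (m : nat).
Hypothesis roots : forall n, (0 < n)%N -> exists l : C, (n.-primitive_root l)%R.
Hypothesis poly : polyhedral_type rho m.
Hypothesis primitive : forall g, g \notin Z -> (1 < torus_conj g)%N.

Lemma polyhedral_cover : spherical_cover rho.
Proof.
have [Ncase ranks [g ng em] classes weyls] := poly.
have m345 : m \in [:: 3; 4; 5] by case: Ncase => -[_ ->].
have [m1 msph] : (1 < m)%N /\ (2 * 3 * m < 3 * m + 2 * m + 2 * 3)%N.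
  by move: m345; rewrite !inE => /or3P[] /eqP ->.
have [N [n2 [n3 [nm [N0 [N2 N3 Nm] nE bound]]]]] :=
  coset_bound_spherical (isT : 1 < 2)%N (isT : 1 < 3)%N m1 msph.
have NE : N = #|[set: gT] : Z| by case: Ncase Nm => -[-> ->]; lia.
have [l lP] := roots N0; have lN := prim_expr_order lP.
have l0 : (l != 0)%R := root1_neq0 N0 lN.
have lN2 : (l ^+ 2 = l ^+ n2 * l ^+ n3 * l ^+ nm)%R.
  by rewrite -!exprD nE exprD lN mul1r.
have yP := prim_root_exp lP N2; have wP := prim_root_exp lP N3; have zP := prim_root_exp lP Nm.
(* For [m = 3] the generators [t] and [u] have the same eigenvalue; this lets [u] take over the
   second end of the axis of [t] below. *)
have zw : m = 3%N -> (l ^+ nm = l ^+ n3)%R by move=> m3; congr (_ ^+ _)%R; lia.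
move: (l ^+ n2)%R (l ^+ n3)%R (l ^+ nm)%R lN2 yP wP zP zw => y w z lN2 yP wP zP zw.
have prim_neq k (x : C) : (k.-primitive_root x)%R -> (1 < k)%N -> (x != 1)%R.
  by move=> xP k1; rewrite -(expr1 x) -(prim_order_dvd xP) dvdn1 gtn_eqF.
have w3 := prim_expr_order wP; have z_exp := prim_expr_order zP.
have w1 := prim_neq _ _ wP isT; have z1 := prim_neq _ _ zP m1.
have z0 : (z != 0)%R := root1_neq0 (ltnW m1) z_exp.
have wE : (w ^+ 2 + w + 1 = 0)%R.
  have := geometric_sum0 w3 w1; rewrite !big_ord_recl big_ord0 /= => E.
  by apply: (lin_comb E); rewrite /bump /=; ring.
have yE : (y = -1)%R.
  have := geometric_sum0 (prim_expr_order yP) (prim_neq _ _ yP isT).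
  by rewrite !big_ord_recl big_ord0 /= => E; apply: (lin_comb E); ring.
have lE : (l ^+ 2 = - (w * z))%R by rewrite lN2 yE; ring.
have [g' [P [Q0 [ng' eg' tP tQ0 nC]]]] := noncommuting_tori ng (primitive ng).
rewrite em in eg'.
have [Q [tQ qE]] : exists Q, torus_proj rho g' Q /\ ((z - 1) ^+ 2 * \tr (P *m Q) = - z)%R.
  have tQ0' := torus_proj_compl tQ0.
  by case: (torus_pair rho_inj m345 ranks ng ng' em eg' tP tQ0 zP nC) => qE;
    [exists Q0 | exists (1%:M - Q0)%R].
have pP := tP.1; have pQ := tQ.1.
have [b [s [t [b0 tE stu rs rt]]]] := rf_triple pP pQ z0 z1 wE w1 lE qE.
have ru := refl_rf pP z0 z1; set u := rf z P in tE stu ru.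
have n2E : ((-1) ^+ 2 = 1 :> C)%R by rewrite expr2 mulrNN mulr1.
pose k (i : 'I_3) := nth m [:: 2; 3; m] i; pose K i := Some (k i).
have [phi [ps pt pu]] := GL_triple_lift (erefl : K o30 = Some 2%N) (erefl : K o31 = Some 3%N)
  (erefl : K o32 = Some m) rs rt ru n2E w3 z_exp stu.
have n1 : (-1 != 1 :> C)%R by case: rs.
have n2P j : ((-1) ^+ j = 1 :> C)%R -> (2 %| j)%N.
  by rewrite -signr_odd dvdn2; case: (odd j) => //= /eqP; rewrite expr1 (negPf n1).
have w3P j : (w ^+ j = 1)%R -> (3 %| j)%N by move/eqP; rewrite -(prim_order_dvd wP).
have zmP j : (z ^+ j = 1)%R -> (m %| j)%N by move/eqP; rewrite -(prim_order_dvd zP).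
have lNP j : (l ^+ j = 1)%R -> (N %| j)%N by move/eqP; rewrite -(prim_order_dvd lP).
have [phi_inj [cs csN csP]] : injective phi /\
    exists2 s, size s = N & pairwise (fun x y => (phi x)^-1 * phi y \notin scalars) s.
  apply: (@J3_faithful _ K 2 3 m N phi (-1)%R w z l); rewrite ?ps ?pt ?pu //; first exact: ltnW.
  by rewrite !gmulfM ps pt pu.
have scu : scaled_image rho u by apply: scaled_torus tP _; rewrite ?em.
have sct : scaled_image rho t.
  rewrite tE; apply: scaled_imageM; first exact: scaled_scal.
  by apply: scaled_imageM => //; apply: scaled_torus tQ _; rewrite ?eg'.
have scs : scaled_image rho s.
  have -> : s = scal l * (t * u)^-1 by rewrite -stu -(mulgA s) mulgK.
  by apply: scaled_imageM; [exact: scaled_scal | apply/scaled_imageV/scaled_imageM].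
have im : forall x, scaled_image rho (phi x).
  by apply: scaled_image_J => i; case: (ord3_cases i) => ->; rewrite ?ps ?pt ?pu.
have full := cosets_full im (etrans csN NE) csP.
exists K, k, phi; split=> //.
  by move=> i; split=> //; case: (ord3_cases i) => ->.
have [Qs [gs [sE ngs tS es1]]] := gen_torus rho_inj scs rs.
have [Qt [gt [tE' ngt tT et1]]] := gen_torus rho_inj sct rt.
have cov_s : covered phi (rf (-1)%R Qs) by rewrite -sE -ps; exact: covered_gen.
have cov_t : covered phi (rf w Qt) by rewrite -tE' -pt; exact: covered_gen.
have cov_u : covered phi (rf z P) by rewrite -/u -pu; exact: covered_gen.
have et : e gt = 3.
  move: (ranks gt ngt) (w3P _ et1); rewrite !inE => /or3P[] /eqP -> //.
  by move: m345; rewrite !inE => /or3P[] /eqP ->.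
(* Up to a scalar [s * u] is conjugate to [t^-1], a three-fold rotation; this trace serves to locate
   the axis of [s]. *)
have trsu : (\tr (s * u)%g ^+ 2 = - z)%R.
  have -> : s * u = scal l * (t^-1 ^ u).
    have -> : s = scal l * (t * u)^-1 by rewrite -stu -(mulgA s) mulgK.
    by rewrite invgM /conjg !mulgA.
  have [trt dett _] := rt; have w0 := root1_neq0 (isT : 0 < 3)%N w3.
  rewrite scal_mulE // mxtraceZ GL_trJ GL_trV trt dett exprMn lE.
  have -> : ((1 + w) / w = - w)%R by apply: (mulIf w0); apply: (lin_comb wE); field.
  by apply: (lin_comb (congr1 (fun x => - z * x)%R w3)); ring.
(* For [m = 4] the half-turn [s] could be the square of a four-fold rotation. Then either [P] and
   [Qs] commute and [q] is 0 or 1, or [torus_pair] gives [2 q = 1]; both contradict [qsq], which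
   comes from [trsu]. *)
have es : e gs = 2.
  move: (ranks gs ngs) (n2P _ es1); rewrite !inE => /or3P[] /eqP esm; rewrite esm //.
  have := m345; rewrite !inE => /or3P[] /eqP m4; rewrite m4 // => _; exfalso.
  have z2 : (z ^+ 2 = -1)%R.
    have z2P := prim_root_exp zP (m4 : m = 2 * 2)%N.
    have := geometric_sum0 (prim_expr_order z2P) (prim_neq _ _ z2P isT).
    by rewrite !big_ord_recl big_ord0 /= => E; apply: (lin_comb E); ring.
  pose q := (\tr (P *m Qs))%R.
  have half x : ((z - 1) ^+ 2 * x = - z -> 2%:R * x = 1)%R.
    move=> E; apply: (mulfI z0); apply: (lin_comb (congr1 (fun a => - a)%R E)).
    have -> : ((z - 1) ^+ 2 = - (2%:R * z) + (z ^+ 2 + 1))%R by ring.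
    by rewrite z2; ring.
  have qsq : (2%:R * (1 - 2%:R * q) ^+ 2 = 1)%R.
    apply: half; rewrite -trsu sE tr_rf2 ?tS.1 ?oppr_eq0 ?oner_eq0 //; last exact: tS.1.
    by rewrite (mxtrace_mulC Qs) -/q; ring.
  have [PQ|PQ] := pselect (P *m Qs = Qs *m P)%R.
    have q01 : q = 1%R \/ q = 0%R.
      rewrite /q; case: (proj_commute_eq pP tS.1 PQ) => ->; first by left; rewrite (proj_idem pP) pP.1.
      by right; rewrite tr_projC // (proj_idem pP) pP.1 subrr.
    have /eqP : (1 : C)%R = 0%R.
      by case: q01 => qv; rewrite qv in qsq; apply: (lin_comb qsq); ring.
    by rewrite oner_eq0.
  have q2 : (2%:R * q = 1)%R.
    case: (torus_pair rho_inj m345 ranks ng ngs em esm tP tS zP PQ) => /half //.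
    by rewrite tr_projC // -/q => E; apply: (lin_comb (esym E)); ring.
  by move/eqP: qsq; rewrite q2 subrr expr0n mulr0 eq_sym oner_eq0.
have cov_s' : covered phi (rf (-1)%R (1%:M - Qs)%R).
  apply: covered_swap tS _ _ cov_s => //; last by rewrite oppr_eq0 oner_eq0.
  by case: (weyls gs ngs) => // -[_]; rewrite es.
have w0 : (w != 0)%R := root1_neq0 (isT : 0 < 3)%N w3.
(* In the tetrahedral case the ends of the axis of [t] need not be exchanged. A conjugate of [u]
   lies on this axis; were it on the same end, it would equal [t], and [t] and [u] would be
   conjugate in J(2, 3, 3), against [J233_not_conj]. *)
have cov_t' : covered phi (rf w (1%:M - Qt)%R).
  have [fgt|[m3 _]] := weyls gt ngt; first exact: covered_swap tT fgt w0 cov_t.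
  have /torus_classP[x _ gx] : g \in U gt by apply: classes; rewrite // et em.
  have ngx : g ^ x \notin Z by rewrite scZJ.
  have uE : u ^ rho x = rf w (conj_proj P (rho x)) by rewrite /u zw // rfJ // -zw.
  case: (torus_proj_unique rho_inj (torus_proj_other rho_inj ngt ngx gx tT) (torus_proj_conj x tP)) => PE.
    have [c [y' [_ xE]]] := full x.
    have /phi_inj E : phi (Jgen K o32 ^ y') = phi (Jgen K o31).
      by rewrite multJ pu pt tE' -PE -uE xE conj_scaled.
    by case: (@J233_not_conj K w y' w3 w1 erefl erefl).
  by rewrite -PE -uE -pu; apply: coveredJ => //; exact: covered_gen.
move=> h a rh; have nh : h \notin Z by rewrite scZP; exact: refl_nonscalar rh.
have [eh|eh2] := eqVneq (e h) 2%N.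
  apply: (torus_covered rho_inj full ngs tS _ cov_s cov_s' _ rh); first by rewrite es -yE.
  by apply: classes; rewrite ?es.
have [eh|eh3] := eqVneq (e h) 3%N.
  apply: (torus_covered rho_inj full ngt tT _ cov_t cov_t' _ rh); first by rewrite et.
  by apply: classes; rewrite ?et.
have eh : e h = m.
  by move: (ranks h nh); rewrite !inE (negPf eh2) (negPf eh3) => /eqP.
apply: (torus_covered rho_inj full ng tP _ cov_u _ _ rh); first by rewrite em.
  apply: covered_swap tP _ z0 cov_u => //.
  case: (weyls g ng) => // -[m3 _]; by rewrite eh m3 in eh3.
by apply: classes; rewrite ?em.
Qed.

End PolyhedralCover.

Section FiniteSubgroup.
Variables (H : groupType) (s : seq H).
Hypothesis s_group : group_closed [in s].

(** The closure proof is an argument so that the group structure below can be attached to the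
    type. *)
Definition finite_subgroup of group_closed [in s] := seq_sub s.
Local Notation gT := (finite_subgroup s_group).

HB.instance Definition _ := Finite.on gT.
HB.instance Definition _ := SubChoice.on gT.
HB.instance Definition _ := SubChoice_isSubGroup.Build H [in s] gT s_group.

Definition finite_subgroup_val (x : gT) : H := val x.

Lemma finite_subgroup_valM : {morph finite_subgroup_val : x y / x * y}.
Proof. by move=> x y; exact: valM. Qed.

HB.instance Definition _ := isMultiplicative.Build _ _ finite_subgroup_val finite_subgroup_valM.

Lemma finite_subgroup_rep : exists (gT : finGroupType) (rho : {multiplicative gT -> H}),
  injective rho /\ forall w, w \in s <-> exists g, rho g = w.
Proof.
exists gT, finite_subgroup_val; split; first exact: val_inj.
move=> w; split=> [ws|[g <-]]; last exact: valP.
by exists (Sub w ws); exact: SubK.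
Qed.

End FiniteSubgroup.

Lemma finite_set_rep (H : groupType) (W : set H) : is_subgroup W -> finite_set W ->
  exists (gT : finGroupType) (rho : {multiplicative gT -> H}),
    injective rho /\ forall w, W w <-> exists g, rho g = w.
Proof.
move=> Wg /finite_seqP[s sE]; have sW w : (w \in s) <-> W w by rewrite sE.
have s_group : group_closed [in s].
  split; first exact: (sW 1).2 (subgroup1 Wg).
  by move=> x y xs ys; exact: (sW _).2 (Wg.2 _ _ ((sW x).1 xs) ((sW y).1 ys)).
have [gT [rho [rho_inj rhoP]]] := finite_subgroup_rep s_group.
by exists gT, rho; split=> // w; rewrite -rhoP; apply: iff_sym.
Qed.

Section Converse.
Variable R : realType.
Local Notation C := (R[i])%C.
Variables (W : set (GL 2 C)) (G : groupType).
Hypothesis W_refl : rank2_reflection_group W.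
Hypothesis isoG : isomorphic_to G W.
Variables (gT : finGroupType) (rho : {multiplicative gT -> GL 2 C}).
Hypothesis rho_inj : injective rho.
Hypothesis rhoP : forall w, W w <-> exists g, rho g = w.

Lemma spherical_cover_J : spherical_cover rho -> isomorphic_to_finite_generalized_J G.
Proof.
move=> [K [k [phi [Kk phi_inj im cov]]]].
apply: (@reflection_group_is_J _ W 3 K k phi W_refl) isoG => //.
- by move=> i; have [-> _] := Kk i.
- by move=> i; have [_ ->] := Kk i.
- move=> x w /rhoP[g <-]; have [c [h [_ ->]]] := im x; apply/rhoP; exists (g ^ h).
  by rewrite conj_scaled multJ.
- by move=> w a /rhoP[g <-]; exact: cov.
Qed.

(** Three situations: all elements are scalar; some torus has a single conjugate, and then the group
    is abelian if the torus is everything, monomial otherwise; every torus has several conjugates,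
    the polyhedral case. *)
Lemma reflection_group_isomorphic_to_J : isomorphic_to_finite_generalized_J G.
Proof.
have roots n : (0 < n)%N -> exists l : C, (n.-primitive_root l)%R.
  by move=> n0; exists (unity R n); exact: unity_primitive.
have [[g ng]|central] := pselect (exists g, g \notin scZ rho); last first.
  (* Scalars commute with every projection; diag(1, 0) is taken. *)
  apply: (@abelian_reflection_group _ W (mk2 1 0 0 0)%R _ W_refl) isoG => [|w /rhoP[g <-]].
    by split; rewrite ?tr_mx2 ?det_mk2 ?mk2E ?addr0 // mulr0 mulr0 subr0.
  have : g \in scZ rho by apply/negPn/negP => ng; apply: central; exists g.
  by rewrite scZP => /scalarsP[c c0 ->]; rewrite (scalE c0); exact/esym/scalar_mxC.
have [[{ng} g [ng cg]]|prim] := pselect (exists g, g \notin scZ rho /\ torus_conj g = 1%N); last first.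
  have prim' h : h \notin scZ rho -> (1 < torus_conj h)%N.
    move=> nh; rewrite ltn_neqAle indexg_gt0 andbT; apply/eqP => ch.
    by apply: prim; exists h.
  have [m poly] := polyhedral_exists rho_inj (ex_intro _ g ng) prim'.
  exact: spherical_cover_J (polyhedral_cover rho_inj roots poly prim').
have [CG|CG] := eqVneq 'C[g] [set: gT]; last first.
  exact: spherical_cover_J (monomial_cover rho_inj roots ng cg CG).
have [P tP] := torus_projP ng.
apply: (@abelian_reflection_group _ W P _ W_refl tP.1) isoG => w /rhoP[h <-].
by apply/(torus_proj_cent rho_inj h tP); rewrite CG finset.in_setT.
Qed.

End Converse.

Theorem corollary1p4 (R : realType) (G : groupType) :
  isomorphic_to_finite_generalized_J G <->
  exists2 W : set (GL 2 R[i]), rank2_reflection_group W & isomorphic_to G W.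
Proof.
split; first exact: finite_J_is_reflection_group.
move=> [W W_refl isoG]; have [Wg finW _] := W_refl.
have [gT [rho [rho_inj rhoP]]] := finite_set_rep Wg finW.
exact: (reflection_group_isomorphic_to_J W_refl isoG rho_inj rhoP).
Qed.
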